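(* Let $\mathcal{K}_{o,2+}^{PM}$ be the family of origin-symmetric convex disks in $\mathbb{R}^2$ with $C^2$-class boundary and strictly positive curvature, equipped with the topology induced by the perimeter measure distance $d_{PM}$. A typical element $C \in \mathcal{K}_{o,2+}^{PM}$ does not satisfy the Quadrangle Property; that is, the set of those $C\in\mathcal{K}_{o,2+}^{PM}$ that do not satisfy the Quadrangle Property is residual in $\mathcal{K}_{o,2+}^{PM}$.
   Context: A convex disk is a compact, convex set with nonempty interior in $\mathbb{R}^2$. A residual set of a topological space is a countable intersection of sets having dense interiors; elements of a residual set are called typical. **$C$-convexity.** Let $C$ be an origin-symmetric convex disk. For $p,q\in\mathbb{R}^2$, the $C$-spindle $[p,q]_C$ is the intersection of all translates of $C$ containing both $p$ and $q$; if there is no such translate, $[p,q]_C=\mathbb{R}^2$. A convex disk $K$ is $C$-convex if $[p,q]_C\subseteq K$ for all $p,q\in K$; equivalently, $K$ is an intersection of translates of $C$. **The regions $r_K(p,q)$.** Let $K$ be a $C$-convex disk. For distinct $p,q\in\operatorname{bd}(K)$, let $\widehat{pq}$ be the arc of $\operatorname{bd}(K)$ from $p$ to $q$ in counterclockwise direction. Let $r_K(p,q)$ be the region bounded by $\widehat{pq}$ and the arc in the boundary of $[p,q]_C$ that runs from $p$ to $q$ in counterclockwise direction. A point $q\in \operatorname{bd}(K)$ is antipodal to $p\in\operatorname{bd}(K)$ if $K$ has parallel supporting lines at $p$ and $q$. The arc $\widehat{pq}$ has turning angle strictly less than $\pi$ if it contains no point antipodal to $p$. **Quadrangle Property.** $C$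 satisfies the Quadrangle Property if for any $C$-convex disk $K$ and any boundary points $x_1,x_2,x_3,x_4$ of $K$ in this counterclockwise order such that $\widehat{x_1x_4}$ has turning angle strictly less than $\pi$, $$\operatorname{area}(r_K(x_1,x_4))+\operatorname{area}(r_K(x_2,x_3)) \geq \operatorname{area}(r_K(x_1,x_3))+ \operatorname{area}(r_K(x_2,x_4)).$$ **PM-distance.** For a convex disk $K$ and a Borel set $\sigma\subseteq\mathbb{S}^1$, let $N_K(\sigma)$ be the set of boundary points $p$ of $K$ at which some element of $\sigma$ is an outer unit normal vector of $K$, and let the surface area measure $A_K(\sigma)$ be the one-dimensional Hausdorff measure of $N_K(\sigma)$. Let $\mathcal{H}(\sigma)$ denote the one-dimensional Hausdorff measure of $\sigma$. For origin-symmetric convex disks $C,D$, $$d_{PM}(C,D)=\inf\{\tau\ge 0: |A_C(\sigma)-A_D(\sigma)|\le \tau\,\mathcal{H}(\sigma)\text{ for every Borel set }\sigma\subseteq\mathbb{S}^1\},$$ with $d_{PM}(C,D)=\infty$ if no such $\tau$ exists. This is a generalized metric (values in $[0,\infty]$), and the topology it induces is the one generated by its open balls; $\mathcal{K}_{o,2+}^{PM}$ carries the corresponding subspace topology. *)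

(* Defs.v *)
(* MathComp-Analysis; the plane is [R * R] for an arbitrary [R : realType]. *)
From HB Require Import structures.
From mathcomp Require Import all_boot all_order all_algebra.
From mathcomp Require Import all_classical all_reals all_analysis.

Set Implicit Arguments.
Unset Strict Implicit.
Unset Printing Implicit Defensive.

Import Order.TTheory GRing.Theory Num.Theory.
Import numFieldNormedType.Exports.

Local Open Scope classical_set_scope.
Local Open Scope ring_scope.

Section topology.
Context {T : topologicalType}.
Implicit Type A : set T.

Definition boundary A : set T := closure A `\` A°.

Definition residual A : Prop :=
  exists F : (set T)^nat, (forall i, dense (F i)°) /\ A = \bigcap_i F i.

End topology.

Section plane.
Context {R : realType}.
Implicit Types (p q o u x : R * R) (A B C K U sigma : set (R * R)).

(* The library norm on [R * R] is the sup norm: it induces the same topology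
   and bounded sets as the Euclidean one, but lengths must be measured with
   [dist]. *)
Definition dot u x : R := u.1 * x.1 + u.2 * x.2.

Definition dist p q : R := Num.sqrt (dot (p - q) (p - q)).

Definition unit_circle : set (R * R) := [set u | dot u u = 1].

Definition area A : \bar R := (lebesgue_measure \x lebesgue_measure)%E A.

(* [0] is added so that the empty set has diameter 0 rather than -oo. *)
Definition diam U : \bar R :=
  ereal_sup (0%E |` [set (dist z.1 z.2)%:E | z in U `*` U]).

Definition hausdorff1_pre (delta : R) A : \bar R :=
  ereal_inf [set (\sum_(0 <= i <oo) diam (U i))%E | U in
    [set U : (set (R * R))^nat |
      A `<=` \bigcup_i U i /\ forall i, (diam (U i) <= delta%:E)%E]].

Definition hausdorff1 A : \bar R :=
  ereal_sup [set hausdorff1_pre delta A | delta in [set delta : R | 0 < delta]].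

Definition convex_disk K : Prop := [/\ compact K, convex_set K & K° !=set0].

Definition origin_symmetric C : Prop := forall x, C x -> C (- x).

Definition translate (v : R * R) C : set (R * R) := [set v + x | x in C].

(* When no translate contains both points this is an empty intersection, that
   is, the whole plane. *)
Definition spindle C p q : set (R * R) :=
  \bigcap_(v in [set v | translate v C p /\ translate v C q]) translate v C.

Definition C_convex C K : Prop :=
  convex_disk K /\ forall p q, K p -> K q -> spindle C p q `<=` K.

(* [x] lies on the open ray issuing from [o] with direction angle [t]. *)
Definition at_angle o (t : R) x : Prop :=
  exists2 r, 0 < r & x = o + r *: (cos t, sin t).

Definition segment p q : set (R * R) :=
  [set (1 - t) *: p + t *: q | t in [set t : R | 0 <= t <= 1]].

(* For distinct boundary points [p], [q] of a compact convex set [K], the arc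
   of the boundary from [p] to [q] in counterclockwise direction.  The boundary
   of a convex disk is met exactly once by every ray issuing from an interior
   point [o], so arcs are read off from direction angles at [o] (the result does
   not depend on [o]).  A spindle of a polygon may degenerate to the segment
   joining [p] and [q], whose boundary is the segment itself. *)
Definition bd_arc K p q : set (R * R) :=
  [set x | (K° = set0 /\ segment p q x) \/
    (boundary K x /\
     exists o tp t tq,
       [/\ K° o, at_angle o tp p, at_angle o t x, at_angle o tq q
         & [/\ tp <= t, t <= tq & tq < tp + 2 * pi]])].

(* Distinct points in this counterclockwise order around an interior point. *)
Definition ccw_order4 K (x1 x2 x3 x4 : R * R) : Prop :=
  exists o t1 t2 t3 t4,
    [/\ K° o,
        [/\ at_angle o t1 x1, at_angle o t2 x2, at_angle o t3 x3
          & at_angle o t4 x4]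
      & [/\ t1 < t2, t2 < t3, t3 < t4 & t4 < t1 + 2 * pi]].

(* The region bounded by a closed curve, as the union of the bounded components
   of its complement. *)
Definition enclosed_region (G : set (R * R)) : set (R * R) :=
  [set x | (~` G) x /\ bounded_set (connected_component (~` G) x)].

Definition r_region C K p q : set (R * R) :=
  enclosed_region (bd_arc K p q `|` bd_arc (spindle C p q) p q).

Definition outer_normal K u p : Prop :=
  K p /\ forall x, K x -> dot u x <= dot u p.

(* The two parallel supporting lines are meant to be distinct (otherwise every
   point would be antipodal to itself), so their outer normals are opposite. *)
Definition antipodal K p q : Prop :=
  exists u, [/\ u != 0, outer_normal K u p & outer_normal K (- u) q].

Definition turning_angle_lt_pi K p q : Prop :=
  forall x, bd_arc K p q x -> ~ antipodal K p x.

Definition quadrangle_property C : Prop :=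
  forall K, C_convex C K ->
  forall x1 x2 x3 x4 : R * R,
    boundary K x1 -> boundary K x2 -> boundary K x3 -> boundary K x4 ->
    ccw_order4 K x1 x2 x3 x4 ->
    turning_angle_lt_pi K x1 x4 ->
    (area (r_region C K x1 x3) + area (r_region C K x2 x4) <=
     area (r_region C K x1 x4) + area (r_region C K x2 x3))%E.

Definition normal_preimage K sigma : set (R * R) :=
  [set p | boundary K p /\ exists2 u, sigma u & outer_normal K u p].

Definition surface_area_measure K sigma : \bar R :=
  hausdorff1 (normal_preimage K sigma).

(* The measurable subsets of [R * R] are its Borel sets, and the circle is
   closed.  The infimum of the empty set is +oo. *)
Definition pm_distance C (D : set (R * R)) : \bar R :=
  ereal_inf [set tau%:E | tau in [set tau : R | 0 <= tau /\
    forall sigma, measurable sigma -> sigma `<=` unit_circle ->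
      (`| surface_area_measure C sigma - surface_area_measure D sigma |
         <= tau%:E * hausdorff1 sigma)%E]].

Definition twice_continuously_derivable (f : R -> R) : Prop :=
  [/\ forall t, derivable f t 1, forall t, derivable (derive1 f) t 1
    & continuous (derive1n 2 f)].

Definition curvature (x y : R -> R) (t : R) : R :=
  (derive1 x t * derive1n 2 y t - derive1 y t * derive1n 2 x t) /
  Num.sqrt (derive1 x t ^+ 2 + derive1 y t ^+ 2) ^+ 3.

(* [t |-> (x t, y t)] is a regular C^2 parametrization of the boundary as a
   simple closed curve of period [L].  The curvature is signed, so positivity
   also forces the counterclockwise orientation, which can always be chosen. *)
Definition C2_positive_curvature K : Prop :=
  exists (L : R) (x y : R -> R),
    [/\ 0 < L,
        twice_continuously_derivable x /\ twice_continuously_derivable y,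
        [/\ forall t, (x (t + L), y (t + L)) = (x t, y t),
            {in `[0, L[ &, injective (fun t => (x t, y t))}
          & range (fun t => (x t, y t)) = boundary K],
        forall t, (derive1 x t, derive1 y t) != 0
      & forall t, 0 < curvature x y t].

End plane.

Record sym_disk (R : realType) := SymDisk {
  sym_disk_set :> set (R * R);
  sym_diskP : convex_disk sym_disk_set /\ origin_symmetric sym_disk_set }.

HB.instance Definition _ (R : realType) := gen_eqMixin (sym_disk R).
HB.instance Definition _ (R : realType) := gen_choiceMixin (sym_disk R).

Definition pm_ball (R : realType) (C : sym_disk R) (e : R) : set (sym_disk R) :=
  [set D : sym_disk R | (pm_distance C D < e%:E)%E].

Definition pm_balls (R : realType) : set (set (sym_disk R)) :=
  [set B | exists (C : sym_disk R) (e : R), 0 < e /\ B = pm_ball C e].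

HB.instance Definition _ (R : realType) :=
  isSubBaseTopological.Build (sym_disk R) (@pm_balls R) id.

(* Used below as a type, it carries the subspace topology. *)
Definition K_o2plus (R : realType) : set (sym_disk R) :=
  [set C : sym_disk R | C2_positive_curvature C].

Arguments K_o2plus : clear implicits.

(* Main.v *)
(* Near a lowest point the boundary of a disk C of class C^2_+ is, up to scaling,
   almost the parabola z^2/2.  Digging the bump eps * max(1 - z^2, 0)^3 into its
   graph, and symmetrically at the highest point, changes the radius of curvature
   as a function of the normal by a factor 1 + O(eps) only, so that the dented
   disk C' is at perimeter distance O(eps) from C, and it is again of class C^2_+.

   Any symmetric disk D whose lower boundary is uniformly close to the dented
   parabola on a window of length O(1/eps) violates the Quadrangle Property.  The
   four points x_i lie at -1/2 -+ eps/2 and 1/2 -+ eps/2, the outer two being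
   higher than the inner two, and K is the intersection of four translates of D
   whose lowest arcs have these points far out on their flanks.  The lower arc of
   K cancels in the four areas, and the remaining integrals compare the lower arcs
   of the spindles, which all are translates of the dented parabola: only those
   of [x_1, x_4] and [x_2, x_3] have the dent in their middle.

   Perimeter closeness to C' forces the lower boundary of D to be close to that
   of C': H^1 of the arc with normals (m, -1), m in [m1, m2], determines the
   increment of the abscissa of the point with slope m up to a factor 1 + O(m),
   and the heights follow by convexity.  Hence a whole ball around C' consists of
   disks violating the Quadrangle Property, so that these disks contain a dense
   open set. *)
Require Import Defs.
From mathcomp Require Import all_boot all_order all_algebra.
From mathcomp Require Import all_classical all_reals all_analysis.
From mathcomp Require Import measurable_realfun.
From mathcomp Require Import ring lra.

Set Implicit Arguments.
Unset Strict Implicit.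
Unset Printing Implicit Defensive.

Import Order.TTheory GRing.Theory Num.Theory.
Import numFieldNormedType.Exports.

Local Open Scope classical_set_scope.
Local Open Scope ring_scope.

(** * Convex sets and boundary arcs *)

Section plane_geometry.
Context {R : realType}.
Implicit Types (p q o u x y z : R * R) (A B C K Z : set (R * R)).

(** Perimeter closeness only allows a dent that is small relative to the parabola, and this fixes
    all the scales. Let x_1, x_2 (and likewise x_3, x_4) differ by [eps] horizontally and by about
    [1 / 2] vertically. For an undented parabola the inequality then holds with a surplus of order
    [eps], the horizontal gap times the height. A dent of relative depth [eps] shifts the balance by
    the same order, and wins ([model_gap]). A much wider gap would cost more than the dent returns,
    while the narrow one makes the chords x_1 x_2 and x_3 x_4 as steep as 1/(2 eps): hence the long
    window, of half-length [4 * Z] with [Z] of order 1/eps. All other errors must be small compared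
    with [eps]. The oscillation of the curvature is reduced by shrinking the window. The heights of
    D, recovered from lengths of arcs, are off by the square of the largest slope times the length
    of the window; this is cubic in the scale [d], whereas the depth of the dent is quadratic. So
    [d] is chosen after [eps], [Z] and the precision [nu] of the curvature. *)

Lemma pair_ext p q : p.1 = q.1 -> p.2 = q.2 -> p = q.
Proof. by case: p q => [a b] [c d] /= -> ->. Qed.

Lemma interiorP A x : A° x <->
  exists2 e : R, 0 < e &
    forall y, `|y.1 - x.1| < e -> `|y.2 - x.2| < e -> A y.
Proof.
split.
  rewrite /interior => /nbhs_ballP[e /= e0 H]; exists e => // y y1 y2.
  by apply: H; split; rewrite /= /ball/= distrC.
case=> e e0 H; apply/nbhs_ballP; exists e => //= y [y1 y2].
by apply: H; rewrite distrC.
Qed.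

(** Convexity in coordinates with a real parameter, a form that [lra] and [ring] can use
    directly. *)
Definition cvx K := forall p q (t : R), K p -> K q -> 0 <= t <= 1 ->
  K ((1 - t) * p.1 + t * q.1, (1 - t) * p.2 + t * q.2).

Lemma cvxP K : convex_set K <-> cvx K.
Proof.
split.
  move=> cK p q t Kp Kq /andP[t0 t1].
  have u0 : 0 <= 1 - t by lra.
  have u1 : 1 - t <= 1 by lra.
  have := cK p q (Itv01 u0 u1); rewrite !inE => /(_ Kp Kq).
  rewrite /conv/=; congr (K _); apply: pair_ext => //=.
    by rewrite unstable.onemK.
  by rewrite unstable.onemK.
move=> cK p q l; rewrite !inE => Kp Kq.
have l01 : 0 <= 1 - l%:num <= 1.
  have : l%:num <= 1 by []. have : 0 <= l%:num by [].
  by rewrite /unstable.onem; lra.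
have := cK p q _ Kp Kq l01.
congr (K _); apply: pair_ext; rewrite /conv/=.
  by rewrite subKr.
by rewrite subKr.
Qed.

Lemma cvx_comb K p q (t : R) z : cvx K -> K p -> K q -> 0 <= t -> t <= 1 ->
  z.1 = (1 - t) * p.1 + t * q.1 -> z.2 = (1 - t) * p.2 + t * q.2 -> K z.
Proof.
move=> cK Kp Kq t0 t1 z1 z2.
rewrite (_ : z = ((1 - t) * p.1 + t * q.1, (1 - t) * p.2 + t * q.2)).
  by apply: cK => //; rewrite t0.
exact: pair_ext.
Qed.

Lemma cvx_interior K o p (t : R) z : cvx K -> K° o -> K p -> 0 <= t -> t < 1 ->
  z.1 = (1 - t) * o.1 + t * p.1 -> z.2 = (1 - t) * o.2 + t * p.2 -> K° z.
Proof.
move=> cK /interiorP[e e0 He] Kp t0 t1 z1 z2.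
have u0 : 0 < 1 - t by lra.
apply/interiorP; exists ((1 - t) * e); first exact: mulr_gt0.
move=> y y1 y2.
pose o' := (o.1 + (y.1 - z.1) / (1 - t), o.2 + (y.2 - z.2) / (1 - t)).
have Ko' : K o'.
  apply: He => /=.
    by rewrite addrAC subrr add0r normrM normfV (gtr0_norm u0) ltr_pdivrMr// mulrC.
  by rewrite addrAC subrr add0r normrM normfV (gtr0_norm u0) ltr_pdivrMr// mulrC.
apply: (cvx_comb cK Ko' Kp t0 (ltW t1)) => /=.
  by rewrite mulrDr z1 mulrCA divff ?lt0r_neq0// mulr1; ring.
by rewrite mulrDr z2 mulrCA divff ?lt0r_neq0// mulr1; ring.
Qed.

Definition cross (u v : R * R) : R := u.1 * v.2 - u.2 * v.1.

Lemma cvx_cone K o a b v (s t : R) : cvx K -> K° o -> K a -> K b ->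
  0 <= s -> 0 <= t -> s + t < 1 ->
  v.1 - o.1 = s * (a.1 - o.1) + t * (b.1 - o.1) ->
  v.2 - o.2 = s * (a.2 - o.2) + t * (b.2 - o.2) -> K° v.
Proof.
move=> cK Ko Ka Kb s0 t0 st1 v1 v2.
have [st0|st0] := eqVneq (s + t) 0.
  have s00 : s = 0 by lra.
  have t00 : t = 0 by lra.
  rewrite s00 t00 !mul0r addr0 in v1 v2.
  have -> // : v = o.
  by apply: pair_ext; lra.
have st0' : 0 < s + t by rewrite lt_neqAle eq_sym st0 addr_ge0.
pose c := ((1 - t / (s + t)) * a.1 + t / (s + t) * b.1,
           (1 - t / (s + t)) * a.2 + t / (s + t) * b.2).
have Kc : K c.
  apply: cK => //; apply/andP; split; first by rewrite divr_ge0// ltW.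
  by rewrite ler_pdivrMr// mul1r; lra.
apply: (cvx_interior cK Ko Kc (ltW st0') st1) => /=.
  rewrite -[LHS](subrK o.1) v1.
  by field.
rewrite -[LHS](subrK o.2) v2.
by field.
Qed.

End plane_geometry.

Section arcs.
Context {R : realType}.
Implicit Types (p q o u x y z : R * R) (A B C K Z : set (R * R)).

Lemma cross_angle o (a b : R) p q : 
  forall r s : R, p = o + r *: (cos a, sin a) -> q = o + s *: (cos b, sin b) ->
  cross (p - o) (q - o) = r * s * sin (b - a).
Proof.
move=> r s -> ->; rewrite /cross sinB /=.
rewrite ![_ *: _]/GRing.scale /=. ring.
Qed.

Lemma sin_lt0 (a : R) : pi < a -> a < 2 * pi -> sin a < 0.
Proof.
move=> a1 a2; have /(_ (a - pi))/eqP := @sinDpi R.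
rewrite subrK => /eqP ->; rewrite oppr_lt0; apply: sin_gt0_pi; lra.
Qed.

Lemma sin_lt0_ge0 (a b : R) : pi < a -> 0 <= b -> a + b < 2 * pi ->
  [/\ sin a < 0, 0 <= sin b & sin (a + b) < 0].
Proof.
move=> a1 b0 ab; split; [apply: sin_lt0; lra| |apply: sin_lt0; lra].
by apply: sin_ge0_pi; lra.
Qed.

(* Bracket form of "[v] lies in the cone spanned by [a] and [b] at [o],
   strictly on the same side of the line [a b] as [o]". *)
Lemma cone_interior K o a b v : cvx K -> K° o -> K a -> K b ->
  0 < cross (a - o) (b - o) ->
  0 <= cross (v - o) (b - o) -> 0 <= cross (a - o) (v - o) ->
  cross (v - o) (b - o) + cross (a - o) (v - o) < cross (a - o) (b - o) ->
  K° v.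
Proof.
move=> cK Ko Ka Kb d0 s0 t0 st.
set d := cross (a - o) (b - o) in d0 st *.
apply: (@cvx_cone _ K o a b v (cross (v - o) (b - o) / d)
  (cross (a - o) (v - o) / d) cK Ko Ka Kb).
- by rewrite divr_ge0// ltW.
- by rewrite divr_ge0// ltW.
- by rewrite -mulrDl ltr_pdivrMr// mul1r.
- apply: (mulIf (lt0r_neq0 d0)).
  rewrite [RHS]mulrDl ![_ / d * _ * d]mulrAC !divfK ?lt0r_neq0// /d /cross /=; ring.
- apply: (mulIf (lt0r_neq0 d0)).
  rewrite [RHS]mulrDl ![_ / d * _ * d]mulrAC !divfK ?lt0r_neq0// /d /cross /=; ring.
Qed.

Lemma not_interior_boundary A x : boundary A x -> ~ A° x.
Proof. by case. Qed.

(** The arc from [p] to [q] runs on the right of the directed chord. If [x] were strictly on its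
    left, one of the three points would lie in the cone of the other two at [o], on the near side of
    their chord, and so be interior: [q], [p] or [x], according to whether the turn from [p] to [x],
    the turn from [x] to [q] or neither exceeds [pi]. *)
Lemma bd_arc_sub K p q : cvx K -> closed K -> boundary K p -> boundary K q ->
  K° !=set0 ->
  bd_arc K p q `<=` [set x | boundary K x /\ cross (q - p) (x - p) <= 0].
Proof.
move=> cK clK bp bq K0 x [[K00 _]|]; first by case: K0 => y; rewrite K00.
move=> [bx [c0 [tp [t [tq [Ko [rp rp0 pE] [r r0 xE] [rq rq0 qE] [h1 h2 h3]]]]]]].
rename c0 into o.
have Kc y : boundary K y -> K y by case; rewrite -(closure_id K).1.
split => //; rewrite leNgt; apply/negP => D0.
(* Read with [D0], this identity is the strict inequality that [cone_interior] asks for in each of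
   the three cases. *)
have E : cross (q - p) (x - p) =
  cross (p - o) (q - o) - cross (x - o) (q - o) - cross (p - o) (x - o).
  by rewrite /cross /=; ring.
have pqE := cross_angle pE qE.
have pxE := cross_angle pE xE.
have xqE := cross_angle xE qE.
have tE : tq - tp = (t - tp) + (tq - t) by ring.
have Kp := Kc _ bp. have Kq := Kc _ bq. have Kx := Kc _ bx.
have sgn u v : cross u v = - cross v u by rewrite /cross; ring.
have [A1|A1] := ltP pi (t - tp).
  have [sA sB sAB] : [/\ sin (t - tp) < 0, 0 <= sin (tq - t)
      & sin ((t - tp) + (tq - t)) < 0].
    by apply: sin_lt0_ge0; lra.
  rewrite tE in pqE.
  have : cross (p - o) (x - o) < 0 by rewrite pxE pmulr_rlt0// mulr_gt0.
  have : 0 <= cross (x - o) (q - o) by rewrite xqE mulr_ge0// mulr_ge0// ltW.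
  have : cross (p - o) (q - o) < 0 by rewrite pqE pmulr_rlt0// mulr_gt0.
  move=> a1 a2 a3; apply: (not_interior_boundary bq).
  apply: (cone_interior cK Ko Kx Kp);
    rewrite ?[cross (x - o) (p - o)]sgn ?[cross (q - o) (p - o)]sgn; lra.
have [B1|B1] := ltP pi (tq - t).
  have [sA sB sAB] : [/\ sin (tq - t) < 0, 0 <= sin (t - tp)
      & sin ((tq - t) + (t - tp)) < 0].
    by apply: sin_lt0_ge0; lra.
  rewrite tE [in sin _]addrC in pqE.
  have : 0 <= cross (p - o) (x - o) by rewrite pxE mulr_ge0// mulr_ge0// ltW.
  have : cross (x - o) (q - o) < 0 by rewrite xqE pmulr_rlt0// mulr_gt0.
  have : cross (p - o) (q - o) < 0 by rewrite pqE pmulr_rlt0// mulr_gt0.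
  move=> a1 a2 a3; apply: (not_interior_boundary bp).
  apply: (cone_interior cK Ko Kq Kx);
    rewrite ?[cross (q - o) (x - o)]sgn ?[cross (q - o) (p - o)]sgn; lra.
have : 0 <= cross (p - o) (x - o).
  by rewrite pxE mulr_ge0 ?mulr_ge0 ?(ltW r0) ?(ltW rp0)//; apply: sin_ge0_pi; lra.
have : 0 <= cross (x - o) (q - o).
  by rewrite xqE mulr_ge0 ?mulr_ge0 ?(ltW r0) ?(ltW rq0)//; apply: sin_ge0_pi; lra.
move=> a1 a2; apply: (not_interior_boundary bx).
by apply: (cone_interior cK Ko Kp Kq); lra.
Qed.

(** The angle [t] is normalised to the half turn that ends at [a], since [bd_arc] compares angles as
    real numbers and not modulo a full turn. *)
Lemma polar u (a : R) : u != 0 -> cross (cos a, sin a) u <= 0 ->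
  exists t r : R, [/\ a - pi <= t, t <= a, 0 < r & u = r *: (cos t, sin t)].
Proof.
move=> u0 ua.
pose c := cos a * u.1 + sin a * u.2.
pose d := - cross (cos a, sin a) u.
have d0 : 0 <= d by rewrite oppr_ge0.
pose r := Num.sqrt (c ^+ 2 + d ^+ 2).
have cs : cos a ^+ 2 + sin a ^+ 2 = 1 by exact: cos2Dsin2.
have u1E : u.1 = c * cos a + d * sin a.
  transitivity ((cos a ^+ 2 + sin a ^+ 2) * u.1); first by rewrite cs mul1r.
  by rewrite /c /d /cross /=; ring.
have u2E : u.2 = c * sin a - d * cos a.
  transitivity ((cos a ^+ 2 + sin a ^+ 2) * u.2); first by rewrite cs mul1r.
  by rewrite /c /d /cross /=; ring.
have cd0 : 0 < c ^+ 2 + d ^+ 2.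
  rewrite lt_neqAle eq_sym addr_ge0 ?sqr_ge0// andbT.
  rewrite paddr_eq0 ?sqr_ge0// !sqrf_eq0; apply/negP => /andP[/eqP cE /eqP dE].
  move/eqP: u0; apply; apply: pair_ext; rewrite ?u1E ?u2E cE dE /=; ring.
have r0 : 0 < r by rewrite sqrtr_gt0.
have r2 : r ^+ 2 = c ^+ 2 + d ^+ 2 by rewrite sqr_sqrtr ?ltW.
have cr : -1 <= c / r <= 1.
  rewrite -ler_norml normrM normfV (gtr0_norm r0) ler_pdivrMr// mul1r.
  rewrite -(ler_pXn2r (n:=2))// ?nnegrE ?(ltW r0)//.
  by rewrite real_normK ?num_real// r2 lerDl sqr_ge0.
pose th := acos (c / r).
have cth : cos th = c / r by rewrite /th acosK.
have sth : sin th = d / r.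
  have th0 : 0 <= sin th by rewrite /th sin_ge0_pi// acos_ge0// acos_lepi.
  apply/eqP; rewrite -(eqrXn2 (n:=2))//; last by rewrite divr_ge0// ltW.
  rewrite sin2cos2 cth expr_div_n [X in _ == X]expr_div_n r2.
  apply/eqP; field.
  by rewrite lt0r_neq0.
exists (a - th), r; split => //.
- by rewrite lerB// acos_lepi.
- by rewrite gerBl acos_ge0.
- rewrite cosB sinB cth sth; apply: pair_ext; rewrite /= ?u1E ?u2E /GRing.scale/=;
   by field; rewrite lt0r_neq0.
Qed.

(** Seen from the midpoint of the chord, [p] and [q] have opposite directions, so the half-plane to
    the right of the chord is exactly a half turn of angles and needs no case distinction. *)
Lemma bd_arc_sup K p q : p != q ->
  K° ((p.1 + q.1) / 2, (p.2 + q.2) / 2) ->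
  [set x | boundary K x /\ cross (q - p) (x - p) <= 0] `<=` bd_arc K p q.
Proof.
move=> pq; set m := (X in K° X) => Km x [bx cx]; right; split => //.
have qm0 : q - m != 0.
  apply/negP => /eqP qm; move/eqP: pq; apply.
  have := congr1 fst qm; have := congr1 snd qm; rewrite /m /= => q2 q1.
  by apply: pair_ext; lra.
have [a [r [r0 qmE]]] : exists a r : R, 0 < r /\ q - m = r *: (cos a, sin a).
  have [|] := lerP (cross (cos 0, sin 0) (q - m)) 0.
    by move=> /(polar qm0)[t [r [_ _ r0 E]]]; exists t, r.
  move=> c0; have : cross (cos pi, sin pi) (q - m) <= 0.
    by move: c0; rewrite /cross cospi sinpi cos0 sin0 /=; lra.
  by move=> /(polar qm0)[t [r [_ _ r0' E]]]; exists t, r.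
have pmE : p - m = - (q - m) by apply: pair_ext; rewrite /m /=; lra.
exists m, (a - pi).
have xm0 : x - m != 0.
  by apply/negP => /eqP /subr0_eq xm; case: bx => _; rewrite xm.
have : cross (cos a, sin a) (x - m) <= 0.
  have -> : cross (cos a, sin a) (x - m) = (cross (q - p) (x - p)) / (2 * r).
    have : cross (q - p) (x - p) = 2 * cross (q - m) (x - m).
      by rewrite /cross /m /=; field.
    rewrite qmE => ->.
    rewrite /cross /= /GRing.scale/=; field; exact: lt0r_neq0.
  by rewrite pmulr_lle0// invr_gt0 mulr_gt0.
move=> /(polar xm0)[t [s [h1 h2 s0 xE]]].
exists t, a; split => //.
- exists r => //; rewrite cosB sinB cospi sinpi -[LHS](subrK m) pmE qmE addrC.
  by congr (_ + _); apply: pair_ext; rewrite /= /GRing.scale/=; ring.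
- by exists s => //; rewrite -xE addrC subrK.
- by exists r => //; rewrite -qmE addrC subrK.
- split => //; have := pi_gt0 R; lra.
Qed.

End arcs.

(** * Regions between a disk and a spindle *)

Section regions.
Context {R : realType}.
Implicit Types (p q o u x y z : R * R) (A B C K Z : set (R * R)).

Lemma bounded_planeP A : bounded_set A <->
  exists M : R, forall x, A x -> `|x.1| <= M /\ `|x.2| <= M.
Proof.
split.
  move=> [M0 [_ H]]; exists (M0 + 1) => x Ax.
  have /H/(_ x Ax) : M0 < M0 + 1 by rewrite ltrDl.
  by rewrite /= prod_normE ge_max => /andP.
move=> [M H]; exists M; split; first exact: num_real.
move=> M' MM' x Ax; rewrite /= prod_normE ge_max.
by have [h1 h2] := H _ Ax; rewrite !(le_trans _ (ltW MM')).
Qed.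

Lemma affine_continuous (a b c : R) :
  continuous (fun x : R * R => a * x.1 + b * x.2 + c).
Proof.
move=> x; apply: cvgD; last exact: cvg_cst.
by apply: cvgD; apply: cvgM; [exact: cvg_cst|exact: cvg_fst|
  exact: cvg_cst|exact: cvg_snd].
Qed.

Lemma crossE p q x : cross (q - p) (x - p) =
  (- (q.2 - p.2)) * x.1 + (q.1 - p.1) * x.2 +
  ((q.2 - p.2) * p.1 - (q.1 - p.1) * p.2).
Proof. by rewrite /cross /=; ring. Qed.

Lemma closed_affine (a b c : R) : closed [set x : R * R | a * x.1 + b * x.2 + c <= 0].
Proof.
rewrite (_ : [set _ | _] = (fun x : R * R => a * x.1 + b * x.2 + c) @^-1` [set t | t <= 0])//.
by apply: preimage_closed; [move=> x _; exact: affine_continuous|exact: closed_le].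
Qed.

Lemma open_affine (a b c : R) : open [set x : R * R | a * x.1 + b * x.2 + c < 0].
Proof.
rewrite (_ : [set _ | _] = (fun x : R * R => a * x.1 + b * x.2 + c) @^-1` [set t | t < 0])//.
by apply: open_comp; [move=> x _; exact: affine_continuous|exact: open_lt].
Qed.

Lemma continuous_pair (T U V : topologicalType) (f : T -> U) (g : T -> V) :
  continuous f -> continuous g -> continuous (fun s => (f s, g s)).
Proof. by move=> cf cg s; exact: (cvg_pair (cf s) (cg s)). Qed.

(** A vertical ray that misses [G] is connected and unbounded, so it makes the component of its
    starting point unbounded; [e] is the sign of the direction. *)
Lemma vertical_escape (G : set (R * R)) x (e : R) : e ^+ 2 = 1 ->
  (forall s : R, 0 <= s -> ~ G (x.1, x.2 + e * s)) -> ~ enclosed_region G x.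
Proof.
move=> e1 H [nGx].
have e1' : `|e| = 1.
  by apply/eqP; rewrite -(eqrXn2 (n:=2))// real_normK ?num_real// e1 expr1n.
pose L := [set (x.1, x.2 + e * s) | s in `[0, +oo[ : set R].
have Lc : connected L.
  apply: (@connected_continuous_connected R (R * R)%type `[0, +oo[ (fun s => (x.1, x.2 + e * s))).
    by apply/connected_intervalP => a b /=; rewrite !in_itv/= !andbT => a0 b0 z;
      move=> /andP[az zb]; rewrite /= in_itv/= andbT (le_trans a0 az).
  apply: continuous_subspaceT; apply: continuous_pair; first exact: cst_continuous.
  move=> s; apply: cvgD; first exact: cvg_cst.
  by apply: cvgM; [exact: cvg_cst|exact: cvg_id].
have LG : L `<=` connected_component (~` G) x.
  apply: connected_component_max => //.
    exists 0; first by rewrite /= in_itv/= lexx.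
    by apply: pair_ext; rewrite /= ?mulr0 ?addr0.
  by move=> y [s]; rewrite /= in_itv/= andbT => s0 <-; exact: H.
move=> /bounded_planeP[M HM].
pose s := `|x.2| + `|M| + 1.
have s0 : 0 <= s by rewrite /s !addr_ge0.
have Ls : L (x.1, x.2 + e * s).
  by exists s => //; rewrite /= in_itv/= s0.
have [_] := HM _ (LG _ Ls); rewrite /= => h.
have : s <= `|x.2 + e * s| + `|x.2|.
  rewrite {1}(_ : s = `|e * s|); last by rewrite normrM e1' mul1r ger0_norm.
  by have := ler_normB (x.2 + e * s) x.2; rewrite addrAC subrr add0r.
have := ler_norm M; rewrite /s; lra.
Qed.

Lemma boundary_closed A x : closed A -> boundary A x <-> A x /\ ~ A° x.
Proof. by move=> /closure_id AE; rewrite /boundary -AE. Qed.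

Section between.
Variables (K Z : set (R * R)) (p q : R * R).
Hypotheses (cK : cvx K) (cZ : cvx Z) (clK : closed K) (clZ : closed Z).
Hypotheses (bK : bounded_set K) (ZK : Z `<=` K) (Zp : Z p) (Zq : Z q).
Hypothesis pq : p.1 < q.1.
Hypothesis lowp : forall y : R, K (p.1, y) -> p.2 <= y.
Hypothesis lowq : forall y : R, K (q.1, y) -> q.2 <= y.
Hypothesis Zm : Z° ((p.1 + q.1) / 2, (p.2 + q.2) / 2).

Let m := ((p.1 + q.1) / 2, (p.2 + q.2) / 2).

Let ZKi : Z° `<=` K°. Proof. exact: interiorS. Qed.

Lemma low_not_interior o : (forall y : R, K (o.1, y) -> o.2 <= y) -> ~ K° o.
Proof.
move=> lo /interiorP[e e0 H].
have /lo : K (o.1, o.2 - e / 2).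
  apply: H; rewrite /= ?subrr ?normr0//.
  by rewrite addrAC subrr add0r normrN gtr0_norm; lra.
lra.
Qed.

Lemma chord_interior x : cross (q - p) (x - p) = 0 -> p.1 < x.1 -> x.1 < q.1 -> Z° x.
Proof.
have pq' := pq.
rewrite /cross /= => c0 x1 x2.
have d0 : q.1 - p.1 != 0 by lra.
have x2E : x.2 = p.2 + (x.1 - p.1) * (q.2 - p.2) / (q.1 - p.1).
  apply: (mulIf d0); rewrite mulrDl divfK//; lra.
have [h|h] := lerP x.1 m.1.
- apply: (@cvx_interior _ Z m p ((m.1 - x.1) / (m.1 - p.1)) x) => //.
  + by rewrite divr_ge0 ?subr_ge0 //= /m/=; lra.
  + by rewrite ltr_pdivrMr ?mul1r /m /=; lra.
  + by rewrite /m /=; field; lra.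
  + by rewrite x2E /m /=; field; lra.
- apply: (@cvx_interior _ Z m q ((x.1 - m.1) / (q.1 - m.1)) x) => //.
  + by rewrite divr_ge0 ?subr_ge0 ?ltW //= /m/=; lra.
  + by rewrite ltr_pdivrMr ?mul1r /m /=; lra.
  + by rewrite /m /=; field; lra.
  + by rewrite x2E /m /=; field; lra.
Qed.

(** The segment from the midpoint [m], an interior point, to a point below the chord and outside the
    strip would cross the vertical through [p] or [q] in an interior point of [K] that is not above
    this lowest point. *)
Lemma below_chord_strip x : K x -> cross (q - p) (x - p) <= 0 -> p.1 <= x.1 <= q.1.
Proof.
have pq' := pq.
move=> Kx cx; apply/andP; split; rewrite leNgt; apply/negP => xp.
  have mp : 0 < m.1 - p.1 by rewrite /m /=; lra.
  have mx : 0 < m.1 - x.1 by rewrite /m /=; lra.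
  pose t := (m.1 - p.1) / (m.1 - x.1).
  pose e := ((1 - t) * m.1 + t * x.1, (1 - t) * m.2 + t * x.2).
  have Ke : K° e.
    apply: (@cvx_interior _ K m x t) => //; first exact: ZKi.
      by rewrite divr_ge0// ltW.
    by rewrite ltr_pdivrMr// mul1r; lra.
  have e1 : e.1 = p.1 by rewrite /e /= /t /m /=; field; lra.
  have e2 : e.2 <= p.2.
    have : (q.1 - p.1) * (e.2 - p.2) <= 0.
      have <- : cross (q - p) (e - p) = (q.1 - p.1) * (e.2 - p.2).
        by rewrite crossE e1; ring.
      have -> : cross (q - p) (e - p) = t * cross (q - p) (x - p).
        by rewrite /cross /e /m /=; field.
      by rewrite mulr_ge0_le0// divr_ge0// ltW.
    by rewrite pmulr_rle0 ?subr_gt0// subr_le0.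
  move: Ke; apply: low_not_interior; rewrite e1 => y /lowp; exact: le_trans.
have mp : 0 < q.1 - m.1 by rewrite /m /=; lra.
have mx : 0 < x.1 - m.1 by rewrite /m /=; lra.
pose t := (q.1 - m.1) / (x.1 - m.1).
pose e := ((1 - t) * m.1 + t * x.1, (1 - t) * m.2 + t * x.2).
have Ke : K° e.
  apply: (@cvx_interior _ K m x t) => //; first exact: ZKi.
    by rewrite divr_ge0// ltW.
  by rewrite ltr_pdivrMr// mul1r; lra.
have e1 : e.1 = q.1 by rewrite /e /= /t /m /=; field; lra.
have e2 : e.2 <= q.2.
  have : (q.1 - p.1) * (e.2 - q.2) <= 0.
    have <- : cross (q - p) (e - p) = (q.1 - p.1) * (e.2 - q.2).
      by rewrite crossE e1; ring.
    have -> : cross (q - p) (e - p) = t * cross (q - p) (x - p).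
      by rewrite /cross /e /m /=; field.
    by rewrite mulr_ge0_le0// divr_ge0// ltW.
  by rewrite pmulr_rle0 ?subr_gt0// subr_le0.
move: Ke; apply: low_not_interior; rewrite e1 => y /lowq; exact: le_trans.
Qed.

Let G : set (R * R) :=
  [set x | (boundary K x \/ boundary Z x) /\ cross (q - p) (x - p) <= 0].

Let V : set (R * R) := [set x | [/\ K° x, cross (q - p) (x - p) < 0 & ~ Z x]].

Lemma chord_in_Z x : K x -> cross (q - p) (x - p) = 0 -> Z x.
Proof.
have pq' := pq.
move=> Kx cx; have /andP[x1 x2] : p.1 <= x.1 <= q.1.
  by apply: below_chord_strip; rewrite // cx.
have [xp|xp] := eqVneq x.1 p.1.
  have -> // : x = p.
  apply: pair_ext => //; move: cx; rewrite /cross /= xp subrr mulr0 subr0.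
  by move/eqP; rewrite mulf_eq0 => /orP[|]/eqP; lra.
have [xq|xq] := eqVneq x.1 q.1.
  have -> // : x = q.
  apply: pair_ext => //; move: cx; rewrite /cross /= xq.
  have -> : (q.1 - p.1) * (x.2 - p.2) - (q.2 - p.2) * (q.1 - p.1) =
    (q.1 - p.1) * (x.2 - q.2) by ring.
  by move/eqP; rewrite mulf_eq0 => /orP[|]/eqP; lra.
apply: interior_subset; apply: chord_interior => //; rewrite lt_neqAle.
  by rewrite eq_sym xp.
by rewrite xq.
Qed.

Lemma V_open : open V.
Proof.
rewrite (_ : V = K° `&` [set x | cross (q - p) (x - p) < 0] `&` ~` Z).
  apply: openI; last exact: closed_openC.
  apply: openI; first exact: open_interior.
  by under eq_set do rewrite crossE; exact: open_affine.
by apply/seteqP; split => [x []|x [[]]].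
Qed.

Lemma closure_V x : closure V x -> V x \/ G x.
Proof.
move=> cVx.
have Kx : K x.
  rewrite (closure_id K).1//; apply: closureS cVx.
  by move=> y [/interior_subset].
have cx : cross (q - p) (x - p) <= 0.
  have cl : closed [set x | cross (q - p) (x - p) <= 0].
    by under eq_set do rewrite crossE; exact: closed_affine.
  move: cVx; rewrite [X in _ -> X](_ : _ = [set x | cross (q - p) (x - p) <= 0] x)//.
  by rewrite (closure_id [set x | _]).1//; apply: closureS => y [_ /ltW].
have nZx : ~ Z° x.
  move=> Zx; have [|y [[_ _ nZy] /interior_subset]//] := cVx Z°.
  by apply: open_nbhs_nbhs; split => //; exact: open_interior.
have [Kix|nKix] := pselect (K° x); last first.
  by right; split => //; left; apply/(boundary_closed _ clK).
have [Zx|nZ] := pselect (Z x).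
  by right; split => //; right; apply/(boundary_closed _ clZ).
left; split => //; rewrite lt_neqAle cx andbT; apply/eqP => cx0.
by apply: nZ; exact: chord_in_Z.
Qed.

(** [V] is open and, by [closure_V], closed relative to the complement of [G]; so a component that
    meets [V] stays in [V], which is bounded. *)
Lemma V_enclosed : V `<=` enclosed_region G.
Proof.
move=> x Vx.
have VG y : V y -> ~ G y.
  move=> [Ky _ nZ] [[|]].
    by move=> /(boundary_closed _ clK)[].
  by move=> /(boundary_closed _ clZ)[].
split; first exact: VG.
set B := connected_component _ _.
have BE : B `&` V = B.
  apply: (@component_connected _ (~` G) x).
  - by exists x; split => //; exact: connected_component_refl (VG _ Vx).
  - by exists V => //; exact: V_open.
  - exists (closure V); first exact: closed_closure.
    apply/seteqP; split => y [By Vy]; split => //; first exact: subset_closure.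
    by have [//|Gy] := closure_V Vy; have := connected_component_sub By.
have /bounded_planeP[M HM] := bK.
apply/bounded_planeP; exists M => y; rewrite -BE => -[_ [/interior_subset Ky _ _]].
exact: HM.
Qed.

(** A point outside [V] escapes along a vertical ray: upwards if it is outside the strip, above the
    chord or in the interior of [Z], downwards if it is outside [K]. *)
Lemma enclosed_V : enclosed_region G `<=` V.
Proof.
have pq' := pq.
move=> x ex; apply: contrapT => nVx.
have nGx := ex.1.
have GW y : G y -> [/\ K y, p.1 <= y.1 <= q.1, cross (q - p) (y - p) <= 0 & ~ Z° y].
  move=> [by_ cy].
  have [Ky nZy] : K y /\ ~ Z° y.
    case: by_ => [/(boundary_closed _ clK)[Ky nKy]|/(boundary_closed _ clZ)[Zy nZy]].
      by split => // /ZKi.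
    by split => //; exact: ZK.
  by split => //; exact: below_chord_strip.
have up : (forall s : R, 0 <= s -> ~ G (x.1, x.2 + s)) -> False.
  move=> H; apply: (@vertical_escape G x 1) ex; first by rewrite expr1n.
  by move=> s /H; rewrite mul1r.
have dn : (forall s : R, 0 <= s -> ~ G (x.1, x.2 - s)) -> False.
  move=> H; apply: (@vertical_escape G x (-1)) ex; first by rewrite sqrrN expr1n.
  by move=> s /H; rewrite mulN1r.
have [x12|nx12] := boolP (p.1 <= x.1 <= q.1); last first.
  by apply: up => s s0 /GW[_ /= x12 _ _]; rewrite x12 in nx12.
have [cx|cx] := ltP 0 (cross (q - p) (x - p)).
  apply: up => s s0 /GW[_ _ + _]; move: cx; rewrite !crossE /= => c1 c2.
  have : 0 <= (q.1 - p.1) * s by rewrite mulr_ge0// subr_ge0 ltW.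
  by lra.
pose c := (x.1, p.2 + (x.1 - p.1) * (q.2 - p.2) / (q.1 - p.1)).
have d0 : q.1 - p.1 != 0 by lra.
have cc : cross (q - p) (c - p) = 0.
  by rewrite /cross /c /=; field.
have Zc : Z c.
  have /andP[h1 h2] := x12.
  apply: (@cvx_comb _ Z p q ((x.1 - p.1) / (q.1 - p.1))) => //=.
  + by rewrite divr_ge0 ?subr_ge0// ltW.
  + by rewrite ler_pdivrMr ?mul1r; lra.
  + by field.
  + by field.
have xc : x.2 <= c.2.
  have : (q.1 - p.1) * (x.2 - c.2) <= 0.
    have <- // : cross (q - p) (x - p) = (q.1 - p.1) * (x.2 - c.2).
    by rewrite /cross /c /=; field.
  by rewrite pmulr_rle0 ?subr_gt0// subr_le0.
have seg A a b s : cvx A -> A (x.1, a) -> A (x.1, b) -> a <= s -> s <= b ->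
    A (x.1, s).
  move=> cA Aa Ab as_ sb.
  have [ab|ab] := eqVneq a b.
    by have -> : s = a by lra.
  have ab' : 0 < b - a by rewrite subr_gt0 lt_neqAle ab (le_trans as_ sb).
  apply: (@cvx_comb _ A (x.1, a) (x.1, b) ((s - a) / (b - a))) => //=.
  + by rewrite divr_ge0 ?(ltW ab')// subr_ge0.
  + by rewrite ler_pdivrMr ?mul1r; lra.
  + by ring.
  + by field; rewrite lt0r_neq0.
have [Zx|nZx] := pselect (Z° x).
  have /andP[h1 h2] := x12.
  have xi : p.1 < x.1 < q.1.
    apply/andP; split; rewrite lt_neqAle ?h1 ?h2 andbT; apply/eqP => E.
      have xp : x.2 <= p.2 by move: xc; rewrite /c /= -E subrr mul0r mul0r addr0.
      by apply: (@low_not_interior x); [rewrite -E => y /lowp; exact: le_trans|exact: ZKi].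
    have xp : x.2 <= q.2.
      by move: xc; rewrite /c /= E mulrAC divff// mul1r addrC subrK.
    by apply: (@low_not_interior x); [rewrite E => y /lowq; exact: le_trans|exact: ZKi].
  have Zci : Z° c by move/andP: xi => [? ?]; apply: chord_interior.
  apply: up => s s0 /GW[_ _ cs]; apply.
  have cs' : x.2 + s <= c.2.
    have : (q.1 - p.1) * (x.2 + s - c.2) <= 0.
      have <- // : cross (q - p) ((x.1, x.2 + s) - p) = (q.1 - p.1) * (x.2 + s - c.2).
      by rewrite /cross /c /=; field.
    by rewrite pmulr_rle0 ?subr_gt0// subr_le0.
  apply: (seg _ x.2 c.2) => //.
  - move=> a b t Za Zb /andP[t0 t1].
    have [->|t1'] := eqVneq t 1.
      by rewrite subrr !mul0r !add0r !mul1r; case: (b) Zb.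
    apply: (@cvx_interior _ Z a b t) => //; first exact: interior_subset.
    by rewrite lt_neqAle t1'.
  - by rewrite lerDl.
have [Kx|nKx] := pselect (K x).
  have Kix : K° x.
    apply: contrapT => nKi; apply: nGx; split => //; left.
    exact/(boundary_closed _ clK).
  have nZ : ~ Z x.
    by move=> Zx; apply: nGx; split => //; right; apply/(boundary_closed _ clZ).
  apply: nVx; split => //; rewrite lt_neqAle cx andbT; apply/eqP => cx0.
  by apply: nZ; exact: chord_in_Z.
apply: dn => s s0 /GW[Ks _ _ _]; apply: nKx.
rewrite (_ : x = (x.1, x.2)); last by case: (x).
by apply: (seg _ (x.2 - s) c.2) => //; [exact: ZK|rewrite gerBl].
Qed.

(** From here on the components of the complement are replaced by inequalities, so that areas can be
    computed from vertical sections. *)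
Lemma region_between : enclosed_region (bd_arc K p q `|` bd_arc Z p q) =
  [set x | [/\ K° x, cross (q - p) (x - p) < 0 & ~ Z x]].
Proof.
have pq' : p != q by apply/eqP => E; move: pq; rewrite E ltxx.
have bp : ~ K° p by exact: low_not_interior.
have bq : ~ K° q by exact: low_not_interior.
have -> : bd_arc K p q `|` bd_arc Z p q = G.
  have bd A : closed A -> A p -> A q -> ~ A° p -> ~ A° q ->
      boundary A p /\ boundary A q.
    by move=> clA Ap Aq ? ?; split; apply/(boundary_closed _ clA).
  have [bKp bKq] := bd _ clK (ZK Zp) (ZK Zq) bp bq.
  have [bZp bZq] := bd _ clZ Zp Zq (fun h => bp (ZKi h)) (fun h => bq (ZKi h)).
  apply/seteqP; split => x.
    case=> [|].
      have Ki : K° !=set0 by exists m; exact: ZKi.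
      by move=> /(bd_arc_sub cK clK bKp bKq Ki)[bx cx]; split => //; left.
    have Zi : Z° !=set0 by exists m.
    by move=> /(bd_arc_sub cZ clZ bZp bZq Zi)[bx cx]; split => //; right.
  move=> [[bx|bx] cx].
  - by left; apply: bd_arc_sup => //; exact: ZKi.
  - by right; exact: bd_arc_sup.
apply/seteqP; split; [exact: enclosed_V|exact: V_enclosed].
Qed.

End between.
End regions.

(** * Areas of the regions by vertical sections *)

Section measures.
Context {R : realType}.
Implicit Types (p q o v : R * R) (A B C D K Z : set (R * R)).

Lemma open_measurable_plane A : open A -> measurable A.
Proof.
move=> oA.
pose box (i : rat * rat * nat) : set (R * R) :=
  `]ratr i.1.1 - i.2.+1%:R^-1, ratr i.1.1 + i.2.+1%:R^-1[ `*`
  `]ratr i.1.2 - i.2.+1%:R^-1, ratr i.1.2 + i.2.+1%:R^-1[.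
pose F i := if `[< box i `<=` A >] then box i else set0.
have -> : A = \bigcup_i F i.
  apply/seteqP; split => x; last first.
    by case=> i _; rewrite /F; case: asboolP => // h; exact: h.
  move=> Ax; have /interiorP[e e0 eA] : A° x by move: oA; rewrite openE; exact.
  have [n ne] : exists n : nat, n.+1%:R^-1 < e / 2.
    have /ltr_add_invr[n] : 0 < e / 2 by rewrite divr_gt0.
    by rewrite add0r => ?; exists n.
  have n0 : (0 : R) < n.+1%:R^-1 by rewrite invr_gt0.
  have rb (d t : R) : 0 < d -> exists a : rat, `|ratr a - t| < d.
    move=> d0; have [|a] := @rat_in_itvoo R (t - d) (t + d); first lra.
    by rewrite in_itv/= -ltr_distl => h; exists a.
  have [a ha] := rb _ x.1 n0; have [b hb] := rb _ x.2 n0.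
  have bx : box (a, b, n) x.
    by split; rewrite /= in_itv/= -ltr_distl distrC.
  exists (a, b, n) => //; rewrite /F; case: asboolP => // -[] y [].
  rewrite /= !in_itv/= -!ltr_distl => h1 h2; move: ne ha hb h1 h2.
  move: n.+1%:R^-1 => d ne ha hb h1 h2; apply: eA.
    rewrite -(subrK (ratr a) y.1) -addrA (le_lt_trans (ler_normD _ _))//; lra.
  rewrite -(subrK (ratr b) y.2) -addrA (le_lt_trans (ler_normD _ _))//; lra.
apply: countable_bigcupT_measurable; first exact: countableP.
move=> i; rewrite /F; case: ifP => _; last exact: measurable0.
by apply: measurableX; exact: measurable_itv.
Qed.

Lemma closed_measurable_plane A : closed A -> measurable A.
Proof.
by move=> cA; rewrite -[A]setCK; apply: measurableC; apply: open_measurable_plane;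
  exact: closed_openC.
Qed.

Definition low_at K p := K p /\ forall y : R, K (p.1, y) -> p.2 <= y.

Lemma compact_plane_closed K : compact K -> closed K.
Proof.
by apply: compact_closed; exact: norm_hausdorff.
Qed.

Lemma compact_plane_bounded K : compact K -> bounded_set K.
Proof. by move=> /compact_bounded. Qed.

Lemma low_exists K (x y : R) : compact K -> K (x, y) ->
  exists k : R, low_at K (x, k).
Proof.
move=> coK Kxy.
have cl : closed [set z : R * R | z.1 = x].
  rewrite (_ : [set _ | _] = fst @^-1` [set x]) //.
  by apply: preimage_closed; [move=> z _; exact: cvg_fst|exact: closed_eq].
have [|||z] := @compact_EVT_min _ R snd (K `&` [set z : R * R | z.1 = x]).
- by exists (x, y).
- exact: compact_closedI.
- by apply: continuous_subspaceT => z; exact: cvg_snd.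
rewrite inE => -[Kz /= zx] H; exists z.2; split => /=.
  by rewrite -zx; case: (z) Kz.
by move=> t Kt; have := H (x, t); rewrite inE; apply.
Qed.

Section sections.
Variables (K Z : set (R * R)) (p q : R * R).
Hypotheses (cK : cvx K) (cZ : cvx Z) (clZ : closed Z) (ZK : Z `<=` K) (Zp : Z p) (Zq : Z q).
Hypothesis pq : p.1 < q.1.
Hypothesis lowp : forall y : R, K (p.1, y) -> p.2 <= y.
Hypothesis lowq : forall y : R, K (q.1, y) -> q.2 <= y.
Hypothesis Zm : Z° ((p.1 + q.1) / 2, (p.2 + q.2) / 2).

Let V : set (R * R) := [set x | [/\ K° x, cross (q - p) (x - p) < 0 & ~ Z x]].

Let chord (x : R) := p.2 + (x - p.1) * (q.2 - p.2) / (q.1 - p.1).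

Lemma cross_chord (x y : R) : (cross (q - p) ((x, y) - p) < 0) = (y < chord x).
Proof.
have pq' := pq.
have -> : cross (q - p) ((x, y) - p) = (q.1 - p.1) * (y - chord x).
  by rewrite crossE /chord /=; field; lra.
by rewrite pmulr_rlt0 ?subr_gt0// subr_lt0.
Qed.

Lemma chord_Z (x : R) : p.1 <= x <= q.1 -> Z (x, chord x).
Proof.
have pq' := pq.
move=> /andP[h1 h2].
apply: (@cvx_comb _ Z p q ((x - p.1) / (q.1 - p.1))) => //=.
+ by rewrite divr_ge0 ?subr_ge0// ltW.
+ by rewrite ler_pdivrMr ?mul1r; lra.
+ by field; lra.
+ by rewrite /chord; field; lra.
Qed.

Lemma section_out (x : R) : ~~ (p.1 <= x <= q.1) -> xsection V x = set0.
Proof.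
move=> nx; rewrite -subset0 => y /xsectionP[/interior_subset Kxy /ltW cxy _].
move/negP: nx; apply.
exact: (below_chord_strip cK ZK pq lowp lowq Zm Kxy cxy).
Qed.

(** Above [u] the convex set [Z] contains everything up to the chord, so the section of the region
    is confined between the floor [k] of [K] and [u]. *)
Lemma section_le (x k u : R) : p.1 <= x <= q.1 -> Z (x, u) ->
  (forall y : R, K (x, y) -> k <= y) ->
  (lebesgue_measure (xsection V x) <= (u - k)%:E)%E.
Proof.
move=> xpq Zu lk.
have ku : k <= u by exact/lk/ZK.
have sub : xsection V x `<=` `[k, u].
  move=> y /xsectionP[/interior_subset Kxy]; rewrite cross_chord => yc nZ.
  rewrite /= in_itv/= lk//= leNgt; apply/negP => uy; apply: nZ.
  have Zc := chord_Z xpq.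
  have uc : 0 < chord x - u by rewrite subr_gt0 (lt_trans uy).
  apply: (@cvx_comb _ Z (x, u) (x, chord x) ((y - u) / (chord x - u))) => //=.
  + by rewrite divr_ge0 ?subr_ge0// ltW// -subr_gt0.
  + by rewrite ler_pdivrMr ?mul1r ?lerD2r// ltW.
  + by ring.
  + by field; rewrite lt0r_neq0.
have -> : (u - k)%:E = lebesgue_measure (`[k, u] : set R).
  rewrite lebesgue_measure_itv/= lte_fin; case: ltP => //.
  by rewrite le_eqVlt ltNge ku orbF => /eqP ->; rewrite subrr.
apply: le_measure; [rewrite inE|by apply/mem_set; exact: measurable_itv|exact: sub].
by apply: measurable_xsection; apply: open_measurable_plane; exact: V_open.
Qed.

(** At the two ends of the strip the section may be empty; there [lowp] and [lowq] force [l <= k]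
    and the bound is trivial. In between, the section contains the open interval from [k] to [l]. *)
Lemma section_ge (x k l : R) : p.1 <= x <= q.1 -> K (x, k) ->
  (forall y : R, Z (x, y) -> l <= y) ->
  ((l - k)%:E <= lebesgue_measure (xsection V x))%E.
Proof.
move=> x12 Kk lZ.
have [lk|kl] := leP l k.
  by apply: (@le_trans _ _ 0%E); [rewrite lee_fin subr_le0|exact: measure_ge0].
have /andP[x1 x2] : p.1 < x < q.1.
  have /andP[h1 h2] := x12; rewrite !lt_neqAle h1 h2 !andbT.
  apply/andP; split; apply/eqP => E; move: kl; rewrite ltNge => /negP; apply.
    apply: (@le_trans _ _ p.2); last by apply: lowp; rewrite E.
    by apply: lZ; rewrite -E; case: (p) Zp.
  apply: (@le_trans _ _ q.2); last by apply: lowq; rewrite -E.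
  by apply: lZ; rewrite E; case: (q) Zq.
have lc : l <= chord x by apply/lZ/chord_Z; rewrite !ltW.
have sub : `]k, l[ `<=` xsection V x.
  move=> y; rewrite /= in_itv/= => /andP[ky yl]; apply/xsectionP; split.
  - have Zc : Z° (x, chord x).
      apply: (chord_interior cZ Zp Zq pq Zm) => //=.
      by have pq' := pq; rewrite crossE /chord /=; field; lra.
    have ck : 0 < chord x - k by rewrite subr_gt0 (lt_le_trans kl).
    apply: (@cvx_interior _ K (x, chord x) (x, k) ((chord x - y) / (chord x - k))) => //=.
    + exact: (interiorS ZK).
    + by rewrite divr_ge0 ?(ltW ck)// subr_ge0 (le_trans (ltW yl)).
    + by rewrite ltr_pdivrMr ?mul1r ?ltrD2l ?ltrN2.
    + by ring.
    + by field; rewrite lt0r_neq0.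
  - by rewrite cross_chord (lt_le_trans yl).
  - by move=> /lZ; rewrite leNgt yl.
have -> : (l - k)%:E = lebesgue_measure (`]k, l[ : set R).
  by rewrite lebesgue_measure_itv/= lte_fin kl.
apply: le_measure; [by apply/mem_set; exact: measurable_itv|rewrite inE|exact: sub].
by apply: measurable_xsection; apply: open_measurable_plane; exact: V_open.
Qed.
End sections.

Section area_comparison.
Variables (K Z14 Z23 Z13 Z24 : set (R * R)) (x1 x2 x3 x4 : R * R).
Let V (Z : set (R * R)) (p q : R * R) : set (R * R) :=
  [set x | [/\ K° x, cross (q - p) (x - p) < 0 & ~ Z x]].

Definition between K Z p q := [/\ cvx Z, closed Z, Z `<=` K, Z p /\ Z q &
  Z° ((p.1 + q.1) / 2, (p.2 + q.2) / 2)].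

(** Every abscissa is covered equally often by the intervals of the pairs 14 and 23 and by those of
    13 and 24, so the height [k] of the lower boundary of [K] cancels pointwise, before any
    integration. The integrals are those of nonnegative functions with values in [\bar R], hence the
    shift by [B] and the sums arranged without subtraction. *)
Lemma area_comparison (U14 U23 L13 L24 : R -> R) (B : R) :
  cvx K -> compact K ->
  low_at K x1 -> low_at K x2 -> low_at K x3 -> low_at K x4 ->
  x1.1 < x2.1 -> x2.1 < x3.1 -> x3.1 < x4.1 ->
  between K Z14 x1 x4 -> between K Z23 x2 x3 ->
  between K Z13 x1 x3 -> between K Z24 x2 x4 ->
  continuous U14 -> continuous U23 -> continuous L13 -> continuous L24 ->
  (forall x : R, x1.1 <= x <= x4.1 -> exists2 y : R, Z14 (x, y) & y <= U14 x) ->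
  (forall x : R, x2.1 <= x <= x3.1 -> exists2 y : R, Z23 (x, y) & y <= U23 x) ->
  (forall x y : R, x1.1 <= x <= x3.1 -> Z13 (x, y) -> L13 x <= y) ->
  (forall x y : R, x2.1 <= x <= x4.1 -> Z24 (x, y) -> L24 x <= y) ->
  (forall p, K p -> - B <= p.2) ->
  (forall x : R, x1.1 <= x <= x3.1 -> - B <= L13 x) ->
  (forall x : R, x2.1 <= x <= x4.1 -> - B <= L24 x) ->
  (\int[lebesgue_measure]_(x in `[x1.1, x4.1]) (U14 x + B)%:E +
   \int[lebesgue_measure]_(x in `[x2.1, x3.1]) (U23 x + B)%:E <
   \int[lebesgue_measure]_(x in `[x1.1, x3.1]) (L13 x + B)%:E +
   \int[lebesgue_measure]_(x in `[x2.1, x4.1]) (L24 x + B)%:E)%E ->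
  (area (V Z14 x1 x4) + area (V Z23 x2 x3) <
   area (V Z13 x1 x3) + area (V Z24 x2 x4))%E.
Proof.
move=> cK coK [Kx1 lo1] [Kx2 lo2] [Kx3 lo3] [Kx4 lo4] x12 x23 x34.
move=> [c14 cl14 s14 [Z14p Z14q] m14] [c23 cl23 s23 [Z23p Z23q] m23].
move=> [c13 cl13 s13 [Z13p Z13q] m13] [c24 cl24 s24 [Z24p Z24q] m24].
move=> cU14 cU23 cL13 cL24 hU14 hU23 hL13 hL24 KB L13B L24B main.
have mV Z p q : closed Z -> measurable (V Z p q).
  by move=> clZ; apply: open_measurable_plane; exact: V_open.
pose F Z p q : measurableTypeR R -> \bar R := lebesgue_measure \o xsection (V Z p q).
have mF Z p q : closed Z -> measurable_fun setT (F Z p q).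
  by move=> clZ; apply: measurable_fun_xsection; exact: mV.
have F0 Z p q x : (0 <= F Z p q x)%E by exact: measure_ge0.
pose res (f : R -> R) (a b : R) : measurableTypeR R -> \bar R :=
  (fun x => (f x + B)%:E) \_ `[a, b].
have resE f a b x : res f a b x = (if a <= x <= b then f x + B else 0)%:E.
  by rewrite /res patchE mem_setE in_itv/=; case: ifP.
have mres f a b : continuous f -> measurable_fun setT (res f a b).
  move=> cf; apply/measurable_restrict => //.
  apply: measurable_funTS; apply/measurable_EFinP.
  by apply: measurable_funD => //; exact: continuous_measurable_fun.
have KBx : forall x y, K (x, y) -> - B <= y by move=> x y /KB.
have res0 f a b : (forall x, a <= x <= b -> - B <= f x) ->
    forall x, (0 <= res f a b x)%E.
  move=> fB x; rewrite resE lee_fin; case: ifP => // /fB; lra.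
have U14B x : x1.1 <= x <= x4.1 -> - B <= U14 x.
  by move=> /hU14[y /s14/KBx]; exact: le_trans.
have U23B x : x2.1 <= x <= x3.1 -> - B <= U23 x.
  by move=> /hU23[y /s23/KBx]; exact: le_trans.
pose l x := (res L13 x1.1 x3.1 x + res L24 x2.1 x4.1 x)%E.
pose u x := (res U14 x1.1 x4.1 x + res U23 x2.1 x3.1 x)%E.
(* The first inequality is the comparison with [l] and [u] moved to the opposite sides; the second
   shows that the areas of the left side are finite, so that they can be cancelled at the end. *)
have pw x : (F Z14 x1 x4 x + F Z23 x2 x3 x + l x <=
             F Z13 x1 x3 x + F Z24 x2 x4 x + u x)%E /\
            (F Z14 x1 x4 x + F Z23 x2 x3 x <= u x)%E.
  have out Z p q : cvx Z -> closed Z -> Z `<=` K -> p.1 < q.1 ->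
      (forall y : R, K (p.1, y) -> p.2 <= y) ->
      (forall y : R, K (q.1, y) -> q.2 <= y) ->
      Z° ((p.1 + q.1) / 2, (p.2 + q.2) / 2) ->
      ~~ (p.1 <= x <= q.1) -> F Z p q x = 0%E.
    move=> cZ clZ sZ pq lp lq mZ nx.
    by have E := section_out cK sZ pq lp lq mZ nx; rewrite /F /= /V E measure0.
  have x13 := lt_trans x12 x23. have x24 := lt_trans x23 x34.
  have x14 := lt_trans x13 x34.
  have [h14|h14] := boolP (x1.1 <= x <= x4.1); last first.
    have n23 : ~~ (x2.1 <= x <= x3.1).
      apply: contra h14 => /andP[? ?]; apply/andP; lra.
    rewrite (out _ _ _ c14)// (out _ _ _ c23)// !add0e.
    have n13 : (x1.1 <= x <= x3.1) = false.
      apply/negbTE; apply: contra h14 => /andP[? ?]; apply/andP; lra.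
    have n24 : (x2.1 <= x <= x4.1) = false.
      apply/negbTE; apply: contra h14 => /andP[? ?]; apply/andP; lra.
    rewrite /l !resE n13 n24 add0e.
    by split; rewrite !adde_ge0//; exact: res0.
  have [y0 /s14 /(low_exists coK)[k [Kk lk]] _] := hU14 _ h14.
  have kB : - B <= k by exact: KBx Kk.
  have [y14 Zy14 yU14] := hU14 _ h14.
  have a14 : (F Z14 x1 x4 x <= (U14 x - k)%:E)%E.
    apply: (le_trans (section_le c14 cl14 s14 Z14p Z14q x14 h14 Zy14 lk)).
    by rewrite lee_fin lerD2r.
  have a23 : (F Z23 x2 x3 x <= (if x2.1 <= x <= x3.1 then U23 x - k else 0)%:E)%E.
    case: ifPn => h23; last by rewrite (out _ _ _ c23).
    have [y Zy yU] := hU23 _ h23.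
    apply: (le_trans (section_le c23 cl23 s23 Z23p Z23q x23 h23 Zy lk)).
    by rewrite lee_fin lerD2r.
  have b13 : ((if x1.1 <= x <= x3.1 then L13 x - k else 0)%:E <= F Z13 x1 x3 x)%E.
    case: ifPn => h13 //.
    by apply: (section_ge cK c13 cl13 s13 Z13p Z13q x13 lo1 lo3 m13 h13 Kk) => y; exact: hL13.
  have b24 : ((if x2.1 <= x <= x4.1 then L24 x - k else 0)%:E <= F Z24 x2 x4 x)%E.
    case: ifPn => h24 //.
    by apply: (section_ge cK c24 cl24 s24 Z24p Z24q x24 lo2 lo4 m24 h24 Kk) => y; exact: hL24.
  have UB14 := U14B _ h14. have UB23 := U23B x.
  split.
    apply: (le_trans (leeD2r _ (leeD a14 a23))).
    apply: (le_trans _ (leeD2r _ (leeD b13 b24))).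
    rewrite /l /u !resE h14 -!EFinD lee_fin.
    move: h14 UB23 => /andP[h1 h4].
    rewrite h1 h4 /= !andbT.
    by have [h2|h2] := leP x2.1 x; have [h3|h3] := leP x x3.1 => /=; move=> UB23;
      try have := UB23 isT; lra.
  apply: (le_trans (leeD a14 a23)).
  rewrite /u !resE h14 -!EFinD lee_fin.
  by case: ifP => _; lra.
have mV14 := mV _ x1 x4 cl14. have mV23 := mV _ x2 x3 cl23.
have mV13 := mV _ x1 x3 cl13. have mV24 := mV _ x2 x4 cl24.
have areaE Z p q : area (V Z p q) = (\int[lebesgue_measure]_x F Z p q x)%E by [].
have Il : (\int[lebesgue_measure]_x l x =
  \int[lebesgue_measure]_(x in `[x1.1, x3.1]) (L13 x + B)%:E +
   \int[lebesgue_measure]_(x in `[x2.1, x4.1]) (L24 x + B)%:E)%E.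
  rewrite ge0_integralD//; last 4 first.
  - by move=> x _; exact: res0.
  - exact: mres.
  - by move=> x _; exact: res0.
  - exact: mres.
  by rewrite [X in _ = (X + _)%E]integral_mkcond [X in _ = (_ + X)%E]integral_mkcond.
have Iu : (\int[lebesgue_measure]_x u x =
  \int[lebesgue_measure]_(x in `[x1.1, x4.1]) (U14 x + B)%:E +
   \int[lebesgue_measure]_(x in `[x2.1, x3.1]) (U23 x + B)%:E)%E.
  rewrite ge0_integralD//; last 4 first.
  - by move=> x _; exact: res0.
  - exact: mres.
  - by move=> x _; exact: res0.
  - exact: mres.
  by rewrite [X in _ = (X + _)%E]integral_mkcond [X in _ = (_ + X)%E]integral_mkcond.
have l0 x : (0 <= l x)%E by rewrite adde_ge0//; exact: res0.
have u0 x : (0 <= u x)%E by rewrite adde_ge0//; exact: res0.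
have ml : measurable_fun setT l by apply: emeasurable_funD; exact: mres.
have mu : measurable_fun setT u by apply: emeasurable_funD; exact: mres.
have I : (area (V Z14 x1 x4) + area (V Z23 x2 x3) + \int[lebesgue_measure]_x l x <=
   area (V Z13 x1 x3) + area (V Z24 x2 x4) + \int[lebesgue_measure]_x u x)%E.
  have mA := emeasurable_funD (mF _ x1 x4 cl14) (mF _ x2 x3 cl23).
  have mB := emeasurable_funD (mF _ x1 x3 cl13) (mF _ x2 x4 cl24).
  rewrite !areaE -!ge0_integralD//; try exact: mF.
  - apply: ge0_le_integral => //.
    + by move=> x _; apply: adde_ge0; [exact: adde_ge0|exact: l0].
    + exact: emeasurable_funD.
    + exact: emeasurable_funD.
    + by move=> x _; exact: (pw x).1.
  - by move=> x _; rewrite adde_ge0.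
  - by move=> x _; rewrite adde_ge0.
rewrite ltNge; apply/negP => le1.
have fA : (area (V Z14 x1 x4) + area (V Z23 x2 x3))%E \is a fin_num.
  have A0 Z p q : (0 <= area (V Z p q))%E.
    by rewrite areaE; apply: integral_ge0 => x _; exact: F0.
  rewrite ge0_fin_numE; last exact: adde_ge0 (A0 _ _ _) (A0 _ _ _).
  apply: (@le_lt_trans _ _ (\int[lebesgue_measure]_x u x)%E).
    rewrite !areaE -ge0_integralD//; [|exact: mF|exact: mF].
    apply: ge0_le_integral => //.
    + by move=> x _; rewrite adde_ge0.
    + by apply: emeasurable_funD; exact: mF.
    + by move=> x _; exact: (pw x).2.
  by rewrite Iu (lt_le_trans main)// leey.
have := le_trans I (leeD2r _ le1).
rewrite leeD2lE// Il Iu leNgt => /negP; apply; exact: main.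
Qed.
End area_comparison.
End measures.

(** * Spindles, counterclockwise order and antipodal points *)

Section spindles.
Context {R : realType}.
Implicit Types (p q o u v : R * R) (A B C D K Z : set (R * R)).

Lemma translateP v C p : translate v C p <-> C (p - v).
Proof.
split; first by move=> [x Cx <-]; rewrite addrAC subrr add0r.
by move=> Cp; exists (p - v) => //; rewrite addrCA subrr addr0.
Qed.

Lemma translate_cvx v C : cvx C -> cvx (translate v C).
Proof.
move=> cC p q t /translateP Cp /translateP Cq t01; apply/translateP.
have := cC _ _ _ Cp Cq t01; congr (C _).
by apply: pair_ext => /=; ring.
Qed.

Lemma translate_compact v C : compact C -> compact (translate v C).
Proof.
move=> cC; apply: continuous_compact => //.
by apply: continuous_subspaceT => x; apply: cvgD; [exact: cvg_cst|exact: cvg_id].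
Qed.

Lemma spindle_left C p q : spindle C p q p.
Proof. by move=> v []. Qed.

Lemma spindle_right C p q : spindle C p q q.
Proof. by move=> v []. Qed.

Lemma spindle_cvx C p q : cvx C -> cvx (spindle C p q).
Proof.
move=> cC a b t Za Zb t01 v vpq.
have tC := @translate_cvx v C cC; exact: (tC a b t (Za v vpq) (Zb v vpq) t01).
Qed.

Lemma spindle_closed C p q : compact C -> closed (spindle C p q).
Proof.
move=> cC; apply: closed_bigI => v _.
by apply: compact_plane_closed; exact: translate_compact.
Qed.

(** The point reflection that exchanges [p] and [q] permutes the translates of a symmetric [C] that
    contain both. *)
Lemma spindle_sym C p q z : origin_symmetric C ->
  spindle C p q z -> spindle C p q (p + q - z).
Proof.
move=> sC Zz v [/translateP Cp /translateP Cq].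
have /translateP : translate (p + q - v) C z.
  apply: Zz; split; apply/translateP.
    by rewrite (_ : p - _ = - (q - v)); [exact: sC|apply: pair_ext => /=; ring].
  by rewrite (_ : q - _ = - (p - v)); [exact: sC|apply: pair_ext => /=; ring].
move=> /sC h; apply/translateP; congr (C _): h.
by apply: pair_ext => /=; ring.
Qed.

(** The low point and its mirror image span, together with [p] and [q], a parallelogram centred at
    the midpoint. *)
Lemma midpoint_interior Z p q (y : R) : cvx Z ->
  (forall z, Z z -> Z (p + q - z)) -> Z p -> Z q -> p.1 < q.1 ->
  Z ((p.1 + q.1) / 2, y) -> y < (p.2 + q.2) / 2 ->
  Z° ((p.1 + q.1) / 2, (p.2 + q.2) / 2).
Proof.
move=> cZ sZ Zp Zq pq Zy ym.
set m := ((p.1 + q.1) / 2, (p.2 + q.2) / 2).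
pose w1 := (q.1 - p.1) / 2. pose w2 := (q.2 - p.2) / 2.
pose h := m.2 - y.
have w0 : 0 < w1 by rewrite /w1; lra.
have h0 : 0 < h by rewrite /h /m /=; lra.
have Zz : Z (m.1, m.2 + h).
  by have := sZ _ Zy; congr (Z _); apply: pair_ext; rewrite /m /h /m /=; field.
have pE : p = (m.1 - w1, m.2 - w2) by apply: pair_ext; rewrite /m/w1/w2/=; field.
have qE : q = (m.1 + w1, m.2 + w2) by apply: pair_ext; rewrite /m/w1/w2/=; field.
have yE : ((p.1 + q.1) / 2, y) = (m.1, m.2 - h).
  by apply: pair_ext; rewrite /m/h /m/=; ring.
rewrite pE in Zp; rewrite qE in Zq; rewrite yE in Zy.
have horiz (a : R) : `|a| <= 1 -> Z (m.1 + a * w1, m.2 + a * w2).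
  rewrite ler_norml => /andP[a1 a2].
  by apply: (@cvx_comb _ Z _ _ ((1 + a) / 2) _ cZ Zp Zq) => /=;
    [lra|lra|field|field].
have vert (b : R) : `|b| <= 1 -> Z (m.1, m.2 + b * h).
  rewrite ler_norml => /andP[a1 a2].
  by apply: (@cvx_comb _ Z _ _ ((1 + b) / 2) _ cZ Zy Zz) => /=;
    [lra|lra|field|field].
have hv (a b : R) : `|a| <= 1 / 2 -> `|b| <= 1 / 2 ->
    Z (m.1 + a * w1, m.2 + a * w2 + b * h).
  move=> ha hb.
  have Za : Z (m.1 + (2 * a) * w1, m.2 + (2 * a) * w2).
    by apply: horiz; rewrite normrM ger0_norm//; lra.
  have Zb : Z (m.1, m.2 + (2 * b) * h).
    by apply: vert; rewrite normrM ger0_norm//; lra.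
  by apply: (@cvx_comb _ Z _ _ (1 / 2) _ cZ Za Zb) => /=; [lra|lra|field|field].
clear pE qE yE.
clearbody w1 w2 h m.
pose e1 := w1 / 2; pose e2 := h / 4; pose e3 := h * w1 / (4 * (`|w2| + 1)).
have w2p : 0 < `|w2| + 1 by rewrite ltr_wpDl.
have e30 : 0 < e3 by rewrite /e3 divr_gt0 ?mulr_gt0.
apply/interiorP; exists (Num.min e1 (Num.min e2 e3)).
  rewrite !lt_min e30 /e1 /e2; apply/andP; split; first lra.
  by rewrite andbT; lra.
move=> z; rewrite !lt_min => /andP[z1 /andP[_ z3]] /andP[_ /andP[z2 _]].
pose a := (z.1 - m.1) / w1; pose b := (z.2 - m.2 - a * w2) / h.
have := hv a b; rewrite (_ : (_, _) = z); last first.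
  by apply: pair_ext; rewrite /b /a /=; field; rewrite ?lt0r_neq0//.
apply.
  rewrite /a normrM normfV (gtr0_norm w0) ler_pdivrMr//.
  by move: z1; rewrite /e1; lra.
rewrite /b normrM normfV (gtr0_norm h0) ler_pdivrMr//.
rewrite (le_trans (ler_normB _ _))//.
have : `|a * w2| <= h / 4.
  rewrite /a mulrAC !normrM normfV (gtr0_norm w0) ler_pdivrMr//.
  apply: (@le_trans _ _ (`|z.1 - m.1| * (`|w2| + 1))).
    by rewrite ler_wpM2l// lerDl.
  rewrite -ler_pdivlMr// (le_trans (ltW z3))// /e3.
  rewrite le_eqVlt; apply/orP; left; apply/eqP; field; exact: lt0r_neq0.
by move: z2; rewrite /e2; lra.
Qed.

(** For points below [o] the angle is an increasing function of the quotient [w], which turns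
    counterclockwise order into an order of quotients. *)
Lemma at_angle_below o p (w : R) : p.2 < o.2 -> w = (p.1 - o.1) / (o.2 - p.2) ->
  at_angle o (atan w - pi / 2) p.
Proof.
move=> po wE.
have c0 : 0 < cos (atan w).
  rewrite cos_gt0_pihalf//; apply/andP; split; [exact: atan_gtNpi2|exact: atan_ltpi2].
exists ((o.2 - p.2) / cos (atan w)).
  by rewrite divr_gt0// subr_gt0.
rewrite cosBpihalf sinBpihalf.
have sE : sin (atan w) = w * cos (atan w).
  by have := atanK w; rewrite /tan => {2}<-; rewrite divfK// lt0r_neq0.
have d0 : o.2 - p.2 != 0 by rewrite subr_eq0 gt_eqF.
have cw : w * (o.2 - p.2) = p.1 - o.1 by rewrite wE divfK.
rewrite sE; apply: pair_ext; rewrite /= /GRing.scale/=.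
  by rewrite mulrCA divfK ?lt0r_neq0// cw addrC subrK.
by rewrite mulrN divfK ?lt0r_neq0//; ring.
Qed.

Lemma ccw_order4_low K o x1 x2 x3 x4 : K° o ->
  x1.2 < o.2 -> x2.2 < o.2 -> x3.2 < o.2 -> x4.2 < o.2 ->
  (x1.1 - o.1) / (o.2 - x1.2) < (x2.1 - o.1) / (o.2 - x2.2) ->
  (x2.1 - o.1) / (o.2 - x2.2) < (x3.1 - o.1) / (o.2 - x3.2) ->
  (x3.1 - o.1) / (o.2 - x3.2) < (x4.1 - o.1) / (o.2 - x4.2) ->
  ccw_order4 K x1 x2 x3 x4.
Proof.
move=> Ko y1 y2 y3 y4 w12 w23 w34.
pose t p := atan ((p.1 - o.1) / (o.2 - p.2)) - pi / 2.
have mono (a b : R) : a < b -> atan a < atan b.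
  exact: lt_atan.
exists o, (t x1), (t x2), (t x3), (t x4); split => //.
  by split; exact: at_angle_below.
split; rewrite /t ?ltrD2r; try exact: mono.
have h1 := atan_gtNpi2 ((x1.1 - o.1) / (o.2 - x1.2)).
have h2 := atan_ltpi2 ((x4.1 - o.1) / (o.2 - x4.2)).
have := pi_gt0 R; lra.
Qed.

(** With parallel supporting lines at [p] and [q], the width of [K] along [u] would be attained by
    this pair. The rectangle contains two points with difference [p - q + 2 e u], a pair that is
    wider along [u] by a positive multiple of [dot u u]. *)
Lemma not_antipodal K p q c (a b : R) :
  (forall x y : R, `|x - c.1| <= a -> `|y - c.2| <= b -> K (x, y)) ->
  `|p.1 - q.1| < 2 * a -> `|p.2 - q.2| < 2 * b -> ~ antipodal K p q.
Proof.
move=> rect pq1 pq2 [u [u0 [_ hp] [_ hq]]].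
have n0 : 0 < u.1 ^+ 2 + u.2 ^+ 2.
  rewrite lt_neqAle eq_sym addr_ge0 ?sqr_ge0// andbT paddr_eq0 ?sqr_ge0// !sqrf_eq0.
  by apply: contra u0 => /andP[/eqP ? /eqP ?]; apply/eqP; exact: pair_ext.
pose n := `|u.1| + `|u.2| + 1.
have n1 : 0 < n by rewrite ltr_wpDl// addr_ge0.
pose g := Num.min (a - `|p.1 - q.1| / 2) (b - `|p.2 - q.2| / 2).
have g0 : 0 < g by rewrite lt_min; apply/andP; split; lra.
have g1 : g <= a - `|p.1 - q.1| / 2 by rewrite ge_min lexx.
have g2 : g <= b - `|p.2 - q.2| / 2 by rewrite ge_min lexx orbT.
clearbody g.
pose e := g / n.
have e0 : 0 < e by rewrite divr_gt0.
have eu (t : R) : `|t| <= n -> `|e * t| <= g.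
  move=> tn; rewrite normrM (gtr0_norm e0) /e mulrAC ler_pdivrMr// ler_wpM2l//.
  exact: ltW.
have eu1 : `|e * u.1| <= g.
  by apply: eu; rewrite /n -addrA lerDl addr_ge0.
have eu2 : `|e * u.2| <= g.
  by apply: eu; rewrite /n addrAC lerDr addr_ge0.
pose s := (p.1 - q.1) / 2 + e * u.1; pose t := (p.2 - q.2) / 2 + e * u.2.
have sa : `|s| <= a.
  rewrite (le_trans (ler_normD _ _))// normrM normfV (@ger0_norm _ 2)//; lra.
have tb : `|t| <= b.
  rewrite (le_trans (ler_normD _ _))// normrM normfV (@ger0_norm _ 2)//; lra.
have Kp : K (c.1 + s, c.2 + t) by apply: rect; rewrite addrAC subrr add0r.
have Km : K (c.1 - s, c.2 - t).
  by apply: rect; rewrite addrAC subrr add0r normrN.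
have := hp _ Kp; have := hq _ Km; rewrite /dot /s /t /= => h1 h2.
have : 0 < e * (u.1 ^+ 2 + u.2 ^+ 2) by rewrite mulr_gt0.
lra.
Qed.
End spindles.

(** * A criterion for the failure of the Quadrangle Property *)

Section failure.
Context {R : realType}.
Implicit Types (p q o u v : R * R) (A B C D K Z : set (R * R)).

Lemma cvx_vertical K (x y a b : R) : cvx K -> K (x, a) -> K (x, b) ->
  a <= y -> y <= b -> K (x, y).
Proof.
move=> cK Ka Kb ay yb.
have [ab|ab] := eqVneq a b; first by have -> : y = a by lra.
have ab' : 0 < b - a by rewrite subr_gt0 lt_neqAle ab (le_trans ay yb).
apply: (@cvx_comb _ K (x, a) (x, b) ((y - a) / (b - a))) => //=.
+ by rewrite divr_ge0 ?(ltW ab')// subr_ge0.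
+ by rewrite ler_pdivrMr ?mul1r; lra.
+ by ring.
+ by field; rewrite lt0r_neq0.
Qed.

(* If the lower arc of one translate passes above both endpoints, it lies in
   every translate containing them: increments of a convex function increase,
   so shifting the arc sideways can only lower it relative to the endpoint it
   moves away from. *)
Lemma spindle_above_low D v0 (s t x P Q a b e : R) : cvx D ->
  low_at (translate v0 D) (s, a) -> low_at (translate v0 D) (t, b) ->
  P <= a -> Q <= b -> s < t -> s <= x <= t -> translate v0 D (x, e) ->
  e <= P + (x - s) * (Q - P) / (t - s) ->
  spindle D (s, P) (t, Q) (x, e).
Proof.
move=> cD; set D0 := translate v0 D => -[_ /= ls] [_ /= lt_] Pa Qb st /andP[sx xt] De ec.
have cD0 : cvx D0 by exact: translate_cvx.
move=> v [/translateP Dp /translateP Dq]; apply/translateP.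
pose w := v - v0.
have tr z : D (z - v) <-> D0 (z - w).
  have E : z - w - v0 = z - v by apply: pair_ext; rewrite /w /=; ring.
  by split=> [h|/translateP]; [apply/translateP; rewrite E|rewrite E].
clearbody w.
move/tr : Dp; move/tr : Dq; rewrite tr.
have wE z : z - w = (z.1 - w.1, z.2 - w.2) by apply: pair_ext.
rewrite !wE /= => Dq Dp.
have d0 : 0 < t - s by lra.
have up : D0 (x - w.1, P + (x - s) * (Q - P) / (t - s) - w.2).
  apply: (@cvx_comb _ D0 _ _ ((x - s) / (t - s)) _ cD0 Dp Dq) => /=.
  + by rewrite divr_ge0 ?subr_ge0// ltW.
  + by rewrite ler_pdivrMr// mul1r; lra.
  + by field; lra.
  + by field; lra.
suff [h Dh hle] : exists2 h : R, D0 (x - w.1, h) & h <= e - w.2.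
  by apply: (cvx_vertical cD0 Dh up hle); lra.
have [w0|w0] := leP 0 w.1.
- pose l := x - s + w.1.
  have [l0|l0] := eqVneq l 0.
    have xs : x = s by rewrite /l in l0; lra.
    have w10 : w.1 = 0 by rewrite /l in l0; lra.
    exists (P - w.2); first by rewrite xs.
    have ae : a <= e by apply: ls; rewrite -xs.
    by lra.
  have l1 : 0 < l by rewrite lt_neqAle eq_sym l0 /l; lra.
  exists ((1 - (x - s) / l) * (P - w.2) + (x - s) / l * e).
    apply: (@cvx_comb _ D0 _ _ ((x - s) / l) _ cD0 Dp De) => //=.
    + by rewrite divr_ge0 ?subr_ge0// ltW.
    + by rewrite ler_pdivrMr// mul1r /l; lra.
    + by rewrite /l; field.
  have /ls : D0 (s, (1 - w.1 / l) * (P - w.2) + w.1 / l * e).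
    apply: (@cvx_comb _ D0 _ _ (w.1 / l) _ cD0 Dp De) => //=.
    + by rewrite divr_ge0// ltW.
    + by rewrite ler_pdivrMr// mul1r /l; lra.
    + by rewrite /l; field.
  have -> : w.1 / l = 1 - (x - s) / l by rewrite /l; field.
  by move: (_ / l) => k; lra.
- pose l := t - w.1 - x.
  have l1 : 0 < l by rewrite /l; lra.
  exists ((1 - (t - x) / l) * (Q - w.2) + (t - x) / l * e).
    apply: (@cvx_comb _ D0 _ _ ((t - x) / l) _ cD0 Dq De) => //=.
    + by rewrite divr_ge0 ?(ltW l1)// subr_ge0.
    + by rewrite ler_pdivrMr// mul1r /l; lra.
    + by rewrite /l; field; rewrite /l in l1; lra.
  have /lt_ : D0 (t, (1 - (- w.1) / l) * (Q - w.2) + (- w.1) / l * e).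
    apply: (@cvx_comb _ D0 _ _ ((- w.1) / l) _ cD0 Dq De) => //=.
    + by rewrite divr_ge0 ?oppr_ge0 ?(ltW w0)// ltW.
    + by rewrite ler_pdivrMr// mul1r /l; lra.
    + by rewrite /l; field; rewrite /l in l1; lra.
  have -> : (- w.1) / l = 1 - (t - x) / l.
    by rewrite /l; field; rewrite /l in l1; lra.
  by move: (_ / l) => k; lra.
Qed.

(** As the spindle is centrally symmetric, one point strictly below the midpoint of the chord makes
    this midpoint interior. *)
Definition dips D p q := exists2 y : R,
  spindle D p q ((p.1 + q.1) / 2, y) & y < (p.2 + q.2) / 2.

(** The point [c] is the interior point from which angles are measured. The rectangle around it is
    larger in both directions than the box that holds the arc from [x1] to [x4], which excludes
    antipodal points; [m0] and [M0] bound the heights of this arc. *)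
Lemma not_quadrangle D K x1 x2 x3 x4 c (a b m0 M0 B : R)
  (U14 U23 L13 L24 : R -> R) :
  convex_disk D -> origin_symmetric D -> C_convex D K ->
  low_at K x1 -> low_at K x2 -> low_at K x3 -> low_at K x4 ->
  x1.1 < x2.1 -> x2.1 < x3.1 -> x3.1 < x4.1 ->
  (forall x y : R, `|x - c.1| <= a -> `|y - c.2| <= b -> K (x, y)) ->
  0 < a -> 0 < b ->
  x4.1 - x1.1 < 2 * a ->
  x1.2 <= M0 -> x4.2 <= M0 -> M0 - m0 < 2 * b ->
  (forall x y : R, x1.1 <= x <= x4.1 -> K (x, y) -> m0 <= y) ->
  x1.2 < c.2 -> x2.2 < c.2 -> x3.2 < c.2 -> x4.2 < c.2 ->
  (x1.1 - c.1) / (c.2 - x1.2) < (x2.1 - c.1) / (c.2 - x2.2) ->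
  (x2.1 - c.1) / (c.2 - x2.2) < (x3.1 - c.1) / (c.2 - x3.2) ->
  (x3.1 - c.1) / (c.2 - x3.2) < (x4.1 - c.1) / (c.2 - x4.2) ->
  dips D x1 x4 -> dips D x2 x3 -> dips D x1 x3 -> dips D x2 x4 ->
  continuous U14 -> continuous U23 -> continuous L13 -> continuous L24 ->
  (forall x : R, x1.1 <= x <= x4.1 ->
     exists2 y : R, spindle D x1 x4 (x, y) & y <= U14 x) ->
  (forall x : R, x2.1 <= x <= x3.1 ->
     exists2 y : R, spindle D x2 x3 (x, y) & y <= U23 x) ->
  (forall x y : R, x1.1 <= x <= x3.1 -> spindle D x1 x3 (x, y) -> L13 x <= y) ->
  (forall x y : R, x2.1 <= x <= x4.1 -> spindle D x2 x4 (x, y) -> L24 x <= y) ->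
  (forall p, K p -> - B <= p.2) ->
  (forall x : R, x1.1 <= x <= x3.1 -> - B <= L13 x) ->
  (forall x : R, x2.1 <= x <= x4.1 -> - B <= L24 x) ->
  (\int[lebesgue_measure]_(x in `[x1.1, x4.1]) (U14 x + B)%:E +
   \int[lebesgue_measure]_(x in `[x2.1, x3.1]) (U23 x + B)%:E <
   \int[lebesgue_measure]_(x in `[x1.1, x3.1]) (L13 x + B)%:E +
   \int[lebesgue_measure]_(x in `[x2.1, x4.1]) (L24 x + B)%:E)%E ->
  ~ quadrangle_property D.
Proof.
move=> [coD /cvxP cD _] sD CK low1 low2 low3 low4 x12 x23 x34 rect a0 b0 wa M1 M4 Mm.
move=> lowm c1 c2 c3 c4 w12 w23 w34 d14 d23 d13 d24 cU14 cU23 cL13 cL24.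
move=> hU14 hU23 hL13 hL24 KB L13B L24B main QP.
have [[coK /cvxP cK Ki] spK] := CK.
have clK := compact_plane_closed coK.
have bK := compact_plane_bounded coK.
have x13 := lt_trans x12 x23. have x24 := lt_trans x23 x34.
have x14 := lt_trans x13 x34.
have Kc : K° c.
  apply/interiorP; exists (Num.min a b); first by rewrite lt_min a0.
  move=> [y1 y2]; rewrite !lt_min /= => /andP[h _] /andP[_ h'].
  by apply: rect; exact: ltW.
have btw p q : low_at K p -> low_at K q -> p.1 < q.1 -> dips D p q ->
    between K (spindle D p q) p q.
  move=> [Kp lp] [Kq lq] pq [y Zy ym]; split.
  - exact: spindle_cvx.
  - exact: spindle_closed.
  - exact: spK.
  - by split; [exact: spindle_left|exact: spindle_right].
  - apply: midpoint_interior Zy ym => //.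
    + exact: spindle_cvx.
    + by move=> z; exact: spindle_sym.
    + exact: spindle_left.
    + exact: spindle_right.
have rE p q : low_at K p -> low_at K q -> p.1 < q.1 -> dips D p q ->
    r_region D K p q = [set x | [/\ K° x, cross (q - p) (x - p) < 0
      & ~ spindle D p q x]].
  move=> Lp Lq pq dpq; have [cZ clZ ZK [Zp Zq] Zm] := btw p q Lp Lq pq dpq.
  exact: (region_between cK cZ clK clZ bK ZK Zp Zq pq Lp.2 Lq.2 Zm).
have bd p : low_at K p -> boundary K p.
  move=> [Kp lp]; apply/(boundary_closed _ clK); split => //.
  exact: low_not_interior.
have ccw : ccw_order4 K x1 x2 x3 x4 by exact: (ccw_order4_low Kc).
have trn : turning_angle_lt_pi K x1 x4.
  move=> z /(bd_arc_sub cK clK (bd _ low1) (bd _ low4) Ki)[bz cz].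
  have [_ _ ZK [Z1 Z4] Zm] := btw _ _ low1 low4 x14 d14.
  have Kz : K z by have /(boundary_closed _ clK)[] := bz.
  have /andP[z1 z4] := below_chord_strip cK ZK x14 low1.2 low4.2 Zm Kz cz.
  apply: (not_antipodal rect).
    by rewrite distrC ger0_norm ?subr_ge0//; lra.
  have mz : m0 <= z.2.
    by apply: (lowm z.1); [rewrite z1|case: (z) Kz].
  have zM : z.2 <= M0.
    move: cz; rewrite crossE => cz.
    have : (x4.1 - x1.1) * z.2 <= (x4.1 - x1.1) * M0.
      have h1 : 0 <= (x4.1 - z.1) * (M0 - x1.2) by rewrite mulr_ge0// subr_ge0.
      have h2 : 0 <= (z.1 - x1.1) * (M0 - x4.2) by rewrite mulr_ge0// subr_ge0.
      lra.
    by rewrite ler_pM2l// subr_gt0.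
  have mx : m0 <= x1.2.
    by apply: (lowm x1.1); [rewrite lexx ltW|case: (x1) low1 => ? ? []].
  rewrite ltr_norml; apply/andP; split; lra.
have := QP K CK x1 x2 x3 x4 (bd _ low1) (bd _ low2) (bd _ low3) (bd _ low4) ccw trn.
rewrite !rE// leNgt => /negP; apply.
apply: (area_comparison cK coK low1 low2 low3 low4 x12 x23 x34
  (btw _ _ low1 low4 x14 d14) (btw _ _ low2 low3 x23 d23)
  (btw _ _ low1 low3 x13 d13) (btw _ _ low2 low4 x24 d24)
  cU14 cU23 cL13 cL24 hU14 hU23 hL13 hL24 KB L13B L24B main).
Qed.

Lemma C_convex_bigcap D (I : Type) (v : I -> R * R) c (e : R) : compact D -> cvx D ->
  inhabited I -> 0 < e ->
  (forall i x y, `|x - c.1| < e -> `|y - c.2| < e -> translate (v i) D (x, y)) ->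
  C_convex D (\bigcap_i translate (v i) D).
Proof.
move=> coD cD [i0] e0 H; set K := \bigcap_i _.
split; last by move=> p q Kp Kq z Zz i _; apply: Zz; split; [exact: Kp|exact: Kq].
split.
- rewrite (_ : K = translate (v i0) D `&` K); last first.
    by rewrite setIidr// => z Kz; exact: Kz.
  apply: compact_closedI; first exact: translate_compact.
  apply: closed_bigI => i _.
  by apply: compact_plane_closed; exact: translate_compact.
- apply/cvxP => p q t Kp Kq t01 i _.
  by have tC := @translate_cvx _ (v i) D cD; exact: (tC p q t (Kp i Logic.I) (Kq i Logic.I) t01).
- exists c; apply/interiorP; exists e => // -[y1 y2] h1 h2 i _; exact: H.
Qed.

End failure.

(** * The dented parabola *)

Section model.
Context {R : realType}.
Implicit Types (p q o u v : R * R) (A B C D K Z : set (R * R)).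

Lemma integral_is_derive (f F : R -> R) (a b : R) : a < b -> continuous f ->
  (forall x : R, is_derive x 1 F (f x)) ->
  (\int[lebesgue_measure]_(x in `[a, b]) (f x)%:E = (F b - F a)%:E)%E.
Proof.
move=> ab cf dF.
have dF1 (x : R) : derivable F x 1 by case: (dF x).
have cF : continuous F.
  by move=> x; apply: differentiable_continuous; exact/derivable1_diffP.
rewrite (@continuous_FTC2 _ f F)//.
- exact: continuous_subspaceT.
- split => //.
  + exact/cvg_at_right_filter/cF.
  + exact/cvg_at_left_filter/cF.
- by move=> x _; rewrite derive1E; exact: derive_val.
Qed.

(** The third power makes the truncation at [1] and [-1] of class C^2. *)
Definition cubic_bump (z : R) : R := Num.max (1 - z ^+ 2) 0 ^+ 3.

Definition model (eps z : R) : R := z ^+ 2 / 2 - eps * cubic_bump z.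

(** The model without truncation. It agrees with [model] on [[-1, 1]], where the arcs of all four
    spindles lie, and has the odd polynomial primitive [primmodel]. *)
Definition polymodel (eps z : R) : R := z ^+ 2 / 2 - eps * (1 - z ^+ 2) ^+ 3.

Definition primmodel (eps z : R) : R :=
  z ^+ 3 / 6 - eps * (z - z ^+ 3 + 3 * z ^+ 5 / 5 - z ^+ 7 / 7).

Lemma model_in (eps z : R) : `|z| <= 1 -> model eps z = polymodel eps z.
Proof.
move=> z1; rewrite /model /polymodel /cubic_bump max_l// subr_ge0.
by rewrite -real_normK ?num_real// exprn_ile1.
Qed.

Lemma model_out (eps z : R) : 1 <= `|z| -> model eps z = z ^+ 2 / 2.
Proof.
move=> z1; rewrite /model /cubic_bump max_r ?expr0n ?mulr0 ?subr0// subr_le0.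
by rewrite -real_normK ?num_real// exprn_ege1.
Qed.

Lemma cubic_bump_itv (z : R) : 0 <= cubic_bump z <= 1.
Proof.
have h0 : 0 <= Num.max (1 - z ^+ 2) 0 by rewrite le_max lexx orbT.
have h1 : Num.max (1 - z ^+ 2) 0 <= 1 by rewrite ge_max ler01 gerBl sqr_ge0.
by rewrite /cubic_bump exprn_ge0//= exprn_ile1.
Qed.

Lemma is_derive_primmodel (eps k1 k2 d b a x : R) : d != 0 ->
  is_derive x 1 (fun x => k1 * x + k2 * (d * primmodel eps ((x - b) / d - a)))
    (k1 + k2 * polymodel eps ((x - b) / d - a)).
Proof.
move=> d0.
have dp (v : R) : is_derive v (1 : R) (primmodel eps) (polymodel eps v).
  rewrite /primmodel; apply: is_derive_eq.
  by rewrite /polymodel /GRing.scale/=; field.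
have da : is_derive x (1 : R) (fun x : R => (x - b) / d - a) d^-1.
  by apply: is_derive_eq; rewrite /GRing.scale/=; field.
have dc := @is_derive1_comp _ (primmodel eps) (fun x : R => (x - b) / d - a) x _ _ (dp _) da.
by apply: is_derive_eq; rewrite /GRing.scale/=; field.
Qed.

Lemma polymodel_continuous (eps k1 k2 d b a : R) :
  continuous (fun x => k1 + k2 * polymodel eps ((x - b) / d - a)).
Proof.
have cq : continuous (fun z : R => z ^+ 2) by exact: exprn_continuous.
have cp : continuous (polymodel eps).
  move=> z; apply: cvgB; apply: cvgM; [exact: cq|exact: cvg_cst|exact: cvg_cst|].
  apply: (@continuous_comp _ _ _ (fun z : R => 1 - z ^+ 2) (fun u : R => u ^+ 3)).
    by apply: cvgB; [exact: cvg_cst|exact: cq].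
  exact: exprn_continuous.
move=> x; apply: cvgD; first exact: cvg_cst.
apply: cvgM; first exact: cvg_cst.
apply: (@continuous_comp _ _ _ (fun x : R => (x - b) / d - a) (polymodel eps)); last exact: cp.
apply: cvgB; last exact: cvg_cst.
by apply: cvgM; [apply: cvgB; [exact: cvg_id|exact: cvg_cst]|exact: cvg_cst].
Qed.

(** The left side integrates the lower arcs over the pairs 14 and 23, the right side those over 13
    and 24, each of which spans half of the dent from its bottom to its rim; [H] is the height of
    this half, [polymodel eps 1 - polymodel eps 0]. After [eps / 10] is set aside for the errors of
    approximation, the difference is an exact polynomial in [eps] with leading coefficient
    [17 / 80]. *)
Lemma model_gap (eps : R) (s := eps / 2) (H := 1 / 2 + eps) : 0 < eps -> eps <= 1 / 10 ->
  2 * primmodel eps (1 / 2 + s) + 2 * primmodel eps (1 / 2 - s) +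
  (1 + 2 * s) * (H - polymodel eps (1 / 2 + s)) - (1 - 2 * s) * polymodel eps (1 / 2 - s)
  + eps / 10 < 2 * primmodel eps 1 + 2 * eps.
Proof.
move=> e0 e1; rewrite -subr_gt0.
have -> : 2 * primmodel eps 1 + 2 * eps - (2 * primmodel eps (1 / 2 + s) +
  2 * primmodel eps (1 / 2 - s) + (1 + 2 * s) * (H - polymodel eps (1 / 2 + s)) -
  (1 - 2 * s) * polymodel eps (1 / 2 - s) + eps / 10) =
  eps * (17 / 80 - eps / 2 + 9 / 16 * (eps ^+ 2 * (1 - eps ^+ 2)) +
    3 / 16 * eps ^+ 6).
  by rewrite /primmodel /polymodel /H /s; field.
have h1 : 0 <= eps ^+ 2 * (1 - eps ^+ 2).
  rewrite mulr_ge0 ?sqr_ge0// subr_ge0 exprn_ile1//; lra.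
have h2 : 0 <= eps ^+ 6 by rewrite exprn_ge0// ltW.
by rewrite mulr_gt0//; lra.
Qed.

End model.

(** * Numerical estimates for the four arcs that bound K *)

Section numerics.
Context {R : realType}.
Variables (eps Z : R).
Hypotheses (e0 : 0 < eps) (e1 : eps <= 1 / 10) (eZ : eps * Z = 1 / 2 + 2 * eps).
Hypothesis (Z7 : 7 <= Z).

(* Parabolas bounding the lower arcs of the four translates. *)
Definition arc1 (z : R) := (z + (1 / 2 + eps / 2) - Z) ^+ 2 / 2 + 2 * (eps / 100) + (1 / 2 + eps) - Z ^+ 2 / 2.
Definition arc2 (z : R) := (z + (1 / 2 - eps / 2) - (Z - 2)) ^+ 2 / 2 + 2 * (eps / 100) - (Z - 2) ^+ 2 / 2.
Definition arc3 (z : R) := (z - (1 / 2 - eps / 2) + (Z - 2)) ^+ 2 / 2 + 2 * (eps / 100) - (Z - 2) ^+ 2 / 2.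
Definition arc4 (z : R) := (z - (1 / 2 + eps / 2) + Z) ^+ 2 / 2 + 2 * (eps / 100) + (1 / 2 + eps) - Z ^+ 2 / 2.

Lemma eps_sq : 0 <= eps ^+ 2 <= eps / 10.
Proof.
rewrite sqr_ge0/= expr2; have h0 := e0; have h1 := e1.
by have := ler_wpM2l (ltW h0) h1; lra.
Qed.

Lemma Z_sq : 7 * Z <= Z ^+ 2.
Proof. by have h7 := Z7; rewrite expr2 ler_wpM2r//; lra. Qed.

(** By [eZ], the chord of the first two points, which are [eps] apart horizontally, has slope
    [- (Z - 1)]. The first two arcs have slopes [- Z] and [- (Z - 2)] at these points, so each
    passes below the other point with a margin of about [eps], which absorbs the slack
    [2 * (eps / 100)]. The other two arcs are their mirror images. *)
Lemma arcs_x1 (z := - (1 / 2 + eps / 2)) (w := 1 / 2 + eps) :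
  [/\ arc2 z <= w, arc3 z <= w & arc4 z <= w].
Proof.
have [/andP[q1 q2] q3] := (eps_sq, Z_sq).
have h0 := e0; have h1 := e1; have h2 := eZ; have h3 := Z7.
by split; rewrite /arc2 /arc3 /arc4 /z /w; lra.
Qed.

Lemma arcs_x2 (z := - (1 / 2 - eps / 2)) (w := 0) :
  [/\ arc1 z <= w, arc3 z <= w & arc4 z <= w].
Proof.
have [/andP[q1 q2] q3] := (eps_sq, Z_sq).
have h0 := e0; have h1 := e1; have h2 := eZ; have h3 := Z7.
by split; rewrite /arc1 /arc3 /arc4 /z /w; lra.
Qed.

Lemma arcs_x3 (z := 1 / 2 - eps / 2) (w := 0) :
  [/\ arc1 z <= w, arc2 z <= w & arc4 z <= w].
Proof.
have [/andP[q1 q2] q3] := (eps_sq, Z_sq).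
have h0 := e0; have h1 := e1; have h2 := eZ; have h3 := Z7.
by split; rewrite /arc1 /arc2 /arc4 /z /w; lra.
Qed.

Lemma arcs_x4 (z := 1 / 2 + eps / 2) (w := 1 / 2 + eps) :
  [/\ arc1 z <= w, arc2 z <= w & arc3 z <= w].
Proof.
have [/andP[q1 q2] q3] := (eps_sq, Z_sq).
have h0 := e0; have h1 := e1; have h2 := eZ; have h3 := Z7.
by split; rewrite /arc1 /arc2 /arc3 /z /w; lra.
Qed.

Lemma arcs_rect (z : R) : `|z| <= 2 -> [/\ arc1 z <= 2 * Z ^+ 2,
  arc2 z <= 2 * Z ^+ 2, arc3 z <= 2 * Z ^+ 2 & arc4 z <= 2 * Z ^+ 2].
Proof.
have [/andP[q1 q2] q3] := (eps_sq, Z_sq).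
have h0 := e0; have h1 := e1; have h3 := Z7.
have quad (t Y : R) : 0 <= Y -> - 3 <= t -> t <= 3 ->
    (t - Y) ^+ 2 / 2 - Y ^+ 2 / 2 <= 3 * Y + 9 / 2 /\
    (t + Y) ^+ 2 / 2 - Y ^+ 2 / 2 <= 3 * Y + 9 / 2.
  move=> Y0 t1 t2; clear -Y0 t1 t2.
  have : 0 <= (3 - t) * Y by rewrite mulr_ge0// subr_ge0.
  have : 0 <= (3 + t) * Y by rewrite mulr_ge0//; lra.
  have : 0 <= (3 - t) * (3 + t) by rewrite mulr_ge0//; lra.
  by split; lra.
rewrite ler_norml => /andP[z1 z2].
have Z0 : 0 <= Z by lra.
have Z20 : 0 <= Z - 2 by lra.
have [||A1 _] := quad (z + (1 / 2 + eps / 2)) _ Z0; [lra|lra|].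
have [||A2 _] := quad (z + (1 / 2 - eps / 2)) _ Z20; [lra|lra|].
have [||_ A3] := quad (z - (1 / 2 - eps / 2)) _ Z20; [lra|lra|].
have [||_ A4] := quad (z - (1 / 2 + eps / 2)) _ Z0; [lra|lra|].
by split; rewrite /arc1 /arc2 /arc3 /arc4; lra.
Qed.

Lemma strip_low (z : R) : `|z| <= 1 -> 
  - 2 * Z - 2 <= (z + (1 / 2 - eps / 2) - (Z - 2)) ^+ 2 / 2 - eps - 2 * (eps / 100)
    - (Z - 2) ^+ 2 / 2.
Proof.
have h0 := e0; have h1 := e1; have h3 := Z7.
rewrite ler_norml => /andP[z1 z2].
have := sqr_ge0 (z + (1 / 2 - eps / 2)).
have : 0 <= (2 - (z + (1 / 2 - eps / 2))) * (Z - 2) by rewrite mulr_ge0//; lra.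
lra.
Qed.

End numerics.

(** * Disks with a lower boundary close to the dented parabola *)

Section window.
Context {R : realType}.
Implicit Types (p q u v : R * R) (A B K : set (R * R)).
Variables (eps Z : R) (D : set (R * R)) (b : R * R) (d k : R) (h : R -> R).
Hypotheses (e0 : 0 < eps) (e1 : eps <= 1 / 10) (eZ : eps * Z = 1 / 2 + 2 * eps).
Hypotheses (Z7 : 7 <= Z).
Hypotheses (convD : convex_disk D) (sD : origin_symmetric D) (d0 : 0 < d) (k0 : 0 < k).
Hypothesis lowz : forall z : R, `|z| <= 4 * Z -> low_at D (b.1 + d * z, b.2 + k * h z).
Hypothesis hmodel : forall z : R, `|z| <= 4 * Z -> `|h z - model eps z| <= eps / 100.

Lemma window_cvx : cvx D.
Proof. by case: convD => _ /cvxP. Qed.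

Lemma window_out (z : R) : 1 <= `|z| -> `|z| <= 4 * Z ->
  z ^+ 2 / 2 - eps / 100 <= h z <= z ^+ 2 / 2 + eps / 100.
Proof.
move=> z1 /hmodel; rewrite model_out// ler_norml => /andP[? ?].
by apply/andP; split; lra.
Qed.

Lemma window_in (z : R) : `|z| <= 1 ->
  polymodel eps z - eps / 100 <= h z <= polymodel eps z + eps / 100.
Proof.
move=> z1; have zN : `|z| <= 4 * Z by have h7 := Z7; lra.
have := hmodel zN; rewrite model_in// ler_norml => /andP[? ?].
by apply/andP; split; lra.
Qed.

Lemma window_itv (z : R) : `|z| <= 4 * Z ->
  z ^+ 2 / 2 - eps - eps / 100 <= h z <= z ^+ 2 / 2 + eps / 100.
Proof.
move=> /hmodel; rewrite ler_norml /model => /andP[h1 h2].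
have /andP[b0 b1] := cubic_bump_itv z.
have p0 : 0 <= eps * cubic_bump z by rewrite mulr_ge0// ltW.
have p1 : eps * cubic_bump z <= eps * 1 by rewrite ler_wpM2l// ltW.
by apply/andP; split; lra.
Qed.

Definition wpt (z w : R) : R * R := (b.1 + d * z, b.2 + k * w).

Definition wtr (a e : R) := translate (d * a, k * e) D.

Lemma wptP (z y : R) : exists w, (b.1 + d * z, y) = wpt z w.
Proof. by exists ((y - b.2) / k); apply: pair_ext => //=; field; rewrite lt0r_neq0. Qed.

Lemma le_wpt (w y : R) : (b.2 + k * w <= b.2 + k * y) = (w <= y).
Proof. by rewrite lerD2l ler_pM2l. Qed.

(** The chord between the two ends of the window has height at least [8 * Z ^+ 2 - eps / 100], since
    [(4 * Z) ^+ 2 / 2] is [8 * Z ^+ 2]; by convexity everything between the graph and this level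
    belongs to [D]. *)
Lemma window_mem (z w : R) : `|z| <= 4 * Z -> h z <= w ->
  w <= 8 * Z ^+ 2 - eps / 100 -> D (wpt z w).
Proof.
move=> zN hw wW; have h7 := Z7; have cD := window_cvx.
have NN : `|4 * Z| <= 4 * Z by rewrite ger0_norm//; lra.
have NNm : `|- (4 * Z)| <= 4 * Z by rewrite normrN.
have N1 : 1 <= 4 * Z by lra.
have /andP[a1 _] : (4 * Z) ^+ 2 / 2 - eps / 100 <= h (4 * Z)
    <= (4 * Z) ^+ 2 / 2 + eps / 100.
  by apply: window_out => //; rewrite ger0_norm//; lra.
have /andP[a2 _] : (- (4 * Z)) ^+ 2 / 2 - eps / 100 <= h (- (4 * Z))
    <= (- (4 * Z)) ^+ 2 / 2 + eps / 100.
  by apply: window_out => //; rewrite normrN ger0_norm//; lra.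
have b1 : w <= h (4 * Z) by lra.
have b2 : w <= h (- (4 * Z)) by rewrite sqrrN in a2; lra.
move: {a1 a2} (h (- (4 * Z))) (h (4 * Z)) (lowz NNm).1 (lowz NN).1 b2 b1.
move=> h1 h2 D1 D2 b2 b1.
pose t := (z + 4 * Z) / (8 * Z).
have /andP[z1 z2] : - (4 * Z) <= z <= 4 * Z by rewrite -ler_norml.
have t0 : 0 <= t by rewrite divr_ge0//; lra.
have t1 : t <= 1 by rewrite ler_pdivrMr; lra.
have zE : z = (1 - t) * (- (4 * Z)) + t * (4 * Z) by rewrite /t; field; lra.
clearbody t.
have Dc : D (b.1 + d * z, b.2 + k * ((1 - t) * h1 + t * h2)).
  apply: (cvx_comb cD D1 D2 t0 t1) => /=; last by ring.
  by rewrite {1}zE; ring.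
apply: (cvx_vertical cD (lowz zN).1 Dc) => /=; rewrite le_wpt//.
have : 0 <= (1 - t) * (h1 - w) by rewrite mulr_ge0 ?subr_ge0.
have : 0 <= t * (h2 - w) by rewrite mulr_ge0 ?subr_ge0.
lra.
Qed.

Lemma wtrP (a e z w : R) : wtr a e (wpt z w) <-> D (wpt (z - a) (w - e)).
Proof.
split=> [/translateP|h0]; [|apply/translateP].
  by congr (D _); apply: pair_ext; rewrite /wpt /=; ring.
by move: h0; congr (D _); apply: pair_ext; rewrite /wpt /=; ring.
Qed.

Lemma wtr_mem (a e z w : R) : `|z - a| <= 4 * Z -> h (z - a) + e <= w ->
  w - e <= 8 * Z ^+ 2 - eps / 100 -> wtr a e (wpt z w).
Proof.
by move=> za hw wW; apply/wtrP/window_mem => //; rewrite lerBrDr.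
Qed.

Lemma wtr_low (a e z w : R) : `|z - a| <= 4 * Z -> wtr a e (wpt z w) -> h (z - a) + e <= w.
Proof.
move=> za /wtrP h1.
have [_ /(_ (b.2 + k * (w - e)))] := lowz za.
by move=> /(_ h1) /=; rewrite le_wpt lerBrDr.
Qed.

Lemma window_inner (u : R) : `|u| <= 1 -> `|u| <= 4 * Z /\ h u <= 2.
Proof.
move=> u1; have uN : `|u| <= 4 * Z by have h7 := Z7; lra.
split => //; have /andP[_ h2] := window_itv uN.
have : u ^+ 2 <= 1 by rewrite -real_normK ?num_real// exprn_ile1.
by have h1 := e1; lra.
Qed.

Lemma window_tall : 2 + 1 <= 8 * Z ^+ 2 - eps / 100.
Proof. by have := Z_sq Z7; have h1 := e1; have h7 := Z7; lra. Qed.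

Lemma wtr_low_at (a e u : R) : `|u - a| <= 1 -> low_at (wtr a e) (wpt u (h (u - a) + e)).
Proof.
move=> ua; have [uN hu] := window_inner ua.
split; first by apply: wtr_mem => //; have := window_tall; lra.
move=> y /=; have [w yE] := wptP u y; rewrite yE => /(wtr_low uN) hw.
by have /= -> := congr1 snd yE; rewrite le_wpt.
Qed.

(** A translate of [D] is lifted until its lower arc passes above both end points, which
    [spindle_above_low] turns into membership in the spindle; where this arc is above the chord, the
    chord itself is used. One error [eps / 100] comes from the height of the lift, the other from
    the arc. *)
Lemma spindle_arc_le (s1 s2 P Q a C : R) : s1 < s2 -> `|s1 - a| <= 1 -> `|s2 - a| <= 1 ->
  P - polymodel eps (s1 - a) <= C -> Q - polymodel eps (s2 - a) <= C ->
  forall z, s1 <= z <= s2 ->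
    exists2 w, spindle D (wpt s1 P) (wpt s2 Q) (wpt z w) &
      w <= polymodel eps (z - a) + C + 2 * (eps / 100).
Proof.
move=> s12 a1 a2 PC QC z /andP[z1 z2].
pose e := Num.max (P - h (s1 - a)) (Q - h (s2 - a)).
have Pe : P - h (s1 - a) <= e by rewrite le_max lexx.
have Qe : Q - h (s2 - a) <= e by rewrite le_max lexx orbT.
have eC : e <= C + eps / 100.
  have /andP[h1 _] := window_in a1. have /andP[h2 _] := window_in a2.
  by rewrite ge_max; apply/andP; split; lra.
clearbody e.
have za : `|z - a| <= 1.
  by move: a1 a2; rewrite !ler_norml => /andP[? ?] /andP[? ?]; apply/andP; split; lra.
have /andP[_ h3] := window_in za.
pose ch := P + (z - s1) * (Q - P) / (s2 - s1).
have s21 : s2 - s1 != 0 by rewrite subr_eq0 gt_eqF.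
have Zch : spindle D (wpt s1 P) (wpt s2 Q) (wpt z ch).
  apply: (@cvx_comb _ _ (wpt s1 P) (wpt s2 Q) ((z - s1) / (s2 - s1))).
  + by apply: spindle_cvx; exact: window_cvx.
  + exact: spindle_left.
  + exact: spindle_right.
  + by rewrite divr_ge0// subr_ge0// ltW.
  + by rewrite ler_pdivrMr ?subr_gt0// mul1r lerD2r.
  + by rewrite /wpt /=; field.
  + by rewrite /wpt /ch /=; field.
have [hc|hc] := leP (h (z - a) + e) ch; last first.
  by exists ch => //; lra.
exists (h (z - a) + e); last by lra.
apply: (@spindle_above_low _ D (d * a, k * e) _ _ _ _ _ _ _ _ window_cvx
  (wtr_low_at e a1) (wtr_low_at e a2)).
+ by rewrite le_wpt -lerBlDl.
+ by rewrite le_wpt -lerBlDl.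
+ by rewrite ltrD2l ltr_pM2l.
+ by rewrite !lerD2l !ler_pM2l// z1.
+ exact: (wtr_low_at e za).1.
+ have -> : b.2 + k * P + (b.1 + d * z - (b.1 + d * s1)) *
      (b.2 + k * Q - (b.2 + k * P)) / (b.1 + d * s2 - (b.1 + d * s1)) = b.2 + k * ch.
    rewrite /ch; field.
    by rewrite s21/= subr_eq0 gt_eqF// ltrD2l ltr_pM2l.
  by rewrite le_wpt.
Qed.

(** Dually, the translate is lowered until it contains both end points, and then it contains their
    spindle. *)
Lemma spindle_arc_ge (s1 s2 P Q a C : R) : `|s1 - a| <= 1 -> `|s2 - a| <= 1 ->
  C <= P - polymodel eps (s1 - a) -> C <= Q - polymodel eps (s2 - a) ->
  0 <= C -> P <= 1 -> Q <= 1 ->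
  forall z w, `|z - a| <= 1 -> spindle D (wpt s1 P) (wpt s2 Q) (wpt z w) ->
    polymodel eps (z - a) + C - 2 * (eps / 100) <= w.
Proof.
move=> a1 a2 PC QC C0 P1 Q1 z w za.
pose e := Num.min (P - h (s1 - a)) (Q - h (s2 - a)).
have Pe : e <= P - h (s1 - a) by rewrite ge_min lexx.
have Qe : e <= Q - h (s2 - a) by rewrite ge_min lexx orbT.
have eC : C - eps / 100 <= e.
  have /andP[_ h1] := window_in a1. have /andP[_ h2] := window_in a2.
  by rewrite le_min; apply/andP; split; lra.
clearbody e.
have Zsub : spindle D (wpt s1 P) (wpt s2 Q) `<=` wtr a e.
  have W2 := window_tall. have h1 := e1.
  move=> u Zu; apply: Zu; split; apply: wtr_mem.
  - exact: (window_inner a1).1.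
  - by rewrite -lerBrDl.
  - by lra.
  - exact: (window_inner a2).1.
  - by rewrite -lerBrDl.
  - by lra.
move=> /Zsub /(wtr_low (window_inner za).1) => h1.
by have /andP[h3 _] := window_in za; lra.
Qed.

Lemma wtr_mem_model (a P Y hY z w : R) : 0 <= P -> P <= 1 -> Y ^+ 2 <= Z ^+ 2 ->
  Y ^+ 2 / 2 - eps / 100 <= hY <= Y ^+ 2 / 2 + eps / 100 -> `|z - a| <= 4 * Z ->
  (z - a) ^+ 2 / 2 + 2 * (eps / 100) + P - Y ^+ 2 / 2 <= w -> w <= 7 * Z ^+ 2 ->
  wtr a (P - hY) (wpt z w).
Proof.
move=> P0 P1 YZ /andP[hY1 hY2] za wl wu.
have /andP[_ h1] := window_itv za.
have h2 := Z_sq Z7; have h3 := Z7; have h4 := e0; have h5 := e1.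
by apply: wtr_mem => //; lra.
Qed.

Let g1 : R := 1 / 2 + eps / 2.
Let g2 : R := 1 / 2 - eps / 2.
Let H : R := 1 / 2 + eps.

(** Each translate has one of the four points exactly on its lower arc, at window abscissa [- Z],
    [- (Z - 2)], [Z - 2] and [Z] for x_1 to x_4 in the listed order. *)
Definition wshift (i : bool * bool) : R * R := match i with
  | (false, false) => (d * (Z - g1), k * (H - h (- Z)))
  | (false, true) => (d * ((Z - 2) - g2), k * (0 - h (- (Z - 2))))
  | (true, false) => (d * (g2 - (Z - 2)), k * (0 - h (Z - 2)))
  | (true, true) => (d * (g1 - Z), k * (H - h Z)) end.

Definition whull := \bigcap_i translate (wshift i) D.

Lemma wshift_itv (Y : R) : Y = Z \/ Y = Z - 2 ->
  [/\ Y ^+ 2 <= Z ^+ 2, Y ^+ 2 / 2 - eps / 100 <= h Y <= Y ^+ 2 / 2 + eps / 100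
    & Y ^+ 2 / 2 - eps / 100 <= h (- Y) <= Y ^+ 2 / 2 + eps / 100].
Proof.
move=> YE; have h7 := Z7.
have [Y1 Y2] : 1 <= Y /\ Y <= Z by case: YE => ->; split; lra.
split.
- by rewrite ler_sqr ?nnegrE; lra.
- by apply: window_out; rewrite ger0_norm; lra.
- by rewrite -(sqrrN Y); apply: window_out; rewrite normrN ger0_norm; lra.
Qed.

Lemma whull_mem (z w : R) : `|z| <= 2 -> w <= 7 * Z ^+ 2 ->
  [/\ arc1 eps Z z <= w -> translate (wshift (false, false)) D (wpt z w),
      arc2 eps Z z <= w -> translate (wshift (false, true)) D (wpt z w),
      arc3 eps Z z <= w -> translate (wshift (true, false)) D (wpt z w)
    & arc4 eps Z z <= w -> translate (wshift (true, true)) D (wpt z w)].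
Proof.
rewrite ler_norml => /andP[z1 z2] w7; have h7 := Z7; have h1 := e1; have h0 := e0.
have H0 : 0 <= H by rewrite /H; lra.
have H1 : H <= 1 by rewrite /H; lra.
have [|p1 q1 r1] := @wshift_itv Z; first by left.
have [|p2 q2 r2] := @wshift_itv (Z - 2); first by right.
split=> hw.
- apply: (wtr_mem_model H0 H1 p1 r1) => //.
    by rewrite ler_norml /g1; apply/andP; split; lra.
  by rewrite [leLHS](_ : _ = arc1 eps Z z)// /arc1 /g1 /g2 /H; field.
- apply: (wtr_mem_model (lexx 0) ler01 p2 r2) => //.
    by rewrite ler_norml /g2; apply/andP; split; lra.
  by rewrite [leLHS](_ : _ = arc2 eps Z z)// /arc2 /g1 /g2 /H; field.
- apply: (wtr_mem_model (lexx 0) ler01 p2 q2) => //.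
    by rewrite ler_norml /g2; apply/andP; split; lra.
  by rewrite [leLHS](_ : _ = arc3 eps Z z)// /arc3 /g1 /g2 /H; field.
- apply: (wtr_mem_model H0 H1 p1 q1) => //.
    by rewrite ler_norml /g1; apply/andP; split; lra.
  by rewrite [leLHS](_ : _ = arc4 eps Z z)// /arc4 /g1 /g2 /H; field.
Qed.

(** Shared by the four points: [i] is the translate that has the point on its lower arc, so the hull
    cannot reach lower, and the other three need only contain the point. *)
Lemma whull_low_at (i : bool * bool) (z P Y a : R) : `|z| <= 2 -> 0 <= P -> P <= 1 ->
  (Y = Z \/ Y = Z - 2) \/ (Y = - Z \/ Y = - (Z - 2)) ->
  wshift i = (d * a, k * (P - h Y)) -> z - a = Y ->
  (i = (false, false) \/ arc1 eps Z z <= P) ->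
  (i = (false, true) \/ arc2 eps Z z <= P) ->
  (i = (true, false) \/ arc3 eps Z z <= P) ->
  (i = (true, true) \/ arc4 eps Z z <= P) ->
  low_at whull (wpt z P).
Proof.
move=> z2 P0 P1 YE iE zY c1 c2 c3 c4.
have h7 := Z7; have hs := Z_sq Z7; have h1 := e1; have h0 := e0.
have [Y1 Y2] : `|Y| <= 4 * Z /\ h Y <= Z ^+ 2.
  have [X [XE p q r]] : exists X : R, [/\ (Y = X \/ Y = - X) /\ (X = Z \/ X = Z - 2),
      X ^+ 2 <= Z ^+ 2, X ^+ 2 / 2 - eps / 100 <= h X <= X ^+ 2 / 2 + eps / 100 &
      X ^+ 2 / 2 - eps / 100 <= h (- X) <= X ^+ 2 / 2 + eps / 100].
    have [a1 a2 a3] := @wshift_itv Z (or_introl erefl).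
    have [b1 b2 b3] := @wshift_itv (Z - 2) (or_intror erefl).
    case: YE => -[] ->; [exists Z|exists (Z - 2)|exists Z|exists (Z - 2)]; split => //;
      by split; tauto.
  have [YX XZ] := XE.
  move: q r => /andP[_ q] /andP[_ r].
  have Xn : `|X| <= 4 * Z.
    by case: XZ => ->; rewrite ger0_norm; lra.
  by case: YX => ->; rewrite ?normrN; split => //; lra.
have Pw : P <= 7 * Z ^+ 2 by lra.
have [m1 m2 m3 m4] := whull_mem z2 Pw.
have ex : translate (wshift i) D (wpt z P).
  by rewrite iE; apply: wtr_mem; rewrite ?zY; lra.
split.
  move=> [[|] [|]] _.
  - by case: c4 => [<-//|]; exact: m4.
  - by case: c3 => [<-//|]; exact: m3.
  - by case: c2 => [<-//|]; exact: m2.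
  - by case: c1 => [<-//|]; exact: m1.
move=> y /= /(_ i Logic.I); have [w yE] := wptP z y; rewrite yE iE.
move=> /wtr_low; rewrite zY => /(_ Y1) hw.
by have /= -> := congr1 snd yE; rewrite le_wpt; lra.
Qed.

Lemma whull_low1 : low_at whull (wpt (- g1) H).
Proof.
have h0 := e0; have h1 := e1.
have [c2 c3 c4] := arcs_x1 e0 e1 eZ Z7.
apply: (@whull_low_at (false, false) _ _ (- Z) (Z - g1)); [| | | | by []| |
  by left|by right|by right|by right].
- by rewrite ler_norml /g1; apply/andP; split; lra.
- by rewrite /H; lra.
- by rewrite /H; lra.
- by right; left.
- by ring.
Qed.

Lemma whull_low2 : low_at whull (wpt (- g2) 0).
Proof.
have h0 := e0; have h1 := e1.
have [c1 c3 c4] := arcs_x2 e0 e1 eZ Z7.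
apply: (@whull_low_at (false, true) _ _ (- (Z - 2)) (Z - 2 - g2)); [| | | | by []| |
  by right|by left|by right|by right] => //.
- by rewrite ler_norml /g2; apply/andP; split; lra.
- by right; right.
- by ring.
Qed.

Lemma whull_low3 : low_at whull (wpt g2 0).
Proof.
have h0 := e0; have h1 := e1.
have [c1 c2 c4] := arcs_x3 e0 e1 eZ Z7.
apply: (@whull_low_at (true, false) _ _ (Z - 2) (g2 - (Z - 2))); [| | | | by []| |
  by right|by right|by left|by right] => //.
- by rewrite ler_norml /g2; apply/andP; split; lra.
- by left; right.
- by ring.
Qed.

Lemma whull_low4 : low_at whull (wpt g1 H).
Proof.
have h0 := e0; have h1 := e1.
have [c1 c2 c3] := arcs_x4 e0 e1 eZ Z7.
apply: (@whull_low_at (true, true) _ _ Z (g1 - Z)); [| | | | by []| |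
  by right|by right|by right|by left].
- by rewrite ler_norml /g1; apply/andP; split; lra.
- by rewrite /H; lra.
- by rewrite /H; lra.
- by left; left.
- by ring.
Qed.

Lemma wptK (x : R) : b.1 + d * ((x - b.1) / d) = x.
Proof. by field; rewrite lt0r_neq0. Qed.

Lemma whull_rect (i : bool * bool) (x y : R) : `|x - b.1| <= d * 2 ->
  `|y - (b.2 + k * (4 * Z ^+ 2))| <= k * (2 * Z ^+ 2) -> translate (wshift i) D (x, y).
Proof.
pose z := (x - b.1) / d; have xE : x = b.1 + d * z by rewrite wptK.
have [w yE] := wptP z y; rewrite -xE in yE; rewrite yE.
have /= -> := congr1 snd yE; rewrite xE.
rewrite addrAC subrr add0r normrM (gtr0_norm d0) ler_pM2l// => z2.
rewrite opprD addrACA subrr add0r -mulrBr normrM (gtr0_norm k0) ler_pM2l//.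
rewrite ler_norml => /andP[w1 w2].
have [a1 a2 a3 a4] := arcs_rect e0 e1 Z7 z2.
have hs := Z_sq Z7; have h7 := Z7.
have ww : 2 * Z ^+ 2 <= w by lra.
have w7 : w <= 7 * Z ^+ 2 by lra.
have [m1 m2 m3 m4] := whull_mem z2 w7.
by move: i => [[|] [|]]; [apply: m4|apply: m3|apply: m2|apply: m1];
  exact: le_trans ww.
Qed.

Lemma whull_C_convex : C_convex D whull.
Proof.
apply: (@C_convex_bigcap _ D (bool * bool)%type wshift
  (b.1, b.2 + k * (4 * Z ^+ 2)) (Num.min (d * 2) (k * (2 * Z ^+ 2)))).
- by case: convD.
- exact: window_cvx.
- by constructor; exact: (true, true).
- have h7 := Z7; have hs := Z_sq Z7.
  by rewrite lt_min !mulr_gt0//=; lra.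
- move=> i x y /=; rewrite !lt_min => /andP[h1 _] /andP[_ h2].
  by apply: whull_rect; exact: ltW.
Qed.

Lemma dips_arc (s1 s2 P Q a C : R) : s1 < s2 -> `|s1 - a| <= 1 -> `|s2 - a| <= 1 ->
  P - polymodel eps (s1 - a) <= C -> Q - polymodel eps (s2 - a) <= C ->
  polymodel eps ((s1 + s2) / 2 - a) + C + 2 * (eps / 100) < (P + Q) / 2 ->
  dips D (wpt s1 P) (wpt s2 Q).
Proof.
move=> s12 a1 a2 PC QC lt_.
have [|w Zw wle] := spindle_arc_le s12 a1 a2 PC QC (z := (s1 + s2) / 2).
  by apply/andP; split; lra.
exists (b.2 + k * w) => /=.
  by move: Zw; congr (spindle _ _ _ _); apply: pair_ext => //=; field.
have -> : (b.2 + k * P + (b.2 + k * Q)) / 2 = b.2 + k * ((P + Q) / 2) by field.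
by rewrite ltrD2l ltr_pM2l//; exact: le_lt_trans lt_.
Qed.

Definition warc (a C x : R) := b.2 + k * C + k * polymodel eps ((x - b.1) / d - a).

Lemma warc_wpt (a C z : R) : warc a C (b.1 + d * z) = b.2 + k * (polymodel eps (z - a) + C).
Proof.
rewrite /warc (_ : (b.1 + d * z - b.1) / d = z); first by ring.
by field; rewrite lt0r_neq0.
Qed.

Lemma warc_continuous (a C : R) : continuous (warc a C).
Proof. exact: polymodel_continuous. Qed.

Lemma warc_integral (a C z1 z2 B : R) : z1 < z2 ->
  (\int[lebesgue_measure]_(x in `[(b.1 + d * z1)%R, (b.1 + d * z2)%R]) (warc a C x + B)%:E =
   ((b.2 + k * C + B) * (d * (z2 - z1)) +
    k * d * (primmodel eps (z2 - a) - primmodel eps (z1 - a)))%:E)%E.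
Proof.
move=> z12; have dn0 : d != 0 by rewrite lt0r_neq0.
pose F (x : R) := (b.2 + k * C + B) * x + k * (d * primmodel eps ((x - b.1) / d - a)).
transitivity (F (b.1 + d * z2) - F (b.1 + d * z1))%:E; last first.
  have kE (z : R) : (b.1 + d * z - b.1) / d = z by field.
  by rewrite /F !kE; congr (_%:E); ring.
apply: (@integral_is_derive R (fun x => warc a C x + B)).
- by rewrite ltrD2l ltr_pM2l.
- by move=> x; apply: cvgD; [exact: warc_continuous|exact: cvg_cst].
- move=> x; have := @is_derive_primmodel R eps (b.2 + k * C + B) k d b.1 a x dn0.
  by rewrite (_ : warc a C x + B = b.2 + k * C + B + k * polymodel eps ((x - b.1) / d - a))
    // /warc; ring.
Qed.

Lemma in_strip (s1 s2 x : R) : b.1 + d * s1 <= x <= b.1 + d * s2 ->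
  exists2 z, x = b.1 + d * z & s1 <= z <= s2.
Proof.
by rewrite -{1 2}(wptK x) !lerD2l !ler_pM2l// => h0; exists ((x - b.1) / d); rewrite ?wptK.
Qed.

Lemma warc_above (s1 s2 P Q a C : R) : s1 < s2 -> `|s1 - a| <= 1 -> `|s2 - a| <= 1 ->
  P - polymodel eps (s1 - a) <= C -> Q - polymodel eps (s2 - a) <= C ->
  forall x, (wpt s1 P).1 <= x <= (wpt s2 Q).1 ->
    exists2 y, spindle D (wpt s1 P) (wpt s2 Q) (x, y) &
      y <= warc a (C + 2 * (eps / 100)) x.
Proof.
move=> s12 a1 a2 PC QC x /in_strip[z -> zs].
have [w Zw wle] := spindle_arc_le s12 a1 a2 PC QC zs.
by exists (b.2 + k * w) => //; rewrite warc_wpt le_wpt addrA.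
Qed.

Lemma warc_below (s1 s2 P Q a C : R) : `|s1 - a| <= 1 -> `|s2 - a| <= 1 ->
  C <= P - polymodel eps (s1 - a) -> C <= Q - polymodel eps (s2 - a) ->
  0 <= C -> P <= 1 -> Q <= 1 ->
  forall x y, (wpt s1 P).1 <= x <= (wpt s2 Q).1 ->
    spindle D (wpt s1 P) (wpt s2 Q) (x, y) -> warc a (C - 2 * (eps / 100)) x <= y.
Proof.
move=> a1 a2 PC QC C0 P1 Q1 x y /in_strip[z -> /andP[z1 z2]].
have [w yE] := wptP z y; rewrite yE => Zw.
have /= -> := congr1 snd yE; rewrite warc_wpt le_wpt addrA.
apply: (spindle_arc_ge a1 a2 PC QC C0 P1 Q1) Zw.
by move: a1 a2; rewrite !ler_norml => /andP[? ?] /andP[? ?]; apply/andP; split; lra.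
Qed.

(** The slack [nu] is lost over four intervals of total length [4] in window units, that is
    [8 * eps / 100], less than the reserve [eps / 10] of [model_gap]. *)
Lemma window_gap (B : R) (nu := 2 * (eps / 100)) :
  (\int[lebesgue_measure]_(x in `[(b.1 + d * (- g1))%R, (b.1 + d * g1)%R])
      (warc 0 (H - polymodel eps g1 + nu) x + B)%:E +
   \int[lebesgue_measure]_(x in `[(b.1 + d * (- g2))%R, (b.1 + d * g2)%R])
      (warc 0 (0 - polymodel eps g2 + nu) x + B)%:E <
   \int[lebesgue_measure]_(x in `[(b.1 + d * (- g1))%R, (b.1 + d * g2)%R])
      (warc g2 (eps - nu) x + B)%:E +
   \int[lebesgue_measure]_(x in `[(b.1 + d * (- g2))%R, (b.1 + d * g1)%R])
      (warc (- g2) (eps - nu) x + B)%:E)%E.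
Proof.
have h0 := e0; have h1 := e1.
rewrite !warc_integral ?/g1 ?/g2; [|lra|lra|lra|lra].
rewrite -!EFinD lte_fin -/g1 -/g2 -subr_gt0.
have podd (z : R) : primmodel eps (- z) = - primmodel eps z.
  by rewrite /primmodel; field.
have gap := model_gap h0 h1; rewrite -/g1 -/g2 -/H in gap.
have E1 : g2 - - g2 = 2 * g2 by ring.
have E2 : - g1 - g2 = - 1 by rewrite /g1 /g2; field.
have E3 : g1 - - g2 = 1 by rewrite /g1 /g2; field.
rewrite !subr0 E2 E3 subrr addrN !podd.
have p0 : primmodel eps 0 = 0 by rewrite /primmodel; field.
have : 0 < k * d * (2 * primmodel eps 1 + 2 * eps - (2 * primmodel eps g1 + 2 * primmodel eps g2 +
  (1 + 2 * (eps / 2)) * (H - polymodel eps g1) - (1 - 2 * (eps / 2)) * polymodel eps g2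
  + eps / 10)).
  by rewrite !mulr_gt0 ?subr_gt0.
have : 0 < k * d * eps by rewrite !mulr_gt0.
rewrite p0; move: (primmodel eps 1) (primmodel eps g1) (primmodel eps g2).
move: (polymodel eps g1) (polymodel eps g2) => u4 u5 u1 u2 u3.
by rewrite /nu /H /g1 /g2 => q1 q2; lra.
Qed.

(** For the pairs 13 and 24 the dented parabola is moved so that the bottom of its dent is at the
    lower point and its rim at the higher one; it is lifted by [eps] because the bottom of the model
    has height [- eps]. *)
Lemma skew_dips : dips D (wpt (- g1) H) (wpt g2 0) /\ dips D (wpt (- g2) 0) (wpt g1 H).
Proof.
have h0 := e0; have h1 := e1; have HE : H = 1 / 2 + eps by [].
have g12 : g1 + g2 = 1 by rewrite /g1 /g2; field.
have g10 : 0 < g1 by rewrite /g1; lra.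
have g20 : 0 < g2 by rewrite /g2; lra.
have peven (z : R) : polymodel eps (- z) = polymodel eps z.
  by rewrite /polymodel sqrrN.
have pg1 : polymodel eps 1 = 1 / 2 by rewrite /polymodel; field.
have pg0 : polymodel eps 0 = - eps by rewrite /polymodel; field.
have pghalf : polymodel eps (1 / 2) = 1 / 8 - 27 / 64 * eps by rewrite /polymodel; field.
split.
  have E1 : - g1 - g2 = - 1 by lra.
  have E2 : (- g1 + g2) / 2 - g2 = - (1 / 2) by lra.
  by apply: (@dips_arc _ _ _ _ g2 eps); rewrite ?E1 ?E2 ?subrr ?normr0 ?normrN1 ?peven ?pg1 ?pg0 ?pghalf ?HE//; lra.
have E1 : - g2 - - g2 = 0 by lra.
have E2 : g1 - - g2 = 1 by lra.
have E3 : (- g2 + g1) / 2 - - g2 = 1 / 2 by lra.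
by apply: (@dips_arc _ _ _ _ (- g2) eps); rewrite ?E1 ?E2 ?E3 ?normr0 ?normr1 ?peven ?pg1 ?pg0 ?pghalf ?HE//; lra.
Qed.

Lemma skew_below :
  (forall x y, (wpt (- g1) H).1 <= x <= (wpt g2 0).1 ->
    spindle D (wpt (- g1) H) (wpt g2 0) (x, y) -> warc g2 (eps - 2 * (eps / 100)) x <= y) /\
  (forall x y, (wpt (- g2) 0).1 <= x <= (wpt g1 H).1 ->
    spindle D (wpt (- g2) 0) (wpt g1 H) (x, y) -> warc (- g2) (eps - 2 * (eps / 100)) x <= y).
Proof.
have h0 := e0; have h1 := e1; have HE : H = 1 / 2 + eps by [].
have g12 : g1 + g2 = 1 by rewrite /g1 /g2; field.
have peven (z : R) : polymodel eps (- z) = polymodel eps z.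
  by rewrite /polymodel sqrrN.
have pg1 : polymodel eps 1 = 1 / 2 by rewrite /polymodel; field.
have pg0 : polymodel eps 0 = - eps by rewrite /polymodel; field.
split.
  have E1 : - g1 - g2 = - 1 by lra.
  by apply: warc_below; rewrite ?E1 ?subrr ?normr0 ?normrN1 ?peven ?pg1 ?pg0 ?HE//; lra.
have E1 : - g2 - - g2 = 0 by lra.
have E2 : g1 - - g2 = 1 by lra.
by apply: warc_below; rewrite ?E1 ?E2 ?normr0 ?normr1 ?peven ?pg1 ?pg0 ?HE//; lra.
Qed.

Lemma window_not_quadrangle : ~ quadrangle_property D.
Proof.
have h0 := e0; have h1 := e1; have h7 := Z7; have hs := Z_sq Z7.
have hd := d0; have hk := k0.
have g10 : 0 < g1 by rewrite /g1; lra.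
have g20 : 0 < g2 by rewrite /g2; lra.
have g21 : g2 < g1 by rewrite /g1 /g2; lra.
have g11 : g1 <= 1 by rewrite /g1; lra.
have g12 : g1 + g2 = 1 by rewrite /g1 /g2; field.
have H0 : 0 < H by rewrite /H; lra.
have H1 : H <= 1 by rewrite /H; lra.
have Zb : 49 <= Z ^+ 2 by lra.
have n1 : `|g1| <= 1 by rewrite gtr0_norm.
have n2 : `|g2| <= 1 by rewrite gtr0_norm//; lra.
have peven (z : R) : polymodel eps (- z) = polymodel eps z.
  by rewrite /polymodel sqrrN.
have pg0 : polymodel eps 0 = - eps by rewrite /polymodel; field.
have [[coK _ _] _] := whull_C_convex.
have [B0 KB0] := (bounded_planeP whull).1 (compact_plane_bounded coK).
(* [B0] serves the points of the hull, [k - b.2] the arcs, which stay above [b.2 - k]. *)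
pose B := Num.max B0 (k - b.2).
have BB0 : B0 <= B by rewrite le_max lexx.
have Bk : k - b.2 <= B by rewrite le_max lexx orbT.
have KB p : whull p -> - B <= p.2.
  by move=> /KB0[_]; rewrite ler_norml => /andP[? _]; lra.
clearbody B.
have plow (z : R) : `|z| <= 1 -> z ^+ 2 / 2 - eps <= polymodel eps z.
  move=> z1; have /andP[c0 c1] := cubic_bump_itv z; rewrite -model_in// /model.
  have : eps * cubic_bump z <= eps * 1 by rewrite ler_wpM2l// ltW.
  by lra.
have lB (a x : R) : `|(x - b.1) / d - a| <= 1 -> - B <= warc a (eps - 2 * (eps / 100)) x.
  move=> xa; rewrite /warc; move: ((x - b.1) / d - a) xa => z z1.
  have : - eps <= polymodel eps z.
    have /andP[c0 c1] := cubic_bump_itv z.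
    rewrite -model_in// /model; have := sqr_ge0 z.
    have : eps * cubic_bump z <= eps * 1 by rewrite ler_wpM2l// ltW.
    by lra.
  move=> pz; have : 0 <= k * (polymodel eps z + eps) by rewrite mulr_ge0 ?(ltW hk)//; lra.
  have : 0 <= k * (1 - 2 * (eps / 100)) by rewrite mulr_ge0 ?(ltW hk)//; lra.
  by lra.
have sE : eps / 2 <= 1 / 20 by lra.
have rat (s1 s2 P Q : R) : P < 4 * Z ^+ 2 -> Q < 4 * Z ^+ 2 ->
    s1 * (4 * Z ^+ 2 - Q) < s2 * (4 * Z ^+ 2 - P) ->
    ((wpt s1 P).1 - b.1) / (b.2 + k * (4 * Z ^+ 2) - (wpt s1 P).2) <
    ((wpt s2 Q).1 - b.1) / (b.2 + k * (4 * Z ^+ 2) - (wpt s2 Q).2).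
  move=> P1 Q1 lt_; rewrite /wpt /=.
  have E1 (t : R) : b.1 + d * t - b.1 = d * t by ring.
  have E2 (t : R) : b.2 + k * (4 * Z ^+ 2) - (b.2 + k * t) = k * (4 * Z ^+ 2 - t) by ring.
  rewrite !E1 !E2 ltr_pdivrMr ?mulr_gt0 ?subr_gt0// mulrAC ltr_pdivlMr ?mulr_gt0 ?subr_gt0//.
  by rewrite mulrACA [ltRHS]mulrACA ltr_pM2l ?mulr_gt0.
apply: (@not_quadrangle R D whull (wpt (- g1) H) (wpt (- g2) 0) (wpt g2 0) (wpt g1 H)
  (b.1, b.2 + k * (4 * Z ^+ 2)) (d * 2) (k * (2 * Z ^+ 2))
  (b.2 + k * (- 2 * Z - 2)) (b.2 + k * H) B
  (warc 0 (H - polymodel eps g1 + 2 * (eps / 100)))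
  (warc 0 (0 - polymodel eps g2 + 2 * (eps / 100)))
  (warc g2 (eps - 2 * (eps / 100))) (warc (- g2) (eps - 2 * (eps / 100)))) => //=.
- exact: whull_C_convex.
- exact: whull_low1.
- exact: whull_low2.
- exact: whull_low3.
- exact: whull_low4.
- by rewrite ltrD2l ltr_pM2l// ltrN2.
- by rewrite ltrD2l ltr_pM2l//; lra.
- by rewrite ltrD2l ltr_pM2l.
- by move=> x y h2 h3 i _; exact: whull_rect.
- by rewrite mulr_gt0.
- by rewrite !mulr_gt0//; lra.
- have -> : b.1 + d * g1 - (b.1 + d * (- g1)) = d * (2 * g1) by ring.
  by rewrite [ltRHS]mulrCA ltr_pM2l//; lra.
- have -> : b.2 + k * H - (b.2 + k * (- 2 * Z - 2)) = k * (H + 2 * Z + 2) by ring.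
  by rewrite [ltRHS]mulrCA ltr_pM2l//; lra.
- move=> x y /in_strip[z -> /andP[z1 z2]]; have [w yE] := wptP z y; rewrite yE => Kz.
  have /= -> := congr1 snd yE; rewrite le_wpt.
  have z3 : `|z| <= 1 by rewrite ler_norml; apply/andP; split; lra.
  (* For a lower bound of the hull on the whole strip, the single translate through x_2 is
     enough. *)
  have zN : `|z - (Z - 2 - g2)| <= 4 * Z.
    by rewrite ler_norml; apply/andP; split; lra.
  have := wtr_low zN (Kz (false, true) Logic.I).
  have [_ _ /andP[r1 r2]] := @wshift_itv (Z - 2) (or_intror erefl).
  have /andP[r3 _] := window_itv zN.
  have := strip_low h0 h1 h7 z3.
  have -> : z - (Z - 2 - g2) = z + (1 / 2 - eps / 2) - (Z - 2) by rewrite /g2; ring.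
  rewrite (_ : z - (Z - 2 - g2) = z + (1 / 2 - eps / 2) - (Z - 2)) in r3; last by rewrite /g2; ring.
  lra.
- by rewrite ltrD2l ltr_pM2l//; lra.
- by rewrite ltrD2l ltr_pM2l//; lra.
- by rewrite ltrD2l ltr_pM2l//; lra.
- by rewrite ltrD2l ltr_pM2l//; lra.
- apply: (rat (- g1) (- g2) H 0); [lra|lra|].
  have : 0 < (g1 - g2) * Z ^+ 2 by rewrite mulr_gt0 ?subr_gt0//; lra.
  have : 0 < g2 * H by rewrite mulr_gt0.
  lra.
- apply: (rat (- g2) g2 0 0); [lra|lra|].
  have : 0 < g2 * Z ^+ 2 by rewrite mulr_gt0 ?subr_gt0//; lra.
  lra.
- apply: (rat g2 g1 0 H); [lra|lra|].
  have : 0 < (g1 - g2) * Z ^+ 2 by rewrite mulr_gt0 ?subr_gt0//; lra.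
  have : 0 < g2 * H by rewrite mulr_gt0.
  lra.
- apply: (@dips_arc _ _ _ _ 0 (H - polymodel eps g1)); rewrite ?subr0 ?normrN ?peven//.
    lra.
  rewrite addNr mul0r pg0.
  have := plow _ n1; have : (1 / 2) ^+ 2 <= g1 ^+ 2 by rewrite ler_sqr ?nnegrE /g1; lra.
  lra.
- apply: (@dips_arc _ _ _ _ 0 (0 - polymodel eps g2)); rewrite ?subr0 ?normrN ?peven//.
    lra.
  rewrite addNr mul0r pg0.
  have := plow _ n2; have : (2 / 5) ^+ 2 <= g2 ^+ 2 by rewrite ler_sqr ?nnegrE /g2; lra.
  lra.
- exact: skew_dips.1.
- exact: skew_dips.2.
- exact: warc_continuous.
- exact: warc_continuous.
- exact: warc_continuous.
- exact: warc_continuous.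
- apply: (@warc_above (- g1) g1 H H 0); rewrite ?subr0 ?normrN ?peven//; lra.
- apply: (@warc_above (- g2) g2 0 0 0); rewrite ?subr0 ?normrN ?peven//; lra.
- exact: skew_below.1.
- exact: skew_below.2.
- move=> x /in_strip[z -> /andP[z1 z2]]; apply: lB.
  rewrite (_ : (b.1 + d * z - b.1) / d = z); last by field; rewrite lt0r_neq0.
  by rewrite ler_norml; apply/andP; split; lra.
- move=> x /in_strip[z -> /andP[z1 z2]]; apply: lB.
  rewrite (_ : (b.1 + d * z - b.1) / d = z); last by field; rewrite lt0r_neq0.
  by rewrite ler_norml; apply/andP; split; lra.
- exact: window_gap.
Qed.


End window.

(** * Hausdorff measure and the perimeter distance *)

Section hausdorff.
Context {R : realType}.
Implicit Types (p q u v : R * R) (A B U : set (R * R)).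

Lemma dist_ge0 p q : 0 <= dist p q.
Proof. exact: sqrtr_ge0. Qed.

Lemma dot_ge0 u : 0 <= dot u u.
Proof. by rewrite /dot -!expr2 addr_ge0// sqr_ge0. Qed.

Lemma dist_sqr p q : dist p q ^+ 2 = (p.1 - q.1) ^+ 2 + (p.2 - q.2) ^+ 2.
Proof. by rewrite sqr_sqrtr ?dot_ge0// /dot -!expr2. Qed.

Lemma dist_le p q (c : R) : 0 <= c ->
  (dist p q <= c) = ((p.1 - q.1) ^+ 2 + (p.2 - q.2) ^+ 2 <= c ^+ 2).
Proof. by move=> c0; rewrite -dist_sqr ler_sqr// nnegrE dist_ge0. Qed.

Lemma dist_fst p q : `|p.1 - q.1| <= dist p q.
Proof.
rewrite -ler_sqr ?nnegrE ?dist_ge0// dist_sqr real_normK ?num_real//.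
by rewrite lerDl sqr_ge0.
Qed.

Lemma dist_snd p q : `|p.2 - q.2| <= dist p q.
Proof.
rewrite -ler_sqr ?nnegrE ?dist_ge0// dist_sqr real_normK ?num_real//.
by rewrite lerDr sqr_ge0.
Qed.

Lemma diam_ge0 U : (0 <= diam U)%E.
Proof. by apply: ereal_sup_ubound; left. Qed.

Lemma dist_diam U p q : U p -> U q -> ((dist p q)%:E <= diam U)%E.
Proof. by move=> Up Uq; apply: ereal_sup_ubound; right; exists (p, q). Qed.

Lemma diam_le U (c : \bar R) : (0 <= c)%E ->
  (forall p q, U p -> U q -> ((dist p q)%:E <= c)%E) -> (diam U <= c)%E.
Proof.
move=> c0 H; apply: ge_ereal_sup => _ [->//|[[p q] /= [Up Uq] <-]].
exact: H.
Qed.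

Lemma hausdorff1_ge0 A : (0 <= hausdorff1 A)%E.
Proof.
apply: (@le_trans _ _ (hausdorff1_pre 1 A)).
  apply: le_ereal_inf_tmp => _ [U _ <-].
  by apply: nneseries_ge0 => i _ _; exact: diam_ge0.
by apply: ereal_sup_ubound; exists 1; rewrite /= ?ltr01.
Qed.

(** Only covers by small sets count, so the Lipschitz bound is needed at distances up to [r] only. A
    relation takes the place of a map because it will pair boundary points of two disks that share a
    normal. *)
Lemma hausdorff1_lipschitz (rel : R * R -> R * R -> Prop) A A' (L r : R) :
  0 < L -> 0 < r -> (forall a', A' a' -> exists2 a, A a & rel a a') ->
  (forall a b a' b', A a -> A b -> rel a a' -> rel b b' -> dist a b <= r ->
     dist a' b' <= L * dist a b) ->
  (hausdorff1 A' <= L%:E * hausdorff1 A)%E.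
Proof.
move=> L0 r0 A'A lip; apply: ge_ereal_sup => _ [e /= e0 <-].
pose d := Num.min r (e / L).
have d0 : 0 < d by rewrite lt_min r0 divr_gt0.
apply: (@le_trans _ _ (L%:E * hausdorff1_pre d A)%E); last first.
  by rewrite lee_pmul2l// ereal_sup_ubound//; exists d.
rewrite muleC -lee_pdivrMr//.
apply: le_ereal_inf_tmp => _ [U [cov Ud] <-].
rewrite lee_pdivrMr// muleC.
pose U' i := [set a' | A' a' /\ exists a, [/\ U i a, A a & rel a a']].
have U'L i : (diam (U' i) <= L%:E * diam (U i))%E.
  apply: diam_le.
    by rewrite mule_ge0 ?diam_ge0// lee_fin ltW.
  move=> a' b' [_ [a [Ua Aa raa']]] [_ [b [Ub Ab rbb']]].
  have ab := dist_diam Ua Ub.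
  have abr : dist a b <= r.
    have := le_trans ab (Ud i); rewrite lee_fin => /le_trans; apply.
    by rewrite ge_min lexx.
  apply: (@le_trans _ _ (L * dist a b)%:E).
    by rewrite lee_fin; exact: lip abr.
  by rewrite EFinM lee_pmul2l.
apply: (@le_trans _ _ (\sum_(0 <= i <oo) diam (U' i))%E).
  apply: ereal_inf_lbound; exists U' => //; split.
    move=> a' A'a'; have [a Aa raa'] := A'A _ A'a'.
    have [i _ Ua] := cov _ Aa.
    by exists i => //; split => //; exists a.
  move=> i; apply: (le_trans (U'L i)).
  apply: (@le_trans _ _ (L%:E * d%:E)%E); first by rewrite lee_pmul2l.
  rewrite -EFinM lee_fin mulrC -ler_pdivlMr// ge_min lexx orbT//.
rewrite -nneseriesZl//; last by move=> i _; exact: diam_ge0.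
by apply: lee_nneseries => [i _ _|i _]; [exact: diam_ge0|exact: U'L].
Qed.

Lemma le_hausdorff1 A B : A `<=` B -> (hausdorff1 A <= hausdorff1 B)%E.
Proof.
move=> AB; rewrite -[leRHS]mul1e.
apply: (@hausdorff1_lipschitz (fun a b => a = b) B A 1 1) => //.
  by move=> a Aa; exists a => //; exact: AB.
by move=> a b a' b' _ _ -> ->; rewrite mul1r.
Qed.

Lemma hausdorff1_segment (a b : R) : a <= b ->
  (hausdorff1 [set ((x, 0) : R * R)%R | x in (`[a, b] : set R)] <= (b - a)%:E)%E.
Proof.
move=> ab; apply: ge_ereal_sup => _ [e /= e0 <-].
have [n ne] : exists n : nat, (b - a) / n.+1%:R <= e.
  have [n hn] : exists n : nat, (b - a) / e < n%:R.
    by exists (Num.bound ((b - a) / e)); apply: archi_boundP; rewrite divr_ge0 ?(ltW e0)// subr_ge0.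
  exists n; rewrite ler_pdivrMr// mulrC -ler_pdivrMr//.
  by rewrite (le_trans (ltW hn))// ler_nat.
pose c := (b - a) / n.+1%:R.
have c0 : 0 <= c by rewrite divr_ge0// subr_ge0.
pose U (i : nat) : set (R * R) := if (i < n.+1)%N then
  [set p | a + i%:R * c <= p.1 <= a + i.+1%:R * c /\ p.2 = 0] else set0.
have dU i : (diam (U i) <= (if (i < n.+1)%N then c else 0)%:E)%E.
  rewrite /U; case: ifP => _; last by apply: diam_le.
  apply: diam_le; first by rewrite lee_fin.
  move=> p q [/andP[p1 p2] p0] [/andP[q1 q2] q0].
  rewrite lee_fin dist_le// p0 q0 subrr expr0n addr0 -[leLHS]real_normK ?num_real//.
  rewrite ler_sqr ?nnegrE// ler_norml.
  have E : i.+1%:R * c = i%:R * c + c by rewrite -natr1 mulrDl mul1r.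
  by rewrite E in p2 q2; move: (i%:R * c) p1 p2 q1 q2 => t ? ? ? ?; apply/andP; split; lra.
apply: (@le_trans _ _ (\sum_(0 <= i <oo) diam (U i))%E).
  apply: ereal_inf_lbound; exists U => //; split; last first.
    by move=> i; apply: (le_trans (dU i)); rewrite lee_fin; case: ifP => _ //; exact: ltW.
  move=> _ [x /= + <-]; rewrite in_itv/= => /andP[ax xb].
  have find : forall m : nat, x <= a + m.+1%:R * c -> exists2 i, (i < m.+1)%N &
      a + i%:R * c <= x <= a + i.+1%:R * c.
    elim=> [|m IH] xm; first by exists 0%N; rewrite // mul0r addr0 ax.
    have [/IH[i im h]|h] := leP x (a + m.+1%:R * c).
      by exists i => //; exact: ltnW.
    by exists m.+1 => //; rewrite (ltW h).
  have [|i im h] := find n.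
    by rewrite /c mulrC divfK// addrC subrK.
  by exists i => //; rewrite /U im.
apply: lime_le.
  by apply: is_cvg_nneseries => i _ _; exact: diam_ge0.
apply: nearW => m.
apply: (@le_trans _ _ (\sum_(0 <= i < m) (if (i < n.+1)%N then c else 0)%:E)%E).
  by apply: lee_sum => i _; exact: dU.
rewrite sumEFin lee_fin.
have : \sum_(0 <= i < m) (if (i < n.+1)%N then c else 0) <= n.+1%:R * c.
  have -> : \sum_(0 <= i < m) (if (i < n.+1)%N then c else 0) = (minn m n.+1)%:R * c.
    elim: m => [|m IH]; first by rewrite big_geq// min0n mul0r.
    rewrite big_nat_recr//= IH; case: ltnP => mn.
      by rewrite (minn_idPl mn) -natr1 mulrDl mul1r.
    by rewrite (minn_idPr (leqW mn)) addr0.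
  by rewrite ler_wpM2r// ler_nat geq_minr.
by rewrite {2}/c mulrC divfK.
Qed.

(* Countably many sets whose shadows cover an interval have total diameter at
   least its length. *)
Lemma hausdorff1_ge A (a b : R) : a <= b ->
  (forall x, a < x < b -> exists y, A (x, y)) -> ((b - a)%:E <= hausdorff1 A)%E.
Proof.
move=> ab HA; apply: (@le_trans _ _ (hausdorff1_pre 1 A)); last first.
  by apply: ereal_sup_ubound; exists 1; rewrite /= ?ltr01.
apply: le_ereal_inf_tmp => _ [U [cov Ud] <-].
pose I i : set R := if `[< U i !=set0 >] then
  [set` `[inf (fst @` U i), sup (fst @` U i)]] else set0.
have UI i p : U i p -> I i p.1 /\ (lebesgue_measure (I i) <= diam (U i))%E.
  move=> Up; have fin : diam (U i) \is a fin_num.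
    by rewrite ge0_fin_numE ?diam_ge0// (le_lt_trans (Ud i))// ltry.
  have dle q r : U i q -> U i r -> q.1 <= r.1 + fine (diam (U i)).
    move=> Uq Ur; have := dist_diam Uq Ur; rewrite -(fineK fin) lee_fin.
    by have := dist_fst q r; rewrite ler_norml => /andP[_]; lra.
  have hs : has_sup (fst @` U i).
    split; first by exists p.1, p.
    by exists (p.1 + fine (diam (U i))) => _ [q Uq <-]; exact: dle.
  have hi : has_inf (fst @` U i).
    split; first by exists p.1, p.
    exists (p.1 - fine (diam (U i))) => _ [q Uq <-].
    by rewrite lerBlDr; exact: dle.
  have Ip : inf (fst @` U i) <= p.1 <= sup (fst @` U i).
    by apply/andP; split; [apply: (ge_inf hi.2)|apply: (ub_le_sup hs.2)]; exists p.
  have Ui0 : U i !=set0 by exists p.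
  rewrite /I; case: asboolP => // _; split; first by rewrite /= in_itv.
  rewrite lebesgue_measure_itv/=; case: ifP => _; last exact: diam_ge0.
  rewrite -(fineK fin) -EFinB lee_fin lerBlDr.
  apply: ge_sup; first by exists p.1, p.
  move=> _ [q Uq <-]; rewrite -lerBlDl.
  apply: lb_le_inf; first by exists p.1, p.
  by move=> _ [r Ur <-]; rewrite lerBlDl addrC; exact: dle.
have mI i : measurable (I i).
  by rewrite /I; case: ifP => _; [exact: measurable_itv|exact: measurable0].
have covI : `]a, b[ `<=` \bigcup_i I i.
  move=> x; rewrite /= in_itv/= => /HA[y /cov[i _ Ui]].
  by exists i => //; exact: (UI i _ Ui).1.
apply: (@le_trans _ _ (lebesgue_measure (`]a, b[ : set R))).
  rewrite lebesgue_measure_itv/= lte_fin; case: ltP => // ba.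
  by rewrite lee_fin subr_le0.
apply: (@le_trans _ _ (\sum_(0 <= i <oo) lebesgue_measure (I i))%E).
  by apply: measure_sigma_subadditive => //; exact: measurable_itv.
apply: lee_nneseries => [i _ _|i _]; first exact: measure_ge0.
have [[p Up]|U0] := pselect (U i !=set0); first exact: (UI i p Up).2.
by rewrite /I; case: asboolP => // _; rewrite measure0 diam_ge0.
Qed.

End hausdorff.

(** * The perimeter distance and its topology *)

Section perimeter_distance.
Context {R : realType}.
Implicit Types (C D E : set (R * R)) (sigma : set (R * R)).

Definition pm_close (t : R) C D := forall sigma, measurable sigma ->
  sigma `<=` unit_circle ->
  (`| surface_area_measure C sigma - surface_area_measure D sigma |
     <= t%:E * hausdorff1 sigma)%E.

Lemma pm_distance_lt C D (e : R) : (pm_distance C D < e%:E)%E <->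
  exists2 t, 0 <= t < e & pm_close t C D.
Proof.
split.
  move=> /ereal_inf_lt[_ [t [t0 Ht] <-]]; rewrite lte_fin => te.
  by exists t; rewrite ?t0.
move=> [t /andP[t0 te] Ht]; apply: (@le_lt_trans _ _ t%:E); last by rewrite lte_fin.
by apply: ereal_inf_lbound; exists t.
Qed.

Lemma abse_sub_trans (a b c x y : \bar R) : (0 <= x)%E -> (0 <= y)%E ->
  (`|a - b| <= x)%E -> (`|b - c| <= y)%E -> (`|a - c| <= x + y)%E.
Proof.
move: x y => [x| |] [y| |] // _ _; rewrite ?addey ?addye ?leey//.
move: a b c => [a| |] [b| |] [c| |] //=; rewrite -?EFinB -?EFinD ?lee_fin//=.
by move=> h1 h2; rewrite (le_trans (ler_distD b a c))// lerD.
Qed.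

Lemma pm_close_trans (s t : R) C D E : 0 <= s -> 0 <= t ->
  pm_close s C D -> pm_close t D E -> pm_close (s + t) C E.
Proof.
move=> s0 t0 CD DE sigma ms ss.
rewrite EFinD ge0_muleDl ?lee_fin//.
by apply: abse_sub_trans (CD _ ms ss) (DE _ ms ss);
  rewrite mule_ge0 ?lee_fin// hausdorff1_ge0.
Qed.

(** Finiteness matters: [+oo - +oo] is [-oo] in [\bar R], so an infinite measure would be at
    infinite distance from itself. *)
Lemma pm_close_refl (t : R) C : 0 <= t ->
  (forall sigma, surface_area_measure C sigma \is a fin_num) -> pm_close t C C.
Proof.
move=> t0 fC sigma _ _; rewrite subee// abse0 mule_ge0 ?lee_fin//.
exact: hausdorff1_ge0.
Qed.

Lemma pm_ball_nbhs (B : set (sym_disk R)) (C : sym_disk R) : @pm_balls R B -> B C ->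
  exists2 t : R, 0 < t & forall D : sym_disk R, (pm_distance C D < t%:E)%E -> B D.
Proof.
move=> [C0 [e [e0 ->]]] /pm_distance_lt[t /andP[t0 te] ct].
exists (e - t); first by rewrite subr_gt0.
move=> D /pm_distance_lt[s /andP[s0 se] cs].
apply/pm_distance_lt; exists (t + s); last exact: pm_close_trans ct cs.
by rewrite addr_ge0//=; move: se; lra.
Qed.

(** Around [C] an open set contains a finite intersection of balls with other centres; the triangle
    inequality recentres each of them at [C], by induction on the intersection. *)
Lemma open_sym_disk_pm (U : set (sym_disk R)) (C : sym_disk R) : open U -> U C ->
  exists2 t : R, 0 < t & forall D : sym_disk R,
    (pm_distance C D < t%:E)%E -> U D.
Proof.
move=> [D' sD' <-] [A D'A AC].
have [F sF AE] := sD' _ D'A.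
move: AC; rewrite -AE => AC.
have : exists2 t : R, 0 < t & forall D : sym_disk R,
    (pm_distance C D < t%:E)%E -> (\bigcap_(i in [set i | i \in finmap.enum_fset F]) i) D.
  move: AC sF; rewrite /mkset/= => {AE}.
  rewrite /bigcap /isBaseTopological.b /= /mkset.
  change ((forall i, i \in finmap.enum_fset F -> i C) ->
    {subset finmap.enum_fset F <= @pm_balls R} -> exists2 t : R, 0 < t &
    forall D : sym_disk R, (pm_distance C D < t%:E)%E ->
    forall i, i \in finmap.enum_fset F -> i D).
  elim: (finmap.enum_fset F) => [|B s IH] sC sb; first by exists 1.
  have [] := IH; first by move=> i si; apply: sC; rewrite inE si orbT.
    by move=> i si; apply: sb; rewrite inE si orbT.
  move=> t t0 Ht.
  have [||u u0 Hu] := @pm_ball_nbhs B C.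
  - by apply/set_mem/sb; rewrite mem_head.
  - by apply: sC; rewrite mem_head.
  exists (Num.min t u); first by rewrite lt_min t0.
  move=> D dD i; rewrite inE => /predU1P[->|si].
    by apply: Hu; apply: lt_le_trans dD _; rewrite lee_fin ge_min lexx orbT.
  by apply: Ht si; apply: lt_le_trans dD _; rewrite lee_fin ge_min lexx.
move=> [t t0 Ht]; exists t => // D dD; exists A => //.
by rewrite -AE; exact: Ht.
Qed.

End perimeter_distance.

(** * Closed curves of positive curvature *)

Section calculus.
Context {R : realType}.
Implicit Types (f df : R -> R) (a b t d : R).

Lemma is_derive_le f df a b : a <= b -> (forall t, a <= t <= b -> is_derive t (1 : R) f (df t)) ->
  (forall t, a <= t <= b -> 0 <= df t) -> f a <= f b.
Proof.
move=> ab fd d0; have ins t : t \in `]a, b[ -> a <= t <= b.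
  by rewrite in_itv/= => /andP[/ltW-> /ltW->].
have [| |c cab] := @MVT_segment R f df a b ab.
- by move=> t /ins/fd.
- apply: continuous_in_subspaceT => t; rewrite inE/= in_itv/= => /fd ft.
  by apply/differentiable_continuous/derivable1_diffP; case: ft.
move=> E; rewrite -subr_ge0 E mulr_ge0 ?subr_ge0//.
by apply: d0; move: cab; rewrite in_itv.
Qed.

Lemma is_derive_lt f df a b : a < b -> (forall t, a <= t <= b -> is_derive t (1 : R) f (df t)) ->
  (forall t, a < t < b -> 0 < df t) -> f a < f b.
Proof.
move=> ab fd d0; have ins t : t \in `]a, b[ -> a <= t <= b.
  by rewrite in_itv/= => /andP[/ltW-> /ltW->].
have [| |c cab] := @MVT R f df a b ab.
- by move=> t /ins/fd.
- apply: continuous_in_subspaceT => t; rewrite inE/= in_itv/= => /fd ft.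
  by apply/differentiable_continuous/derivable1_diffP; case: ft.
move=> E; rewrite -subr_gt0 E mulr_gt0 ?subr_gt0//.
by apply: d0; move: cab; rewrite in_itv.
Qed.

Lemma is_derive_max f t d : (forall s, derivable f s 1) -> is_derive t (1 : R) f d ->
  (forall s, f s <= f t) -> d = 0.
Proof.
move=> df ft tmax.
have h : is_derive t (1 : R) f 0.
  apply: (@derive1_at_max R f (t - 1) (t + 1)) => //; first by lra.
  by rewrite in_itv/=; apply/andP; split; lra.
by rewrite -(@derive_val _ _ _ _ _ _ _ ft) (@derive_val _ _ _ _ _ _ _ h).
Qed.

Lemma derive_gt0_near f t d : is_derive t (1 : R) f d -> 0 < d ->
  exists2 r : R, 0 < r & forall h : R, 0 < h < r ->
    f t < f (t + h) /\ f (t - h) < f t.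
Proof.
move=> [fd fv] d0.
have : (fun h => h^-1 *: (f (h *: 1 + t) - f t)) @ (0 : R)^' --> d.
  by rewrite -fv; exact: fd.
move=> /cvgrPdist_lt /(_ _ d0); rewrite near_withinE => -[r /= r0 Hr].
exists r => // h /andP[h0 hr]; split.
  have := Hr h; rewrite /= sub0r normrN gtr0_norm// => /(_ hr (lt0r_neq0 h0)).
  rewrite -![_ *: _]/(_ * _) mulr1 ltr_norml => /andP[_].
  rewrite ltrBlDr -ltrBlDl subrr pmulr_rgt0 ?invr_gt0// subr_gt0 [h + t]addrC//.
have := Hr (- h); rewrite /= sub0r opprK gtr0_norm// oppr_eq0 => /(_ hr (lt0r_neq0 h0)).
rewrite -![_ *: _]/(_ * _) mulr1 ltr_norml => /andP[_].
rewrite ltrBlDr -ltrBlDl subrr invrN mulNr -mulrN opprB pmulr_rgt0 ?invr_gt0//.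
by rewrite subr_gt0 [- h + t]addrC.
Qed.

End calculus.

(** * Supporting lines of a curve of positive curvature *)

Section support.
Context {R : realType}.
Variables (K : set (R * R)) (x y x1 y1 x2 y2 : R -> R).
Hypothesis dx : forall t, is_derive t (1 : R) x (x1 t).
Hypothesis dy : forall t, is_derive t (1 : R) y (y1 t).
Hypothesis dx1 : forall t, is_derive t (1 : R) x1 (x2 t).
Hypothesis dy1 : forall t, is_derive t (1 : R) y1 (y2 t).
Hypothesis curv : forall t, 0 < x1 t * y2 t - y1 t * x2 t.

(* The scalar product of [q - (x t, y t)] with the outer normal [(y' t, - x' t)]. *)
Definition ahead (q : R * R) (t : R) : R := y1 t * (q.1 - x t) - x1 t * (q.2 - y t).

Lemma is_derive_ahead q t : is_derive t (1 : R) (ahead q)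
  (y2 t * (q.1 - x t) - x2 t * (q.2 - y t)).
Proof.
apply: (@is_derive_eq _ _ _ _ _ _ _ _ _); rewrite -![_ *: _]/(_ * _).
by rewrite /cst/=; ring.
Qed.

(** The function [ahead q] attains its maximum [0] at [t], so its derivative vanishes there as well.
    These are two linear equations for [q - (x t, y t)], and their determinant is, up to sign, the
    numerator of the curvature. *)
Lemma touch q t : (forall s, ahead q s <= 0) -> ahead q t = 0 -> q = (x t, y t).
Proof.
move=> le0 at0.
have E : y2 t * (q.1 - x t) - x2 t * (q.2 - y t) = 0.
  apply: is_derive_max (is_derive_ahead q t) _; last by move=> s; rewrite at0.
  by move=> s; case: (is_derive_ahead q s).
have c := curv t; move: at0; rewrite /ahead => at0.
have a0 : (x1 t * y2 t - y1 t * x2 t) * (q.1 - x t) = 0.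
  have -> : (x1 t * y2 t - y1 t * x2 t) * (q.1 - x t) =
    x1 t * (y2 t * (q.1 - x t) - x2 t * (q.2 - y t)) - x2 t * (y1 t * (q.1 - x t) - x1 t * (q.2 - y t)) by ring.
  by rewrite E at0 !mulr0 subrr.
have b0 : (x1 t * y2 t - y1 t * x2 t) * (q.2 - y t) = 0.
  have -> : (x1 t * y2 t - y1 t * x2 t) * (q.2 - y t) =
    y1 t * (y2 t * (q.1 - x t) - x2 t * (q.2 - y t)) - y2 t * (y1 t * (q.1 - x t) - x1 t * (q.2 - y t)) by ring.
  by rewrite E at0 !mulr0 subrr.
move: a0 b0 => /eqP; rewrite mulf_eq0 (gt_eqF c)/= subr_eq0 => /eqP h1.
move=> /eqP; rewrite mulf_eq0 (gt_eqF c)/= subr_eq0 => /eqP h2.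
by rewrite -h1 -h2; case: (q).
Qed.

Hypothesis cK : cvx K.
Hypothesis Kc : compact K.

(** The three brackets stay positive near [p], and nonnegative brackets are barycentric coordinates
    up to normalisation. *)
Lemma triangle_interior (p a b c : R * R) : K a -> K b -> K c ->
  0 < cross (a - p) (b - p) -> 0 < cross (b - p) (c - p) -> 0 < cross (c - p) (a - p) ->
  K° p.
Proof.
move=> Ka Kb Kc' h1 h2 h3.
pose S := cross (a - p) (b - p) + cross (b - p) (c - p) + cross (c - p) (a - p).
have S0 : 0 < S by apply: addr_gt0 h3; exact: addr_gt0 h1 h2.
have inK z : 0 <= cross (a - z) (b - z) -> 0 <= cross (b - z) (c - z) ->
    0 <= cross (c - z) (a - z) -> K z.
  move=> k1 k2 k3.
  have E : S = cross (a - z) (b - z) + cross (b - z) (c - z) + cross (c - z) (a - z).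
    by rewrite /S /cross/=; ring.
  have [e|ne] := eqVneq (cross (a - z) (b - z) + cross (b - z) (c - z)) 0.
    have e1 : cross (b - z) (c - z) = 0 by move: k1 k2; lra.
    have e2 : cross (a - z) (b - z) = 0 by move: k1 k2; lra.
    have S3 : S = cross (c - z) (a - z) by rewrite E; lra.
    suff -> : z = b by [].
    apply: pair_ext; apply/eqP; rewrite -subr_eq0 -(mulrI_eq0 _ (mulfI (lt0r_neq0 S0))); apply/eqP.
      transitivity (cross (a - z) (b - z) * (c.1 - b.1) + cross (b - z) (c - z) * (a.1 - b.1)).
        by rewrite E /cross/=; ring.
      by rewrite e1 e2; ring.
    transitivity (cross (a - z) (b - z) * (c.2 - b.2) + cross (b - z) (c - z) * (a.2 - b.2)).
      by rewrite E /cross/=; ring.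
    by rewrite e1 e2; ring.
  set u := cross (a - z) (b - z) in k1 ne E *; set v := cross (b - z) (c - z) in k2 ne E *.
  have uv : 0 < u + v by rewrite lt_def ne addr_ge0.
  set w := cross (c - z) (a - z) in k3 E *.
  have Kac : K ((1 - u / (u + v)) * a.1 + u / (u + v) * c.1,
                (1 - u / (u + v)) * a.2 + u / (u + v) * c.2).
    apply: cK => //; rewrite divr_ge0 ?(ltW uv)//= ler_pdivrMr// mul1r lerDl//.
  apply: (cvx_comb cK Kac Kb (t := w / S)).
  - by rewrite divr_ge0// ltW.
  - by rewrite ler_pdivrMr// mul1r E; lra.
  - rewrite /=; have S0' := lt0r_neq0 S0; have uv' := lt0r_neq0 uv.
    have wE : w = S - (u + v) by rewrite E; ring.
    have key : S * z.1 = v * a.1 + w * b.1 + u * c.1 by rewrite E /u /v /w /cross/=; ring.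
    have -> : z.1 = (v * a.1 + w * b.1 + u * c.1) / S by rewrite -key mulrAC divff ?mul1r.
    by rewrite wE; field; rewrite S0' uv'.
  - rewrite /=; have S0' := lt0r_neq0 S0; have uv' := lt0r_neq0 uv.
    have wE : w = S - (u + v) by rewrite E; ring.
    have key : S * z.2 = v * a.2 + w * b.2 + u * c.2 by rewrite E /u /v /w /cross/=; ring.
    have -> : z.2 = (v * a.2 + w * b.2 + u * c.2) / S by rewrite -key mulrAC divff ?mul1r.
    by rewrite wE; field; rewrite S0' uv'.
have cont q r : continuous (fun z : R * R => cross (q - z) (r - z)).
  have -> : (fun z => cross (q - z) (r - z)) =
      (fun z => (q.2 - r.2) * z.1 + (r.1 - q.1) * z.2 + cross q r).
    by apply/funext => z; rewrite /cross/=; ring.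
  exact: affine_continuous.
have near q r : 0 < cross (q - p) (r - p) -> \forall z \near p, 0 < cross (q - z) (r - z).
  by move=> h; exact: (cvgr_gt _ (cont q r p) _ h).
rewrite /interior; near=> z; apply: inK; apply: ltW; near: z; exact: near.
Unshelve. all: by end_near. Qed.

Hypothesis onK : forall t, boundary K (x t, y t).

(** A point [q] of [K] strictly beyond the tangent at [t] would form, with the curve points at
    [t - h] and [t + h], a triangle that has [(x t, y t)] in its interior: [f1] puts the two
    neighbours on different sides of the line to [q], and [g], which increases away from [t] on both
    sides, puts them strictly inside the tangent. *)
Lemma ahead_le0 q t : K q -> ahead q t <= 0.
Proof.
move=> Kq; rewrite leNgt; apply/negP => q0.
have Kt s : K (x s, y s) by exact: ((boundary_closed _ (compact_plane_closed Kc)).1 (onK s)).1.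
have c := curv t.
have T0 : 0 < x1 t * x1 t + y1 t * y1 t.
  rewrite lt_def addr_ge0 -?expr2 ?sqr_ge0// andbT; apply/negP.
  rewrite !expr2 -!expr2 paddr_eq0 ?sqr_ge0// !sqrf_eq0 => /andP[/eqP e1 /eqP e2].
  by move: c; rewrite e1 e2 !mul0r subrr ltxx.
pose f1 s := cross (q - (x t, y t)) ((x s, y s) - (x t, y t)).
pose f2 s := x1 t * (x s - x t) + y1 t * (y s - y t).
pose g s := x1 t * (y s - y t) - y1 t * (x s - x t).
pose g1 s := x1 t * y1 s - y1 t * x1 s.
have d1 : is_derive t (1 : R) f1 (ahead q t).
  rewrite /f1 /cross/=; apply: is_derive_eq; rewrite -![_ *: _]/(_ * _) /ahead /cst/=; ring.
have d2 : is_derive t (1 : R) f2 (x1 t * x1 t + y1 t * y1 t).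
  by rewrite /f2; apply: is_derive_eq; rewrite -![_ *: _]/(_ * _) /cst/=; ring.
have dg s : is_derive s (1 : R) g (g1 s).
  by rewrite /g; apply: is_derive_eq; rewrite -![_ *: _]/(_ * _) /g1 /cst/=; ring.
have dg1 : is_derive t (1 : R) g1 (x1 t * y2 t - y1 t * x2 t).
  by rewrite /g1; apply: is_derive_eq; rewrite -![_ *: _]/(_ * _) /cst/=; ring.
have [r1 r10 H1] := derive_gt0_near d1 q0.
have [r2 r20 H2] := derive_gt0_near d2 T0.
have [r3 r30 H3] := derive_gt0_near dg1 c.
pose h := Num.min r1 (Num.min r2 r3) / 2.
have h0 : 0 < h by rewrite divr_gt0// !lt_min r10 r20 r30.
have hlt : h < Num.min r1 (Num.min r2 r3).
  by rewrite ltr_pdivrMr// ltr_pMr ?ltr1n// !lt_min r10 r20 r30.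
have /andP[hr1 /andP[hr2 hr3]] : (h < r1) && ((h < r2) && (h < r3)).
  by move: hlt; rewrite !lt_min.
have [A1 A2] := H1 h (introT andP (conj h0 hr1)).
have [B1 B2] := H2 h (introT andP (conj h0 hr2)).
have g1t : g1 t = 0 by rewrite /g1; ring.
have gt0 : g t = 0 by rewrite /g !subrr !mulr0 subrr.
have C1 : 0 < g (t + h).
  rewrite -gt0; apply: (@is_derive_lt _ g g1); first by lra.
  move=> s /andP[ts sh]; have [] := H3 (s - t).
    by apply/andP; split; lra.
  by rewrite g1t subrKC.
have C2 : 0 < g (t - h).
  rewrite -gt0 -ltrN2; apply: (@is_derive_lt _ (\- g) (\- g1)); first by lra.
  move=> s /andP[ts sh]; have [] := H3 (t - s).
    by apply/andP; split; lra.
  by rewrite g1t subKr /= oppr_gt0.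
have f1t : f1 t = 0 by rewrite /f1 /cross/= !subrr !mulr0 subrr.
have f2t : f2 t = 0 by rewrite /f2 !subrr !mulr0 addr0.
move: (onK t) => [_]; apply.
apply: (@triangle_interior (x t, y t) (x (t - h), y (t - h)) q (x (t + h), y (t + h))) => //.
- by move: A2; rewrite f1t /f1 /cross/=; lra.
- by move: A1; rewrite f1t.
have E : (x1 t * x1 t + y1 t * y1 t) * cross ((x (t + h), y (t + h)) - (x t, y t)) ((x (t - h), y (t - h)) - (x t, y t)) =
  f2 (t + h) * g (t - h) - f2 (t - h) * g (t + h).
  by rewrite /f2 /g /cross/=; ring.
rewrite -(pmulr_rgt0 _ T0) E.
have : 0 < f2 (t + h) * g (t - h) by rewrite mulr_gt0// -f2t.
have : 0 < - f2 (t - h) * g (t + h) by rewrite mulr_gt0// oppr_gt0 -f2t.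
by lra.
Qed.

Hypothesis intK : K° !=set0.
Hypothesis bdK : range (fun t => (x t, y t)) = boundary K.

Lemma regular t : 0 < x1 t ^+ 2 + y1 t ^+ 2.
Proof.
rewrite lt_def addr_ge0 ?sqr_ge0// andbT; apply/negP.
rewrite paddr_eq0 ?sqr_ge0// !sqrf_eq0 => /andP[/eqP e1 /eqP e2].
by have := curv t; rewrite e1 e2 !mul0r subrr ltxx.
Qed.

Lemma outer_normal_ahead t : outer_normal K (y1 t, - x1 t) (x t, y t).
Proof.
split; first exact: ((boundary_closed _ (compact_plane_closed Kc)).1 (onK t)).1.
by move=> q /(ahead_le0 t); rewrite /ahead /dot/=; lra.
Qed.

Lemma ahead_interior o t : K° o -> ahead o t < 0.
Proof.
move=> Ko; have Ko' := interior_subset Ko.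
rewrite lt_neqAle ahead_le0// andbT; apply/eqP => /touch E.
have oE : o = (x t, y t) by apply: E => s; exact: ahead_le0.
by move: (onK t) => [_]; rewrite -oE.
Qed.

(** Maximality at [t] makes [v] orthogonal to the tangent; an interior point of [K] decides the
    sign. *)
Lemma normal_unique v t : v != 0 -> outer_normal K v (x t, y t) ->
  exists2 l : R, 0 < l & v = (l * y1 t, - (l * x1 t)).
Proof.
move=> v0 [_ vmax].
have E : v.1 * x1 t + v.2 * y1 t = 0.
  pose f s := v.1 * x s + v.2 * y s.
  have df s : is_derive s (1 : R) f (v.1 * x1 s + v.2 * y1 s).
    by rewrite /f; apply: is_derive_eq; rewrite -![_ *: _]/(_ * _) /cst/=; ring.
  apply: (is_derive_max _ (df t)) => [s|s]; first by case: (df s).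
  by have := vmax _ ((boundary_closed _ (compact_plane_closed Kc)).1 (onK s)).1.
have T0 := regular t; have T0' := lt0r_neq0 T0.
pose l := (v.1 * y1 t - v.2 * x1 t) / (x1 t ^+ 2 + y1 t ^+ 2).
have lT : l * (x1 t ^+ 2 + y1 t ^+ 2) = v.1 * y1 t - v.2 * x1 t by rewrite divfK.
have v1 : v.1 = l * y1 t.
  apply: (mulIf T0'); rewrite mulrAC lT.
  by have : x1 t * (v.1 * x1 t + v.2 * y1 t) = 0; [rewrite E mulr0|lra].
have v2 : v.2 = - (l * x1 t).
  apply: (mulIf T0'); rewrite mulNr mulrAC lT.
  by have : y1 t * (v.1 * x1 t + v.2 * y1 t) = 0; [rewrite E mulr0|lra].
exists l; last by apply: pair_ext.
rewrite lt_neqAle; apply/andP; split.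
  apply/eqP => l0; move/eqP: v0; apply.
  by apply: pair_ext; rewrite ?v1 ?v2 -l0 !mul0r ?oppr0.
have [z Ko] := intK; have := ahead_interior t Ko.
have := vmax _ (interior_subset Ko); rewrite /dot/= v1 v2 => h1 h2.
have : l * ahead z t <= 0 by move: h1; rewrite /ahead; lra.
by rewrite nmulr_lle0.
Qed.

Lemma normal_boundary u p : u != 0 -> outer_normal K u p -> boundary K p.
Proof.
move=> u0 [Kp umax]; apply/(boundary_closed _ (compact_plane_closed Kc)); split=> //.
move=> /interiorP[e e0 He].
pose n := `|u.1| + `|u.2|.
have n0 : 0 < n.
  rewrite lt_def addr_ge0// andbT paddr_eq0// !normr_eq0; apply: contra u0.
  by move=> /andP[/eqP h1 /eqP h2]; apply/eqP/pair_ext.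
pose t := e / (2 * n).
have t0 : 0 < t by rewrite divr_gt0// mulr_gt0.
have tn : t * n = e / 2 by rewrite /t invfM mulrA divfK ?gt_eqF.
have b1 : `|t * u.1| < e.
  rewrite normrM gtr0_norm//; apply: (@le_lt_trans _ _ (t * n)); last by rewrite tn; lra.
  by rewrite ler_pM2l// lerDl.
have b2 : `|t * u.2| < e.
  rewrite normrM gtr0_norm//; apply: (@le_lt_trans _ _ (t * n)); last by rewrite tn; lra.
  by rewrite ler_pM2l// lerDr.
have /umax : K (p.1 + t * u.1, p.2 + t * u.2) by apply: He; rewrite /= addrC addKr.
rewrite /dot/= => h; have : t * (u.1 ^+ 2 + u.2 ^+ 2) <= 0 by move: h; lra.
rewrite pmulr_rle0// => h2; move/eqP: u0; apply.
have := sqr_ge0 u.1; have := sqr_ge0 u.2 => k1 k2.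
by apply: pair_ext; apply/eqP; rewrite -sqrf_eq0 eq_le; apply/andP; split => //; move: h2; lra.
Qed.

Lemma normal_point u p q : u != 0 -> outer_normal K u p -> outer_normal K u q -> p = q.
Proof.
move=> u0 up uq; have := normal_boundary u0 up; rewrite -bdK => -[t _ pE].
have [|l l0 uE] := @normal_unique u t u0; first by rewrite pE.
have E : dot u q = dot u p by apply/eqP; rewrite eq_le (up.2 _ uq.1) (uq.2 _ up.1).
rewrite -pE; symmetry; apply: touch; first by move=> s; apply: ahead_le0; exact: uq.1.
move: E; rewrite uE -pE /dot/= => E; apply: (mulfI (lt0r_neq0 l0)).
by rewrite mulr0 /ahead; lra.
Qed.

End support.

Section periodic.
Context {R : realType}.
Implicit Types (f : R -> R) (L t : R).

Lemma periodic_int f L t (k : int) : (forall t, f (t + L) = f t) -> f (t + k%:~R * L) = f t.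
Proof.
move=> fL; have pos (n : nat) s : f (s + n%:R * L) = f s.
  elim: n => [|n IH]; first by rewrite mul0r addr0.
  by rewrite -natr1 mulrDl mul1r addrA fL.
case: k => n; first exact: pos.
by rewrite NegzE mulrNz mulNr -(pos n.+1 (t - _)) subrK.
Qed.

Lemma periodic_reduce L t : 0 < L -> exists k : int, 0 <= t + k%:~R * L < L.
Proof.
move=> L0; exists (- Num.floor (t / L)); rewrite mulrNz mulNr subr_ge0.
rewrite -ler_pdivlMr// ge_floor/= ltrBlDr -[X in X + _]mul1r -mulrDl -ltr_pdivrMr// addrC.
by have := floorD1_gt (t / L); rewrite intrD.
Qed.

Lemma periodic_derive f f1 L : (forall t, f (t + L) = f t) ->
  (forall t, is_derive t (1 : R) f (f1 t)) -> forall t, f1 (t + L) = f1 t.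
Proof.
move=> fL df t; have d1 := df t.
have d2 : is_derive t (1 : R) (fun s => f (s + L)) (f1 (t + L)).
  have dl : is_derive t (1 : R) (fun s : R => s + L) 1.
    by apply: is_derive_eq; rewrite addr0.
  have := @is_derive1_comp _ f (fun s => s + L) t _ _ (df (t + L)) dl.
  by rewrite mulr1.
have E : (fun s => f (s + L)) = f by apply/funext.
rewrite E in d2.
by rewrite -(@derive_val _ _ _ _ _ _ _ d1) (@derive_val _ _ _ _ _ _ _ d2).
Qed.

Lemma C1_lipschitz f f1 (M : R) : (forall t, is_derive t (1 : R) f (f1 t)) ->
  (forall t, `|f1 t| <= M) -> forall s t, `|f s - f t| <= M * `|s - t|.
Proof.
move=> df bf; have main s t : s <= t -> `|f s - f t| <= M * `|s - t|.
  move=> st; rewrite distrC [in leRHS]distrC (ger0_norm (_ : 0 <= t - s)) ?subr_ge0//.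
  rewrite ler_norml; apply/andP; split.
    have := @is_derive_le R (fun u => f u + M * u) (fun u => f1 u + M) s t st.
    have h : forall u, s <= u <= t -> is_derive u (1 : R) (fun u => f u + M * u) (f1 u + M).
      by move=> u _; apply: is_derive_eq; rewrite -![_ *: _]/(_ * _) /cst; ring.
    move=> /(_ h) k; have := k _; suff h2 : forall u, s <= u <= t -> 0 <= f1 u + M by move=> /(_ h2); lra.
    by move=> u _; have := bf u; rewrite ler_norml => /andP[+ _]; lra.
  have := @is_derive_le R (fun u => M * u - f u) (fun u => M - f1 u) s t st.
  have h : forall u, s <= u <= t -> is_derive u (1 : R) (fun u => M * u - f u) (M - f1 u).
    by move=> u _; apply: is_derive_eq; rewrite -![_ *: _]/(_ * _) /cst; ring.
  move=> /(_ h) k; have := k _; suff h2 : forall u, s <= u <= t -> 0 <= M - f1 u by move=> /(_ h2); lra.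
  by move=> u _; have := bf u; rewrite ler_norml => /andP[_ +]; lra.
move=> s t; have [/main//|/ltW/main h] := leP s t.
by rewrite distrC [in leRHS]distrC.
Qed.

Lemma periodic_bounded f L : 0 < L -> (forall t, f (t + L) = f t) -> continuous f ->
  exists2 M : R, 0 < M & forall t, `|f t| <= M.
Proof.
move=> L0 fL cf.
have [||c _ Hc] := @EVT_max R (fun t => `|f t|) 0 L; first exact: ltW.
  apply: continuous_subspaceT => t; apply: continuous_comp; first exact: cf.
  exact: norm_continuous.
exists (`|f c| + 1); first by rewrite ltr_wpDl.
move=> t; have [k /andP[k0 kL]] := periodic_reduce t L0.
rewrite -(periodic_int t k fL); apply: (le_trans (Hc _ _)); last by rewrite lerDl.
by rewrite in_itv/= k0 ltW.
Qed.

Lemma is_derive_continuous f f1 : (forall t, is_derive t (1 : R) f (f1 t)) -> continuous f.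
Proof.
by move=> df t; apply/differentiable_continuous/derivable1_diffP; case: (df t).
Qed.

End periodic.

Section curve.
Context {R : realType}.
Implicit Types (K : set (R * R)) (L : R) (x y : R -> R).

(** [C2_positive_curvature] with its derivatives named and the curvature replaced by its numerator,
    which has the same sign. *)
Definition curve_of K L x y x1 y1 x2 y2 : Prop :=
  [/\ convex_disk K,
      [/\ forall t, is_derive t (1 : R) x (x1 t), forall t, is_derive t (1 : R) y (y1 t),
          forall t, is_derive t (1 : R) x1 (x2 t) & forall t, is_derive t (1 : R) y1 (y2 t)],
      continuous x2 /\ continuous y2,
      [/\ 0 < L, forall t, x (t + L) = x t & forall t, y (t + L) = y t]
    & [/\ {in `[0, L[ &, injective (fun t => (x t, y t))},
          range (fun t => (x t, y t)) = boundary K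
        & forall t, 0 < x1 t * y2 t - y1 t * x2 t]].

Lemma C2_curve K : convex_disk K -> C2_positive_curvature K ->
  exists L x y x1 y1 x2 y2, curve_of K L x y x1 y1 x2 y2.
Proof.
move=> cK [L [x [y [L0 [[dx dx1 cx2] [dy dy1 cy2]] [per inj bd] _ curv]]]].
exists L, x, y, (derive1 x), (derive1 y), (derive1n 2 x), (derive1n 2 y).
have D (f : R -> R) (t : R) : derivable f t 1 -> is_derive t (1 : R) f (derive1 f t).
  by move=> df; rewrite derive1E; exact: derivableP.
split; first exact: cK.
- by split=> t; [exact: D (dx t)|exact: D (dy t)|exact: D (dx1 t)|exact: D (dy1 t)].
- exact: conj cx2 cy2.
- by split => [//|t|t]; have [] := per t.
split; [exact: inj|exact: bd|] => t; have := curv t; rewrite /curvature => h.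
set a := _ - _ in h *; set s := Num.sqrt _ ^+ 3 in h.
have s0 : 0 <= s by rewrite exprn_ge0// sqrtr_ge0.
have [e|ne] := eqVneq s 0; first by rewrite e invr0 mulr0 ltxx in h.
by move: h; rewrite pmulr_lgt0// invr_gt0 lt_def ne.
Qed.

Lemma curve_C2 K L x y x1 y1 x2 y2 : curve_of K L x y x1 y1 x2 y2 ->
  C2_positive_curvature K.
Proof.
move=> [_ [dx dy dx1 dy1] [cx2 cy2] [L0 px py] [inj bd curv]].
have D (f f1 : R -> R) : (forall t : R, is_derive t (1 : R) f (f1 t)) -> derive1 f = f1.
  by move=> df; apply/funext => t; rewrite derive1E; apply: derive_val.
have d (f f1 : R -> R) (t : R) : (forall t : R, is_derive t (1 : R) f (f1 t)) -> derivable f t 1.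
  by move=> df; case: (df t).
have DD (f f1 f2 : R -> R) : (forall t : R, is_derive t (1 : R) f (f1 t)) ->
    (forall t, is_derive t (1 : R) f1 (f2 t)) -> derive1n 2 f = f2.
  by move=> df df1; rewrite /derive1n/= (D _ _ df) (D _ _ df1).
exists L, x, y; split.
- exact: L0.
- split; split.
  + by move=> t; apply: d dx.
  + by move=> t; rewrite (D _ _ dx); apply: d dx1.
  + by rewrite (DD _ _ _ dx dx1); exact: cx2.
  + by move=> t; apply: d dy.
  + by move=> t; rewrite (D _ _ dy); apply: d dy1.
  + by rewrite (DD _ _ _ dy dy1); exact: cy2.
- by split; [move=> t; rewrite px py|exact: inj|exact: bd].
- move=> t; rewrite (D _ _ dx) (D _ _ dy); apply/eqP => -[e1 e2].
  by have := curv t; rewrite e1 e2 !mul0r subrr ltxx.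
move=> t; rewrite /curvature (D _ _ dx) (D _ _ dy) (DD _ _ _ dx dx1) (DD _ _ _ dy dy1).
by apply: divr_gt0; [exact: curv|apply: exprn_gt0; rewrite sqrtr_gt0; exact: (regular curv)].
Qed.

End curve.

Section taylor.
Context {R : realType}.
Implicit Types (f : R -> R).

Lemma second_order_right f f1 f2 (k a b : R) : a <= b -> f1 a = 0 ->
  (forall t, a <= t <= b -> is_derive t (1 : R) f (f1 t)) ->
  (forall t, a <= t <= b -> is_derive t (1 : R) f1 (f2 t)) ->
  (forall t, a <= t <= b -> k <= f2 t) -> f a + k / 2 * (b - a) ^+ 2 <= f b.
Proof.
move=> ab f1a df df1 kf2.
have le1 t : a <= t <= b -> k * (t - a) <= f1 t.
  move=> /andP[at' tb].
  have := @is_derive_le R (fun s => f1 s - k * (s - a)) (fun s => f2 s - k) a t at'.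
  rewrite f1a subrr mulr0 subrr subr_ge0; apply => s /andP[as' st].
    have d1 : is_derive s (1 : R) f1 (f2 s) by apply: df1; rewrite as' (le_trans st).
    by apply: is_derive_eq; rewrite -![_ *: _]/(_ * _) /cst; ring.
  by rewrite subr_ge0 kf2// as' (le_trans st).
have := @is_derive_le R (fun s => f s - k / 2 * (s - a) ^+ 2) (fun s => f1 s - k * (s - a)) a b ab.
rewrite subrr expr0n/= mulr0 subr0 lerBrDr; apply => s sab.
  have d1 : is_derive s (1 : R) f (f1 s) by apply: df.
  by apply: is_derive_eq; rewrite -![_ *: _]/(_ * _) /cst; field.
by rewrite subr_ge0 le1.
Qed.

Lemma second_order f f1 f2 (k r t s : R) : f1 t = 0 ->
  (forall u, is_derive u (1 : R) f (f1 u)) -> (forall u, is_derive u (1 : R) f1 (f2 u)) ->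
  (forall u, `|u - t| <= r -> k <= f2 u) -> `|s - t| <= r ->
  f t + k / 2 * (s - t) ^+ 2 <= f s.
Proof.
move=> f1t df df1 kf2; have [ts|/ltW st] := leP t s => sr.
  apply: (@second_order_right f f1 f2) => // u /andP[tu us]; apply: kf2.
  by move: sr; rewrite !ger0_norm ?subr_ge0//; lra.
have c (u : R) : is_derive u (1 : R) (fun u : R => - u) (-1) by apply: is_derive_eq.
have := @second_order_right (fun u => f (- u)) (fun u => - f1 (- u)) (fun u => f2 (- u)) k (- t) (- s).
rewrite !opprK f1t oppr0 lerN2 => /(_ st erefl).
have -> : (- s + t) ^+ 2 = (s - t) ^+ 2 by ring.
apply=> u /andP[tu us].
- have := @is_derive1_comp _ f (fun s => - s) u _ _ (df _) (c u).
  by rewrite mulrN1.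
- have := is_deriveN (@is_derive1_comp _ f1 (fun s => - s) u _ _ (df1 _) (c u)).
  by rewrite mulrN1 opprK.
apply: kf2; move: sr; rewrite !ler0_norm; lra.
Qed.

End taylor.

(** * Strong convexity and the Lipschitz inverse of the Gauss map *)

Section strong_convexity.
Context {R : realType}.
Variables (K : set (R * R)) (L : R) (x y x1 y1 x2 y2 : R -> R).
Hypothesis HC : curve_of K L x y x1 y1 x2 y2.

Let cD : convex_disk K. Proof. by case: HC. Qed.
Let dx : forall t, is_derive t (1 : R) x (x1 t). Proof. by case: HC => _ []. Qed.
Let dy : forall t, is_derive t (1 : R) y (y1 t). Proof. by case: HC => _ []. Qed.
Let dx1 : forall t, is_derive t (1 : R) x1 (x2 t). Proof. by case: HC => _ []. Qed.
Let dy1 : forall t, is_derive t (1 : R) y1 (y2 t). Proof. by case: HC => _ []. Qed.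
Let cx2 : continuous x2. Proof. by case: HC => _ _ [] + _. Qed.
Let cy2 : continuous y2. Proof. by case: HC => _ _ [] _ +. Qed.
Let L0 : 0 < L. Proof. by case: HC => _ _ _ []. Qed.
Let px : forall t, x (t + L) = x t. Proof. by case: HC => _ _ _ []. Qed.
Let py : forall t, y (t + L) = y t. Proof. by case: HC => _ _ _ []. Qed.
Let inj : {in `[0, L[ &, injective (fun t => (x t, y t))}. Proof. by case: HC => _ _ _ _ []. Qed.
Let bd : range (fun t => (x t, y t)) = boundary K. Proof. by case: HC => _ _ _ _ []. Qed.
Let curv : forall t, 0 < x1 t * y2 t - y1 t * x2 t. Proof. by case: HC => _ _ _ _ []. Qed.
Let cK : cvx K. Proof. by case: cD => _ /cvxP. Qed.
Let Kc : compact K. Proof. by case: cD. Qed.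
Let intK : K° !=set0. Proof. by case: cD. Qed.
Let onK t : boundary K (x t, y t). Proof. by rewrite -bd; exists t. Qed.
Let cx : continuous x. Proof. exact: is_derive_continuous dx. Qed.
Let cy : continuous y. Proof. exact: is_derive_continuous dy. Qed.
Let cx1 : continuous x1. Proof. exact: is_derive_continuous dx1. Qed.
Let cy1 : continuous y1. Proof. exact: is_derive_continuous dy1. Qed.

Lemma curve_ahead_le0 q t : K q -> ahead x y x1 y1 q t <= 0.
Proof. exact: (ahead_le0 dx dy dx1 dy1 curv cK Kc onK). Qed.

Lemma curve_boundary p : boundary K p -> exists t, p = (x t, y t).
Proof. by rewrite -bd => -[t _ <-]; exists t. Qed.

Lemma curve_inj s t : x s = x t -> y s = y t -> exists k : int, s = t + k%:~R * L.
Proof.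
move=> ex ey; have [k hk] := periodic_reduce s L0; have [m hm] := periodic_reduce t L0.
have E : s + k%:~R * L = t + m%:~R * L.
  apply: inj; rewrite ?in_itv//=.
  by rewrite !(periodic_int _ _ px) !(periodic_int _ _ py) ex ey.
by exists (m - k); rewrite rmorphB/= mulrBl; move: E; lra.
Qed.

Lemma curve_normal_point u p q : u != 0 -> outer_normal K u p -> outer_normal K u q -> p = q.
Proof. exact: (normal_point dx dy dx1 dy1 curv cK Kc onK intK bd). Qed.

Lemma curve_normal_unique v t : v != 0 -> outer_normal K v (x t, y t) ->
  exists2 l : R, 0 < l & v = (l * y1 t, - (l * x1 t)).
Proof. exact: (normal_unique dx dy dx1 dy1 curv cK Kc onK intK). Qed.

Lemma curve_outer_normal t : outer_normal K (y1 t, - x1 t) (x t, y t).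
Proof. exact: (outer_normal_ahead dx dy dx1 dy1 curv cK Kc onK). Qed.

Lemma curve_lipschitz : exists2 M : R, 0 < M & forall s t,
  dist (x s, y s) (x t, y t) <= M * `|s - t|.
Proof.
have [M1 M10 H1] := periodic_bounded L0 (periodic_derive px dx) cx1.
have [M2 M20 H2] := periodic_bounded L0 (periodic_derive py dy) cy1.
exists (M1 + M2); first exact: addr_gt0.
move=> s t; have M0 : 0 <= (M1 + M2) * `|s - t| by rewrite mulr_ge0// addr_ge0// ltW.
rewrite dist_le//=; have := C1_lipschitz dx H1 s t; have := C1_lipschitz dy H2 s t.
rewrite mulrDl; set a := M1 * _; set b := M2 * _ => hb ha.
rewrite -(real_normK (num_real (x s - x t))) -(real_normK (num_real (y s - y t))).
have := normr_ge0 (x s - x t); have := normr_ge0 (y s - y t).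
by move: `|x s - x t| `|y s - y t| ha hb => p q; nra.
Qed.

Lemma curve_finite : (hausdorff1 (boundary K) < +oo)%E.
Proof.
have [M M0 HM] := curve_lipschitz.
have H1 : (hausdorff1 (boundary K) <=
    M%:E * hausdorff1 [set ((t, 0) : R * R)%R | t in (`[0%R, L] : set R)])%E.
  apply: (@hausdorff1_lipschitz _ (fun a p => p = (x a.1, y a.1)) _ _ M 1) => //.
    move=> p /curve_boundary[t ->]; have [k /andP[k0 kL]] := periodic_reduce t L0.
    exists (t + k%:~R * L, 0); first by exists (t + k%:~R * L) => //=; rewrite in_itv/= k0 ltW.
    by rewrite /= (periodic_int _ _ px) (periodic_int _ _ py).
  move=> a b a' b' _ _ -> -> _; apply: (le_trans (HM _ _)).
  by rewrite ler_pM2l// dist_fst.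
apply: le_lt_trans H1 _.
apply: (@le_lt_trans _ _ (M%:E * (L - 0)%:E)%E); last by rewrite -EFinM ltry.
by rewrite lee_pmul2l// hausdorff1_segment// ltW.
Qed.

(** The mixed numerator is continuous in both arguments and positive at [w = 0]; periodicity
    supplies the compactness that makes the bound uniform. *)
Lemma uniform_curvature : exists k r : R, [/\ 0 < k, 0 < r, r <= L / 2 &
  forall t w, `|w| <= r -> k <= x1 t * y2 (t + w) - y1 t * x2 (t + w)].
Proof.
have px1 := periodic_derive px dx; have py1 := periodic_derive py dy.
have px2 := periodic_derive px1 dx1; have py2 := periodic_derive py1 dy1.
have [||c _ Hc] := @EVT_min R (fun t => x1 t * y2 t - y1 t * x2 t) 0 L; first exact: ltW.
  apply: continuous_subspaceT => t.
  by apply: cvgB; apply: cvgM; [exact: cx1|exact: cy2|exact: cy1|exact: cx2].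
pose k := (x1 c * y2 c - y1 c * x2 c) / 2.
have k0 : 0 < k by rewrite divr_gt0// curv.
pose F (p : R * R) := x1 p.1 * y2 (p.1 + p.2) - y1 p.1 * x2 (p.1 + p.2).
have cF : continuous F.
  have c1 (f : R -> R) : continuous f -> continuous (fun p : R * R => f p.1).
    by move=> cf p; apply: continuous_comp; [exact: cvg_fst|exact: cf].
  have c2 (f : R -> R) : continuous f -> continuous (fun p : R * R => f (p.1 + p.2)).
    move=> cf p; apply: (@continuous_comp _ _ _ (fun p : R * R => p.1 + p.2)); last exact: cf.
    by apply: cvgD; [exact: cvg_fst|exact: cvg_snd].
  move=> p; apply: cvgB; apply: cvgM.
  - exact: (c1 x1 cx1 p).
  - exact: (c2 y2 cy2 p).
  - exact: (c1 y1 cy1 p).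
  - exact: (c2 x2 cx2 p).
have : \forall w \near (0 : R), `[0, L] `<=` (fun t => k < F (t, w)).
  have /compact_near_coveringP cov := @segment_compact R 0 L.
  apply: (cov R (nbhs (0 : R)) (fun w t => k < F (t, w))) => t tL.
  apply: (cvgr_gt _ (cF (t, 0))); rewrite /F/= addr0.
  apply: (@lt_le_trans _ _ (k * 2)); first by rewrite ltr_pMr// ltr1n.
  by rewrite divfK//; apply: Hc.
move=> /nbhs_ballP[e /= e0 He].
exists k, (Num.min (e / 2) (L / 2)); split => //.
- by rewrite lt_min !divr_gt0.
- by rewrite ge_min lexx orbT.
move=> t w; rewrite le_min => /andP[we _].
have [n /andP[n0 nL]] := periodic_reduce t L0.
rewrite -(periodic_int t n (periodic_derive px dx)) -(periodic_int t n (periodic_derive py dy)).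
rewrite -(periodic_int (t + w) n px2) -(periodic_int (t + w) n py2).
have -> : t + w + n%:~R * L = t + n%:~R * L + w by ring.
apply: ltW; apply: (He w).
  by rewrite /ball/= sub0r normrN (le_lt_trans we)// ltr_pdivrMr// ltr_pMr// ltr1n.
by rewrite /= in_itv/= n0 ltW.
Qed.

(** On a compact set of parameters that keeps away from [w = 0] modulo [L], the curve is strictly
    inside each tangent, by [touch] and injectivity on a period, so a continuous function attains a
    positive minimum. *)
Lemma far_ahead (r : R) : 0 < r -> r <= L / 2 ->
  exists2 c : R, 0 < c & forall t w, r <= w <= L - r -> c <= - ahead x y x1 y1 (x (t + w), y (t + w)) t.
Proof.
move=> r0 rL.
pose F (p : R * R) := x1 p.1 * (y (p.1 + p.2) - y p.1) - y1 p.1 * (x (p.1 + p.2) - x p.1).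
have cF : continuous F.
  have c1 (f : R -> R) : continuous f -> continuous (fun p : R * R => f p.1).
    by move=> cf p; apply: continuous_comp; [exact: cvg_fst|exact: cf].
  have c2 (f : R -> R) : continuous f -> continuous (fun p : R * R => f (p.1 + p.2)).
    move=> cf p; apply: (@continuous_comp _ _ _ (fun p : R * R => p.1 + p.2)); last exact: cf.
    by apply: cvgD; [exact: cvg_fst|exact: cvg_snd].
  move=> p; apply: cvgB; apply: cvgM.
  - exact: (c1 x1 cx1 p).
  - by apply: cvgB; [exact: (c2 y cy p)|exact: (c1 y cy p)].
  - exact: (c1 y1 cy1 p).
  - by apply: cvgB; [exact: (c2 x cx p)|exact: (c1 x cx p)].
have [|||[c v] cv Hc] := @compact_EVT_min _ R F (`[0, L] `*` `[r, L - r]).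
- by exists (0, r); split; rewrite /= in_itv/= lexx ?(ltW L0)//; lra.
- by apply: compact_setX; exact: segment_compact.
- exact: continuous_subspaceT.
move: cv; rewrite inE => -[/=]; rewrite !in_itv/= => c0L /andP[rv vL].
have FE t w : F (t, w) = - ahead x y x1 y1 (x (t + w), y (t + w)) t.
  by rewrite /F /ahead/=; ring.
exists (F (c, v)).
  rewrite FE oppr_gt0 lt_neqAle curve_ahead_le0 ?andbT; last first.
    by have [] := (boundary_closed _ (compact_plane_closed Kc)).1 (onK (c + v)).
  apply/eqP => E.
  have [ex ey] : (x (c + v), y (c + v)) = (x c, y c).
    apply: (touch dx dy dx1 dy1 curv _ E) => s; apply: curve_ahead_le0.
    by have [] := (boundary_closed _ (compact_plane_closed Kc)).1 (onK (c + v)).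
  have [k kE] := curve_inj ex ey.
  have vk : v = k%:~R * L by move: kE; lra.
  have k0 : (0 < k)%R by rewrite -(ltr0z R) -(pmulr_lgt0 _ L0) -vk; move: r0 rv; lra.
  have : (k < 1)%R by rewrite -(ltrz1 R) -(ltr_pM2r L0) mul1r -vk; move: r0 vL; lra.
  by case: (k) k0 => [[|n]|n].
move=> t w /andP[rw wL]; have [n /andP[n0 nL]] := periodic_reduce t L0.
have := Hc (t + n%:~R * L, w); rewrite FE => h.
have := h; rewrite FE /ahead/=.
have -> : t + n%:~R * L + w = t + w + n%:~R * L by ring.
rewrite !(periodic_int _ n px) !(periodic_int _ n py) !(periodic_int _ n (periodic_derive px dx)) !(periodic_int _ n (periodic_derive py dy)).
by apply; rewrite inE; split; rewrite /= in_itv/= ?n0 ?rw ?wL ?ltW.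
Qed.

(** The curve leaves each tangent at least quadratically: near the point of contact by
    [uniform_curvature] and Taylor, elsewhere by [far_ahead], where [B] bounds all distances. The
    Lipschitz constant [M] converts parameters into distances. *)
Lemma strong_convexity : exists2 c : R, 0 < c & forall s t,
  c * dist (x t, y t) (x s, y s) ^+ 2 <= - ahead x y x1 y1 (x s, y s) t.
Proof.
have [k [r [k0 r0 rL curvk]]] := uniform_curvature.
have [c1 c10 far] := far_ahead r0 rL.
have [M M0 HM] := curve_lipschitz.
pose B := M * L.
have B0 : 0 < B by rewrite mulr_gt0.
have near t w : `|w| <= r -> k / 2 * w ^+ 2 <= - ahead x y x1 y1 (x (t + w), y (t + w)) t.
  have dx_ := dx; have dy_ := dy; have dx1_ := dx1; have dy1_ := dy1.
  move=> wr; pose g s := x1 t * (y s - y t) - y1 t * (x s - x t).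
  have := @second_order R g (fun s => x1 t * y1 s - y1 t * x1 s)
    (fun s => x1 t * y2 s - y1 t * x2 s) k r t (t + w).
  have -> : g t = 0 by rewrite /g; ring.
  have -> : t + w - t = w by ring.
  have -> : - ahead x y x1 y1 (x (t + w), y (t + w)) t = g (t + w) by rewrite /ahead /g/=; ring.
  rewrite add0r; apply => //; first by ring.
  - by move=> u; rewrite /g; apply: is_derive_eq; rewrite -![_ *: _]/(_ * _) /cst; ring.
  by move=> u ur; rewrite -(subrKC t u); exact: curvk.
exists (Num.min (k / (2 * M ^+ 2)) (c1 / B ^+ 2)).
  by rewrite lt_min !divr_gt0// ?mulr_gt0// exprn_gt0.
move=> s t; have [n /andP[n0 nL]] := periodic_reduce (s - t) L0.
have local w : (exists m : int, s = t + w + m%:~R * L) -> `|w| <= r ->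
    k / (2 * M ^+ 2) * dist (x t, y t) (x s, y s) ^+ 2 <= - ahead x y x1 y1 (x s, y s) t.
  move=> [m ->] wr; rewrite !(periodic_int _ m px) !(periodic_int _ m py).
  apply: le_trans (near t w wr).
  have := HM t (t + w); rewrite opprD addNKr normrN => h.
  have : dist (x t, y t) (x (t + w), y (t + w)) ^+ 2 <= (M * `|w|) ^+ 2.
    by rewrite ler_sqr ?nnegrE ?dist_ge0// mulr_ge0// ltW.
  rewrite exprMn real_normK ?num_real// => h2.
  apply: (@le_trans _ _ (k / (2 * M ^+ 2) * (M ^+ 2 * w ^+ 2))).
    by rewrite ler_pM2l// divr_gt0// mulr_gt0// exprn_gt0.
  by rewrite le_eqVlt; apply/orP; left; apply/eqP; field; exact: lt0r_neq0.
have sw : s = t + (s - t + n%:~R * L) + (- n)%:~R * L by rewrite mulrNz; ring.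
set w := s - t + n%:~R * L in n0 nL sw.
have dge := sqr_ge0 (dist (x t, y t) (x s, y s)).
have [wr|rw] := leP w r.
  apply: le_trans (local w _ _); last by rewrite ger0_norm.
    by rewrite ler_wpM2r// ge_min lexx.
  by exists (- n).
have [wL|Lw] := leP w (L - r); last first.
  apply: le_trans (local (w - L) _ _); last by rewrite ltr0_norm; move: Lw nL; lra.
    by rewrite ler_wpM2r// ge_min lexx.
  by exists (1 - n); rewrite rmorphB/= mulrBl mul1r {1}sw mulrNz; ring.
have -> : ahead x y x1 y1 (x s, y s) t = ahead x y x1 y1 (x (t + w), y (t + w)) t.
  by rewrite {1 2}sw !(periodic_int _ (- n) px) !(periodic_int _ (- n) py).
apply: le_trans (far t w _); last by rewrite (ltW rw).
apply: (@le_trans _ _ (c1 / B ^+ 2 * B ^+ 2)); last by rewrite divfK// sqrf_eq0 lt0r_neq0.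
apply: ler_pM => //; first by rewrite le_min !divr_ge0 ?mulr_ge0 ?exprn_ge0// ltW.
  by rewrite ge_min lexx orbT.
rewrite ler_sqr ?nnegrE ?dist_ge0 ?(ltW B0)//.
rewrite sw !(periodic_int _ (- n) px) !(periodic_int _ (- n) py).
apply: (le_trans (HM _ _)); rewrite /B ler_pM2l// opprD addNKr normrN ger0_norm//.
exact: ltW.
Qed.

Lemma dot_le_dist (u v p q : R * R) : dot (u - v) (p - q) <= dist u v * dist p q.
Proof.
have [h|h] := leP (dot (u - v) (p - q)) 0.
  by apply: (le_trans h); rewrite mulr_ge0 ?dist_ge0.
rewrite -ler_sqr ?nnegrE ?mulr_ge0 ?dist_ge0 ?(ltW h)// exprMn !dist_sqr /dot/=.
set a := u.1 - v.1; set b := u.2 - v.2; set c := p.1 - q.1; set d := p.2 - q.2.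
rewrite -subr_ge0.
have -> : (a ^+ 2 + b ^+ 2) * (c ^+ 2 + d ^+ 2) - (a * c + b * d) ^+ 2 = (a * d - b * c) ^+ 2 by ring.
exact: sqr_ge0.
Qed.

(** Adding the inequality of strong convexity at [p] with normal [u] to that at [q] with normal [v]
    bounds the square of [dist p q] by a multiple of [dot (u - v) (p - q)], and Cauchy-Schwarz
    divides out one factor. The purpose is to bound the surface area measure by a multiple of the
    length of the set of normals. *)
Lemma gauss_lipschitz : exists2 M : R, 0 < M & forall u v p q, dot u u = 1 -> dot v v = 1 ->
  outer_normal K u p -> outer_normal K v q -> dist p q <= M * dist u v.
Proof.
have [c c0 Hc] := strong_convexity.
have [M1 M10 H1] := periodic_bounded L0 (periodic_derive px dx) cx1.
have [M2 M20 H2] := periodic_bounded L0 (periodic_derive py dy) cy1.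
pose M := M1 + M2; have M0 : 0 < M by rewrite addr_gt0.
have neq0 (u : R * R) : dot u u = 1 -> u != 0.
  by move=> u1; apply/eqP => u0; move: u1; rewrite u0 /dot/= mulr0 addr0 => /eqP; rewrite eq_sym oner_eq0.
have key u p q : dot u u = 1 -> outer_normal K u p -> boundary K q ->
    c / M * dist p q ^+ 2 <= dot u (p - q).
  move=> u1 up /curve_boundary[s qE].
  have u0 := neq0 _ u1.
  have := normal_boundary Kc u0 up => /curve_boundary[t pE].
  rewrite pE in up *; rewrite qE; have [l l0 lE] := curve_normal_unique u0 up.
  have -> : dot u ((x t, y t) - (x s, y s)) = l * (- ahead x y x1 y1 (x s, y s) t).
    by rewrite lE /dot /ahead/=; ring.
  have lM : M^-1 <= l.
    rewrite -[M^-1]mul1r ler_pdivrMr//.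
    have : 1 <= (l * M) ^+ 2.
      rewrite -u1 lE /dot/= exprMn.
      have := H1 t; have := H2 t; rewrite !ler_norml => /andP[a1 a2] /andP[b1 b2].
      have h : x1 t ^+ 2 + y1 t ^+ 2 <= M ^+ 2.
        by rewrite /M; move: (x1 t) (y1 t) a1 a2 b1 b2 => X Y; nra.
      have -> : l * y1 t * (l * y1 t) + - (l * x1 t) * - (l * x1 t) = l ^+ 2 * (x1 t ^+ 2 + y1 t ^+ 2) by ring.
      by rewrite ler_pM2l// exprn_gt0.
    by rewrite -{1}(expr1n _ 2) ler_sqr// nnegrE// ?mulr_ge0// ltW.
  apply: (@le_trans _ _ (l * (c * dist (x t, y t) (x s, y s) ^+ 2))); last by rewrite ler_pM2l// Hc.
  by rewrite mulrA ler_wpM2r ?sqr_ge0// mulrC ler_pM2r.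
exists (M / (2 * c)); first by rewrite divr_gt0// mulr_gt0.
move=> u v p q u1 v1 up vq.
have bp := normal_boundary Kc (neq0 _ u1) up; have bq := normal_boundary Kc (neq0 _ v1) vq.
have h1 := key _ _ _ u1 up bq; have h2 := key _ _ _ v1 vq bp.
have h3 := dot_le_dist u v p q.
have d0 := dist_ge0 p q.
have [->|dn] := eqVneq (dist p q) 0; first by rewrite mulr_ge0 ?dist_ge0// divr_ge0 ?mulr_ge0// ltW.
have dp : 0 < dist p q by rewrite lt_def dn.
have E : dist q p = dist p q.
  by rewrite /dist /dot/=; congr Num.sqrt; ring.
have D : dot (u - v) (p - q) = dot u (p - q) + dot v (q - p) by rewrite /dot/=; ring.
rewrite E in h2; rewrite D in h3.
have : 2 * (c / M) * dist p q * dist p q <= dist u v * dist p q.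
  by move: h1 h2 h3; lra.
rewrite ler_pM2r// => h4.
have -> : M / (2 * c) * dist u v = (2 * (c / M))^-1 * dist u v.
  by congr (_ * _); field; rewrite !lt0r_neq0.
have cM : 0 < 2 * (c / M) by apply: mulr_gt0 => //; exact: divr_gt0.
by rewrite ler_pdivlMl.
Qed.

End strong_convexity.

(** * The boundary near a lowest point *)

Section normals.
Context {R : realType}.
Implicit Types (K : set (R * R)) (u p q : R * R).

Lemma normal_exists K u : compact K -> K !=set0 -> exists p, outer_normal K u p.
Proof.
move=> Kc K0.
have [|p /set_mem Kp Hp] := @compact_EVT_max _ R (fun q => dot u q) K K0 Kc.
  apply: continuous_subspaceT.
  have -> : (fun q => dot u q) = (fun q : R * R => u.1 * q.1 + u.2 * q.2 + 0).
    by apply/funext => q; rewrite addr0.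
  exact: affine_continuous.
by exists p; split => // q Kq; apply: Hp; rewrite inE.
Qed.

Lemma outer_normal_scale K u p (l : R) : 0 < l -> outer_normal K u p ->
  outer_normal K (l * u.1, l * u.2) p.
Proof.
move=> l0 [Kp Hp]; split => // q /Hp; rewrite /dot/= -!mulrA -!mulrDr => h.
by rewrite ler_pM2l.
Qed.

Lemma outer_normal_low K (m : R) p q : outer_normal K (m, -1) p -> K q ->
  p.2 + m * (q.1 - p.1) <= q.2.
Proof. by move=> [_ Hp] /Hp; rewrite /dot/=; lra. Qed.

Lemma low_outer_normal K (m : R) p : K p -> (forall q, K q -> p.2 + m * (q.1 - p.1) <= q.2) ->
  outer_normal K (m, -1) p.
Proof. by move=> Kp H; split => // q /H; rewrite /dot/=; lra. Qed.

End normals.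

Section local_graph.
Context {R : realType}.
Variables (K : set (R * R)) (L : R) (x y x1 y1 x2 y2 : R -> R).
Hypothesis HC : curve_of K L x y x1 y1 x2 y2.

Lemma bottom_point : exists t, [/\ 0 < x1 t, y1 t = 0 & 0 < y2 t].
Proof.
have [[Kc cK intK] [dx dy dx1 dy1] [cx2 cy2] [L0 px py] [inj bd curv]] := HC.
have [z /interior_subset Kz] := intK.
have [p Hp] := @normal_exists R K (0, -1) Kc (ex_intro _ z Kz).
have u0 : ((0, -1) : R * R) != 0 by apply/eqP => -[/eqP]; rewrite oppr_eq0 oner_eq0.
have [t pE] := curve_boundary HC (normal_boundary Kc u0 Hp).
rewrite pE in Hp; have [l l0 [e1 e2]] := curve_normal_unique HC u0 Hp.
have y10 : y1 t = 0 by apply: (mulfI (lt0r_neq0 l0)); rewrite mulr0.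
have x10 : 0 < x1 t by rewrite -(pmulr_rgt0 _ l0); move: e2; lra.
by exists t; split => //; have := curv t; rewrite y10 mul0r subr0 pmulr_rgt0.
Qed.

Definition slope t := y1 t / x1 t.

Lemma is_derive_slope t : x1 t != 0 ->
  is_derive t (1 : R) slope ((x1 t * y2 t - y1 t * x2 t) / x1 t ^+ 2).
Proof.
have [_ [dx dy dx1 dy1] _ _ _] := HC.
move=> x0; have := is_deriveV x0 (dx1 t) => dV.
have := is_deriveM (dy1 t) dV => dM; apply: is_derive_eq; rewrite -![_ *: _]/(_ * _).
by rewrite -!exprVn; field.
Qed.

Section window.
Variables (a b k1 k2 : R).
Hypothesis pos : forall t, a <= t <= b -> 0 < x1 t.
Hypothesis curvb : forall t, a <= t <= b ->
  k1 * x1 t ^+ 3 <= x1 t * y2 t - y1 t * x2 t <= k2 * x1 t ^+ 3.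

(** The derivative of the slope with respect to the abscissa is the numerator of the curvature over
    [x1 ^+ 3], which [curvb] encloses between [k1] and [k2]. *)
Lemma slope_bounds s t : a <= s -> s <= t -> t <= b ->
  k1 * (x t - x s) <= slope t - slope s <= k2 * (x t - x s).
Proof.
have [_ [dx dy dx1 dy1] _ _ _] := HC.
move=> as' st tb; have ins u : s <= u <= t -> a <= u <= b.
  by move=> /andP[su ut]; rewrite (le_trans as' su) (le_trans ut tb).
have dm u : s <= u <= t -> is_derive u (1 : R) slope ((x1 u * y2 u - y1 u * x2 u) / x1 u ^+ 2).
  by move=> /ins/pos/lt0r_neq0; exact: is_derive_slope.
have bnd u : s <= u <= t -> k1 * x1 u <= (x1 u * y2 u - y1 u * x2 u) / x1 u ^+ 2 <= k2 * x1 u.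
  move=> /ins ui; have x0 := pos ui; have /andP[c1 c2] := curvb ui.
  by rewrite ler_pdivlMr ?exprn_gt0// ler_pdivrMr ?exprn_gt0// -!mulrA -!exprS c1.
apply/andP; split.
  have := @is_derive_le R (fun u => slope u - k1 * x u)
    (fun u => (x1 u * y2 u - y1 u * x2 u) / x1 u ^+ 2 - k1 * x1 u) s t st.
  have h : forall u, s <= u <= t -> is_derive u (1 : R) (fun u => slope u - k1 * x u)
    ((x1 u * y2 u - y1 u * x2 u) / x1 u ^+ 2 - k1 * x1 u).
    move=> u ui; have dmu := dm u ui; apply: is_derive_eq.
    by rewrite -![_ *: _]/(_ * _).
  move=> /(_ h) k; have h2 : forall u, s <= u <= t ->
      0 <= (x1 u * y2 u - y1 u * x2 u) / x1 u ^+ 2 - k1 * x1 u.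
    by move=> u /bnd/andP[+ _]; rewrite subr_ge0.
  by move: (k h2); lra.
have := @is_derive_le R (fun u => k2 * x u - slope u)
  (fun u => k2 * x1 u - (x1 u * y2 u - y1 u * x2 u) / x1 u ^+ 2) s t st.
have h : forall u, s <= u <= t -> is_derive u (1 : R) (fun u => k2 * x u - slope u)
  (k2 * x1 u - (x1 u * y2 u - y1 u * x2 u) / x1 u ^+ 2).
  move=> u ui; have dmu := dm u ui; apply: is_derive_eq.
  by rewrite -![_ *: _]/(_ * _).
move=> /(_ h) k; have h2 : forall u, s <= u <= t ->
    0 <= k2 * x1 u - (x1 u * y2 u - y1 u * x2 u) / x1 u ^+ 2.
  by move=> u /bnd/andP[_]; rewrite subr_ge0.
by move: (k h2); lra.
Qed.

Lemma height_bounds s t : a <= s <= b -> a <= t <= b ->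
  k1 / 2 * (x t - x s) ^+ 2 <= y t - y s - slope s * (x t - x s) <= k2 / 2 * (x t - x s) ^+ 2.
Proof.
have [_ [dx dy dx1 dy1] _ _ _] := HC.
move=> /andP[as' sb] /andP[at' tb].
pose f k u := y u - slope s * (x u - x s) - k / 2 * (x u - x s) ^+ 2.
pose g k u := x1 u * (slope u - slope s - k * (x u - x s)).
have df k u : a <= u <= b -> is_derive u (1 : R) (f k) (g k u).
  move=> /pos x0; have -> : g k u = y1 u - slope s * x1 u - k * (x u - x s) * x1 u.
    by rewrite /g {1}/slope; field; exact: lt0r_neq0.
  by rewrite /f; apply: is_derive_eq; rewrite -![_ *: _]/(_ * _) /cst; field.
have fs k : f k s = y s by rewrite /f; ring.
have goal k : f k t - y s = y t - y s - slope s * (x t - x s) - k / 2 * (x t - x s) ^+ 2.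
  by rewrite /f; ring.
have [st|/ltW ts] := leP s t.
  have ins u : s <= u <= t -> a <= u <= b.
    by move=> /andP[su ut]; rewrite (le_trans as' su) (le_trans ut tb).
  apply/andP; split.
    rewrite -subr_ge0 -goal subr_ge0 -(fs k1); apply: (@is_derive_le _ _ (g k1)) => // u ui.
      exact/df/ins.
    have /andP[su ut] := ui; have /andP[h _] := slope_bounds as' su (le_trans ut tb).
    by rewrite mulr_ge0 ?(ltW (pos (ins _ ui)))// subr_ge0.
  rewrite -subr_le0 -goal subr_le0 -(fs k2) -lerN2.
  apply: (@is_derive_le _ (\- f k2) (\- g k2)) => // u ui.
    by apply: is_deriveN; exact: df (ins _ ui).
  have /andP[su ut] := ui; have /andP[_ h] := slope_bounds as' su (le_trans ut tb).
  by rewrite /= oppr_ge0 mulr_ge0_le0 ?(ltW (pos (ins _ ui)))// subr_le0.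
have ins u : t <= u <= s -> a <= u <= b.
  by move=> /andP[su ut]; rewrite (le_trans at' su) (le_trans ut sb).
apply/andP; split.
  rewrite -subr_ge0 -goal subr_ge0 -(fs k1) -lerN2; apply: (@is_derive_le _ (\- f k1) (\- g k1)) => // u ui.
    by apply: is_deriveN; exact: df (ins _ ui).
  have /andP[su ut] := ui; have /andP[h _] := slope_bounds (le_trans at' su) ut sb.
  by rewrite /= oppr_ge0 mulr_ge0_le0 ?(ltW (pos (ins _ ui)))//; move: h; lra.
rewrite -subr_le0 -goal subr_le0 -(fs k2).
apply: (@is_derive_le _ _ (g k2)) => // u ui; first exact/df/ins.
have /andP[su ut] := ui; have /andP[_ h] := slope_bounds (le_trans at' su) ut sb.
by rewrite mulr_ge0 ?(ltW (pos (ins _ ui)))//; move: h; lra.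
Qed.

End window.

(** [c] is the curvature at the lowest point. It is fixed before the precision [nu]: a smaller [nu]
    only costs a shorter window. The functions [h] and [s] are height and slope in terms of the
    horizontal offset, obtained by inverting [x]. *)
Lemma local_graph : exists (b : R * R) (c : R), 0 < c /\ forall nu : R, 0 < nu < 1 ->
  exists (r : R) (h s : R -> R), [/\ 0 < r,
    forall z, `|z| <= r -> outer_normal K (s z, -1) (b.1 + z, b.2 + h z),
    h 0 = 0 /\ s 0 = 0
    & forall z w, `|z| <= r -> `|w| <= r ->
      (z <= w -> c * (1 - nu) * (w - z) <= s w - s z <= c * (1 + nu) * (w - z)) /\
      c * (1 - nu) / 2 * (w - z) ^+ 2 <= h w - h z - s z * (w - z) <= c * (1 + nu) / 2 * (w - z) ^+ 2].
Proof.
have [cD [dx dy dx1 dy1] [cx2 cy2] [L0 px py] [inj bd curv]] := HC.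
have [t0 [xt0 yt0 y2t0]] := bottom_point.
exists (x t0, y t0), (y2 t0 / x1 t0 ^+ 2); split; first by rewrite divr_gt0// exprn_gt0.
set c := y2 t0 / x1 t0 ^+ 2; have c0 : 0 < c by rewrite divr_gt0// exprn_gt0.
move=> nu /andP[nu0 nu1].
have cx1 : continuous x1 by exact: is_derive_continuous dx1.
have cy1 : continuous y1 by exact: is_derive_continuous dy1.
have cx : continuous x by exact: is_derive_continuous dx.
have ccurv : continuous (fun t => x1 t * y2 t - y1 t * x2 t).
  by move=> t; apply: cvgB; apply: cvgM; [exact: cx1|exact: cy2|exact: cy1|exact: cx2].
have ccube k : continuous (fun t => k * x1 t ^+ 3).
  move=> t; apply: cvgM; first exact: cvg_cst.
  by apply: (@continuous_comp _ _ _ x1 (fun u : R => u ^+ 3)); [exact: cx1|exact: exprn_continuous].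
have E0 : x1 t0 * y2 t0 - y1 t0 * x2 t0 = c * x1 t0 ^+ 3.
  by rewrite yt0 /c; field; exact: lt0r_neq0.
have cube0 : 0 < c * x1 t0 ^+ 3 by rewrite mulr_gt0// exprn_gt0.
have : \forall t \near t0, [/\ 0 < x1 t,
    0 < x1 t * y2 t - y1 t * x2 t - c * (1 - nu) * x1 t ^+ 3
    & 0 < c * (1 + nu) * x1 t ^+ 3 - (x1 t * y2 t - y1 t * x2 t)].
  apply: filterS3 (cvgr_gt _ (cx1 t0) _ xt0)
    (cvgr_gt _ (cvgB (ccurv t0) (ccube (c * (1 - nu)) t0)) 0 _)
    (cvgr_gt _ (cvgB (ccube (c * (1 + nu)) t0) (ccurv t0)) 0 _) => //=.
    rewrite E0 -mulrA mulrCA; have : 0 < nu * (c * x1 t0 ^+ 3) by rewrite mulr_gt0.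
    by lra.
  rewrite E0 -mulrA mulrCA; have : 0 < nu * (c * x1 t0 ^+ 3) by rewrite mulr_gt0.
  by lra.
move=> /nbhs_ballP[e /= e0 He].
pose d := e / 2; have d0 : 0 < d by rewrite divr_gt0.
pose a := t0 - d; pose b := t0 + d.
have near t : a <= t <= b -> [/\ 0 < x1 t,
    0 < x1 t * y2 t - y1 t * x2 t - c * (1 - nu) * x1 t ^+ 3
    & 0 < c * (1 + nu) * x1 t ^+ 3 - (x1 t * y2 t - y1 t * x2 t)].
  move=> /andP[at' tb]; apply: He; rewrite /ball/= ltr_norml.
  by move: at' tb; rewrite /a /b /d => ? ?; apply/andP; split; lra.
have pos t : a <= t <= b -> 0 < x1 t by move=> /near[].
have cb t : a <= t <= b ->
    c * (1 - nu) * x1 t ^+ 3 <= x1 t * y2 t - y1 t * x2 t <= c * (1 + nu) * x1 t ^+ 3.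
  by move=> /near[_ h1 h2]; apply/andP; split; apply: ltW; rewrite -subr_gt0.
have xinc s t : a <= s -> s < t -> t <= b -> x s < x t.
  move=> as' st tb; apply: (@is_derive_lt _ x x1) => // u /andP[su ut].
  by apply: pos; rewrite (le_trans as' (ltW su)) (le_trans (ltW ut) tb).
have atb : a <= t0 <= b by rewrite /a /b; apply/andP; split; lra.
pose r := Num.min (x b - x t0) (x t0 - x a).
have r0 : 0 < r by rewrite lt_min !subr_gt0 !xinc// /a /b; move: d0; lra.
(* A dummy value outside the window lets [choice] produce a total inverse of [x]. *)
have ivt z : exists t, `|z| <= r -> a <= t <= b /\ x t = x t0 + z.
  have [zr|zr] := boolP (`|z| <= r); last by exists 0.
  have := zr; rewrite ler_norml => /andP[z1 z2].
  have [|||t tab xt] := @IVT R x a b (x t0 + z); first by rewrite /a /b; move: d0; lra.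
  - exact: continuous_subspaceT.
  - have xab : x a <= x b by rewrite ltW// xinc// /a /b; move: d0; lra.
    rewrite (min_idPl xab) (max_idPr xab).
    have r1 : r <= x b - x t0 by rewrite ge_min lexx.
    have r2 : r <= x t0 - x a by rewrite ge_min lexx orbT.
    by apply/andP; split; move: z1 z2 r1 r2; lra.
  by exists t => _; split => //; rewrite in_itv in tab.
have [tau Htau] := choice ivt.
pose h z := y (tau z) - y t0; pose s z := slope (tau z).
have T z : `|z| <= r -> a <= tau z <= b by move=> /Htau[].
have X z : `|z| <= r -> x (tau z) = x t0 + z by move=> /Htau[].
have Tle z w : `|z| <= r -> `|w| <= r -> z <= w -> tau z <= tau w.
  move=> zr wr zw; rewrite leNgt; apply/negP => lt; have /andP[h1 _] := T _ wr; have /andP[_ h2] := T _ zr.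
  by have := xinc _ _ h1 lt h2; rewrite (X _ zr) (X _ wr) ltrD2l ltNge zw.
have N z : `|z| <= r -> outer_normal K (s z, -1) (x t0 + z, y t0 + h z).
  move=> zr; have x0 := pos _ (T _ zr).
  have := @outer_normal_scale R K _ _ (x1 (tau z))^-1 _ (curve_outer_normal HC (tau z)).
  rewrite invr_gt0 => /(_ x0) /=.
  by rewrite mulrN mulVf ?lt0r_neq0// mulrC (X _ zr) /h subrKC.
have tau0 : tau 0 = t0.
  have r0' : `|0 : R| <= r by rewrite normr0 ltW.
  have := X _ r0'; rewrite addr0 => e'.
  have /andP[h1 h2] := T _ r0'; have /andP[h3 h4] := atb.
  apply/eqP; rewrite eq_le !leNgt; apply/andP; split; apply/negP => lt.
    by have := xinc _ _ h3 lt h2; rewrite e' ltxx.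
  by have := xinc _ _ h1 lt h4; rewrite e' ltxx.
exists r, h, s; split => //.
- by rewrite /h /s tau0 /slope yt0 mul0r subrr.
move=> z w zr wr; split.
  move=> zw; have := @slope_bounds a b _ _ pos cb (tau z) (tau w).
  rewrite (X _ zr) (X _ wr) opprD addrACA subrr add0r; apply.
  - by have /andP[] := T _ zr.
  - exact: Tle.
  - by have /andP[] := T _ wr.
have := @height_bounds a b _ _ pos cb (tau z) (tau w) (T _ zr) (T _ wr).
rewrite (X _ zr) (X _ wr) opprD addrACA subrr add0r.
have -> : y (tau w) - y (tau z) = h w - h z by rewrite /h; ring.
by [].
Qed.

End local_graph.

(** * Denting a disk *)

Section local_derivative.
Context {R : realType}.
Implicit Types (f g : R -> R) (t d : R).

Lemma cvg_is_derive f t d : (fun h => h^-1 *: (f (h *: 1 + t) - f t)) @ (0 : R)^' --> d ->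
  is_derive t (1 : R) f d.
Proof.
move=> h; apply: DeriveDef; first by apply/cvg_ex; exists d.
by apply: cvg_lim => //; exact: h.
Qed.

Lemma is_derive_cvg f t d : is_derive t (1 : R) f d ->
  (fun h => h^-1 *: (f (h *: 1 + t) - f t)) @ (0 : R)^' --> d.
Proof. by move=> [fd <-]; exact: fd. Qed.

Lemma is_derive_near f g t d : (\forall u \near t, f u = g u) ->
  is_derive t (1 : R) g d -> is_derive t (1 : R) f d.
Proof.
move=> fg /is_derive_cvg h; apply: cvg_is_derive; apply: cvg_trans h.
apply: near_eq_cvg; rewrite near_withinE.
have ft := nbhs_singleton fg.
move/nbhs_ballP: fg => [e /= e0 He]; exists e => // u /= ue _.
rewrite ft He//= -[u *: 1]/(u * 1) mulr1 /ball/= opprD addrCA subrr addr0.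
by move: ue; rewrite sub0r.
Qed.

(** Meant for powers of the positive part, where the rules of differentiation fail at the kink but
    the remainder is still quadratic. *)
Lemma is_derive_quadratic f t d (M : R) : (forall u, `|u - t| <= 1 ->
  `|f u - f t - d * (u - t)| <= M * (u - t) ^+ 2) -> is_derive t (1 : R) f d.
Proof.
move=> H; apply: cvg_is_derive; apply/cvgrPdist_le => e e0.
pose r := Num.min 1 (e / (`|M| + 1)).
have M1 : 0 < `|M| + 1 by rewrite ltr_wpDl.
have r0 : 0 < r by rewrite lt_min ltr01 divr_gt0.
rewrite near_withinE; exists r => // h /=; rewrite sub0r normrN => hr h0.
rewrite -![_ *: _]/(_ * _) mulr1.
have h1 : `|h + t - t| <= 1 by rewrite addrK (le_trans (ltW hr))// ge_min lexx.
have := H _ h1; rewrite addrK => k.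
have hp : 0 < `|h| by rewrite normr_gt0.
have E : h * (d - h^-1 * (f (h + t) - f t)) = - (f (h + t) - f t - d * h) by field.
rewrite -(ler_pM2l hp) -normrM E normrN.
apply: (le_trans k); rewrite -(real_normK (num_real h)) expr2 mulrA [leRHS]mulrC ler_pM2r//.
apply: (@le_trans _ _ ((`|M| + 1) * `|h|)).
  by rewrite ler_pM2r// (le_trans (ler_norm M))// lerDl.
by rewrite mulrC -ler_pdivlMr// (le_trans (ltW hr))// ge_min lexx orbT.
Qed.

End local_derivative.

Section bump.
Context {R : realType}.
Implicit Types (z w : R).

Lemma is_derive_sqr_pos w : is_derive w (1 : R) (fun u => Num.max u 0 ^+ 2) (2 * Num.max w 0).
Proof.
apply: (@is_derive_quadratic _ _ _ _ 1) => u _; rewrite mul1r ler_norml.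
have := sqr_ge0 (u - w); have := sqr_ge0 u; have := sqr_ge0 w.
have [u0|/ltW u0] := leP u 0; have [w0|/ltW w0] := leP w 0.
- by move=> ? ? ?; apply/andP; split; lra.
- by have := mulr_ge0_le0 w0 u0; move=> ? ? ? ?; apply/andP; split; lra.
- by have := mulr_ge0_le0 u0 w0; move=> ? ? ? ?; apply/andP; split; lra.
- by move=> ? ? ?; apply/andP; split; lra.
Qed.

Lemma is_derive_cube_pos w : is_derive w (1 : R) (fun u => Num.max u 0 ^+ 3) (3 * Num.max w 0 ^+ 2).
Proof.
(* For positive [u] and [w] the remainder is [(u + 2 * w) * (u - w) ^+ 2] with [u <= w + 1]; the
   factor [5] covers the case of different signs as well. *)
apply: (@is_derive_quadratic _ _ _ _ (5 * Num.max w 0 + 1)) => u.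
rewrite !ler_norml => /andP[h1 h2].
have [u0|u0] := leP u 0; have [w0|w0] := leP w 0.
- by have := sqr_ge0 (u - w); move=> ?; apply/andP; split; lra.
- have -> : 0 ^+ 3 - w ^+ 3 - 3 * w ^+ 2 * (u - w) = w ^+ 2 * (2 * w - 3 * u) by ring.
  have p : 0 <= w ^+ 2 * (2 * w - 3 * u) by rewrite mulr_ge0 ?sqr_ge0//; lra.
  have q : 0 <= (u - w) ^+ 2 by rewrite sqr_ge0.
  apply/andP; split; first by apply: le_trans p; rewrite oppr_le0 mulr_ge0//; lra.
  have : 0 <= w * (3 * w ^+ 2 - 7 * (u * w) + 5 * u ^+ 2) by nra.
  by move: q; lra.
- have -> : u ^+ 3 - 0 ^+ 3 - 3 * 0 ^+ 2 * (u - w) = u ^+ 3 by ring.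
  rewrite mulr0 add0r mul1r.
  have p : 0 <= u ^+ 3 by rewrite exprn_ge0// ltW.
  have q : 0 <= (u - w) ^+ 2 by rewrite sqr_ge0.
  apply/andP; split; first by move: p q; lra.
  have k : u ^+ 3 <= u ^+ 2 by rewrite exprS ler_piMl ?sqr_ge0//; lra.
  by nra.
have -> : u ^+ 3 - w ^+ 3 - 3 * w ^+ 2 * (u - w) = (u + 2 * w) * (u - w) ^+ 2 by ring.
have q : 0 <= (u - w) ^+ 2 by rewrite sqr_ge0.
rewrite -mulNr !ler_wpM2r//; lra.
Qed.

Definition bump1 z : R := - 6 * z * Num.max (1 - z ^+ 2) 0 ^+ 2.

Definition bump2 z : R := 24 * z ^+ 2 * Num.max (1 - z ^+ 2) 0 - 6 * Num.max (1 - z ^+ 2) 0 ^+ 2.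

Lemma is_derive_bump z : is_derive z (1 : R) (@cubic_bump R) (bump1 z).
Proof.
have d : is_derive z (1 : R) (fun u : R => 1 - u ^+ 2) (- (2 * z)).
  by apply: is_derive_eq; rewrite -![_ *: _]/(_ * _) /=; ring.
have := @is_derive1_comp _ (fun u => Num.max u 0 ^+ 3) (fun u : R => 1 - u ^+ 2) z _ _
  (is_derive_cube_pos (1 - z ^+ 2)) d.
by have -> : 3 * Num.max (1 - z ^+ 2) 0 ^+ 2 * - (2 * z) = bump1 z by rewrite /bump1; ring.
Qed.

Lemma is_derive_bump1 z : is_derive z (1 : R) bump1 (bump2 z).
Proof.
have d : is_derive z (1 : R) (fun u : R => 1 - u ^+ 2) (- (2 * z)).
  by apply: is_derive_eq; rewrite -![_ *: _]/(_ * _) /=; ring.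
have := @is_derive1_comp _ (fun u => Num.max u 0 ^+ 2) (fun u : R => 1 - u ^+ 2) z _ _
  (is_derive_sqr_pos (1 - z ^+ 2)) d => d2.
rewrite /bump1; apply: is_derive_eq; rewrite -![_ *: _]/(_ * _) /= /bump2 /cst/=; ring.
Qed.

Lemma bump2_continuous : continuous bump2.
Proof.
have cm : continuous (fun z : R => Num.max (1 - z ^+ 2) 0).
  have cq : continuous (fun z : R => 1 - z ^+ 2).
    by move=> z; apply: cvgB; [exact: cvg_cst|exact: exprn_continuous].
  have -> : (fun z : R => Num.max (1 - z ^+ 2) 0) = (fun z => (1 - z ^+ 2 + `|1 - z ^+ 2|) / 2).
    apply/funext => z; have [u0|u0] := leP (1 - z ^+ 2) 0; first by rewrite ler0_norm//; lra.
    by rewrite gtr0_norm//; lra.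
  move=> z; apply: cvgM; last exact: cvg_cst.
  apply: cvgD; first exact: cq.
  by apply: (@continuous_comp _ _ _ (fun z : R => 1 - z ^+ 2) (fun u : R => `|u|)); [exact: cq|exact: norm_continuous].
move=> z; apply: cvgB; apply: cvgM.
- by apply: cvgM; [exact: cvg_cst|exact: exprn_continuous].
- exact: cm.
- exact: cvg_cst.
by apply: (@continuous_comp _ _ _ (fun z : R => Num.max (1 - z ^+ 2) 0) (fun u : R => u ^+ 2)); [exact: cm|exact: exprn_continuous].
Qed.

Lemma bump_out z : 1 <= `|z| -> [/\ cubic_bump z = 0, bump1 z = 0 & bump2 z = 0].
Proof.
move=> z1; have z2 : 1 - z ^+ 2 <= 0.
  by rewrite subr_le0 -(real_normK (num_real z)) -{1}(expr1n _ 2) ler_sqr ?nnegrE.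
by rewrite /cubic_bump /bump1 /bump2 (max_idPr z2) !expr0n/= !mulr0 subr0.
Qed.

Lemma bump2_bound z : `|bump2 z| <= 6.
Proof.
have [z1|/ltW/bump_out[_ _ ->]] := leP `|z| 1; last by rewrite normr0.
have z2 : 0 <= 1 - z ^+ 2.
  by rewrite subr_ge0 -(real_normK (num_real z)) -{1}(expr1n _ 2) ler_sqr ?nnegrE.
rewrite /bump2 (max_idPl z2) ler_norml.
have := sqr_ge0 z; move: (z ^+ 2) z2 => u u1 u0.
have := sqr_ge0 (1 - u - 2 / 5); have := mulr_ge0 u0 u1; have := sqr_ge0 u.
by move=> ? ? ?; apply/andP; split; lra.
Qed.

Lemma bump1_0 : bump1 0 = 0.
Proof. by rewrite /bump1 mulr0 mul0r. Qed.

End bump.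

Section graph_curve.
Context {R : realType}.
Implicit Types (K C : set (R * R)) (p q b : R * R).

Lemma low_unique K (m n : R) p q : outer_normal K (m, -1) p -> outer_normal K (n, -1) q ->
  p.1 = q.1 -> p = q.
Proof.
move=> mp nq pq; apply: pair_ext => //.
have := outer_normal_low mp nq.1; have := outer_normal_low nq mp.1.
by rewrite pq subrr !mulr0 !addr0 => h1 h2; apply/eqP; rewrite eq_le h1 h2.
Qed.

Lemma slope_le K (m n : R) p q : outer_normal K (m, -1) p -> outer_normal K (n, -1) q ->
  p.1 < q.1 -> m <= n.
Proof.
move=> mp nq pq; have := outer_normal_low mp nq.1; have := outer_normal_low nq mp.1.
move=> h1 h2; have : (m - n) * (q.1 - p.1) <= 0 by move: h1 h2; lra.
by rewrite pmulr_lle0 ?subr_gt0// subr_le0.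
Qed.

Lemma boundary_opp K p : origin_symmetric K -> closed K -> boundary K p -> boundary K (- p).
Proof.
move=> sK cK /(boundary_closed _ cK)[Kp Ip]; apply/(boundary_closed _ cK); split; first exact: sK.
move=> /interiorP[e e0 He]; apply: Ip; apply/interiorP; exists e => // q q1 q2.
by rewrite -(opprK q); apply/sK/He => /=; rewrite opprK addrC distrC.
Qed.

(** Reflecting the parametrization lets the dent at the top be treated as a dent at the bottom. *)
Lemma curve_of_opp K L (x y x1 y1 x2 y2 : R -> R) : origin_symmetric K ->
  curve_of K L x y x1 y1 x2 y2 ->
  curve_of K L (fun t => - x t) (fun t => - y t) (fun t => - x1 t) (fun t => - y1 t)
    (fun t => - x2 t) (fun t => - y2 t).
Proof.
move=> sK [cD [dx dy dx1 dy1] [cx2 cy2] [L0 px py] [inj bd curv]].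
have clK : closed K by apply: compact_plane_closed; case: cD.
split; first exact: cD.
- by split=> t; exact: is_deriveN.
- by split=> t; apply: cvgN; [exact: cx2|exact: cy2].
- by split => // t; rewrite ?px ?py.
split.
- by move=> s t sL tL [/oppr_inj e1 /oppr_inj e2]; apply: inj => //=; rewrite e1 e2.
- apply/seteqP; split => p.
    move=> [t _ <-]; apply: (@boundary_opp _ (x t, y t)) => //.
    by rewrite -bd; exists t.
  move=> bp; have := boundary_opp sK clK bp; rewrite -bd => -[t _ E]; exists t => //.
  by rewrite -(opprK p) -E.
by move=> t; rewrite !mulrNN.
Qed.

Variables (C : set (R * R)) (b : R * R) (r l : R) (h s : R -> R).
Hypothesis r0 : 0 < r.
Hypothesis G1 : forall z, `|z| <= r -> outer_normal C (s z, -1) (b.1 + z, b.2 + h z).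
Hypothesis Gs : forall z w, `|z| <= r -> `|w| <= r -> z <= w -> l * (w - z) <= s w - s z.

Section param.
Variables (L : R) (x y x1 y1 x2 y2 : R -> R).
Hypothesis HC : curve_of C L x y x1 y1 x2 y2.

Lemma slope_outer_normal t : 0 < x1 t -> outer_normal C (y1 t / x1 t, -1) (x t, y t).
Proof.
move=> x0; have := @outer_normal_scale R C _ _ (x1 t)^-1 _ (curve_outer_normal HC t).
rewrite invr_gt0 => /(_ x0) /=.
by rewrite mulrN mulVf ?lt0r_neq0// mulrC.
Qed.

Lemma graph_of_curve t : 0 < x1 t -> `|x t - b.1| <= r ->
  y t = b.2 + h (x t - b.1) /\ y1 t = s (x t - b.1) * x1 t.
Proof.
move=> x0 zr; have zn := G1 zr; have tn := slope_outer_normal x0.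
have := low_unique tn zn; rewrite /= subrKC => /(_ erefl)[E]; split => //.
rewrite -E subrKC in zn; have u0 : ((s (x t - b.1), -1) : R * R) != 0.
  by apply/eqP => -[_ /eqP]; rewrite oppr_eq0 oner_eq0.
have [m m0 [e1 e2]] := curve_normal_unique HC u0 zn.
by rewrite e1 -mulrA mulrCA (_ : m * x1 t = 1) ?mulr1//; move: e2; lra.
Qed.

(** The bound [Gs] on increments of the slope becomes a bound at each single parameter: otherwise
    the slope would grow too slowly just after [t]. *)
Lemma curvature_of_curve t : 0 < x1 t -> `|x t - b.1| < r ->
  l * x1 t ^+ 3 <= x1 t * y2 t - y1 t * x2 t.
Proof.
have [_ [dx dy dx1 dy1] _ _ _] := HC.
move=> x0 zr; rewrite leNgt; apply/negP => lt.
pose f u := l * x u - slope x1 y1 u.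
have df : is_derive t (1 : R) f (l * x1 t - (x1 t * y2 t - y1 t * x2 t) / x1 t ^+ 2).
  have dm := is_derive_slope HC (lt0r_neq0 x0).
  by rewrite /f; apply: is_derive_eq; rewrite -![_ *: _]/(_ * _).
have [|e1 e10 H1] := derive_gt0_near df.
  by rewrite subr_gt0 ltr_pdivrMr ?exprn_gt0// -mulrA -exprS.
have [e2 e20 H2] := derive_gt0_near (dx t) x0.
have cx1 := is_derive_continuous dx1; have cx := is_derive_continuous dx.
have : \forall u \near t, 0 < x1 u /\ 0 < r - `|x u - b.1|.
  apply: filterS2 (cvgr_gt _ (cx1 t) _ x0) (cvgr_gt _ (_ : (fun u => r - `|x u - b.1|) @ t --> r - `|x t - b.1|) 0 _) => //=.
    by apply: cvgB; [exact: cvg_cst|apply: cvg_norm; apply: cvgB; [exact: cx|exact: cvg_cst]].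
  by rewrite subr_gt0.
move=> /nbhs_ballP[e3 /= e30 H3].
pose e := Num.min e1 (Num.min e2 e3) / 2.
have e0 : 0 < e by rewrite divr_gt0// !lt_min e10 e20 e30.
have elt : e < Num.min e1 (Num.min e2 e3).
  by rewrite ltr_pdivrMr// ltr_pMr ?ltr1n// !lt_min e10 e20 e30.
have /andP[l1 /andP[l2 l3]] : (e < e1) && ((e < e2) && (e < e3)) by move: elt; rewrite !lt_min.
have [A _] := H1 e (introT andP (conj e0 l1)).
have [B _] := H2 e (introT andP (conj e0 l2)).
have [|xe ze] := H3 (t + e).
  by rewrite /ball/= opprD addNKr normrN gtr0_norm.
rewrite subr_gt0 in ze.
have [_ q1] := graph_of_curve x0 (ltW zr); have [_ q2] := graph_of_curve xe (ltW ze).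
have := Gs (ltW zr) (ltW ze); rewrite lerD2r (ltW B) => /(_ isT).
move: A; rewrite /f /slope q1 q2 !mulfK ?lt0r_neq0// => A D.
by move: A D; lra.
Qed.

(** A vertical tangent is a supporting line, so it cannot separate the two ends of the window. *)
Lemma vertical_of_curve t : x1 t = 0 -> r <= `|x t - b.1|.
Proof.
have [_ _ _ _ [_ _ curv]] := HC.
move=> x0; rewrite leNgt; apply/negP => zr.
have R1 : `|r| <= r by rewrite gtr0_norm.
have R2 : `|- r| <= r by rewrite normrN gtr0_norm.
have := curve_ahead_le0 HC t (G1 R1).1; have := curve_ahead_le0 HC t (G1 R2).1.
rewrite /ahead x0 !mul0r !subr0/=; move: zr; rewrite ltr_norml => /andP[z1 z2].
move=> h1 h2; have := curv t; rewrite x0 mul0r sub0r oppr_gt0 => c.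
have y0 : y1 t != 0 by apply/eqP => y0; rewrite y0 mul0r ltxx in c.
have [yp|yn|ye] := ltgtP (y1 t) 0; last by rewrite ye eqxx in y0.
  by move: h1; rewrite nmulr_rle0//; lra.
by move: h2; rewrite pmulr_rle0//; lra.
Qed.

End param.

End graph_curve.

Lemma normal_slope (R : realType) (K : set (R * R)) (u p : R * R) :
  outer_normal K u p -> u.2 < 0 -> outer_normal K (- (u.1 / u.2), -1) p.
Proof.
move=> up u2; have u2' : 0 < - u.2^-1 by rewrite oppr_gt0 invr_lt0.
have -> : (- (u.1 / u.2), -1) = (- u.2^-1 * u.1, - u.2^-1 * u.2).
  by apply: pair_ext => /=; rewrite mulNr ?mulVf ?lt_eqF// mulrC.
exact: outer_normal_scale.
Qed.

Lemma continuous_near (R : realType) (f g : R -> R) (t : R) : (\forall u \near t, f u = g u) ->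
  {for t, continuous g} -> {for t, continuous f}.
Proof.
move=> fg cg; have E : f t = g t by exact: (nbhs_singleton fg).
change (f @ t --> f t); rewrite E.
by apply: cvg_trans cg; apply: near_eq_cvg; apply: filterS fg.
Qed.

(** * The modified disk and its parametrization *)

Section modification.
Context {R : realType}.
Implicit Types (p q : R * R) (z w : R).
Variables (C : set (R * R)) (L : R) (x y x1 y1 x2 y2 : R -> R).
Hypothesis HC : curve_of C L x y x1 y1 x2 y2.
Hypothesis sC : origin_symmetric C.
Variables (b : R * R) (r l d kap : R) (h s phi phi1 phi2 : R -> R).
Hypothesis r0 : 0 < r.
Hypothesis G1 : forall z, `|z| <= r -> outer_normal C (s z, -1) (b.1 + z, b.2 + h z).
Hypothesis Gs : forall z w, `|z| <= r -> `|w| <= r -> z <= w -> l * (w - z) <= s w - s z.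
Hypothesis Gh : forall z w, `|z| <= r -> `|w| <= r ->
  l / 2 * (w - z) ^+ 2 <= h w - h z - s z * (w - z).
Hypothesis d0 : 0 < d.
Hypothesis dr : d < r.
Hypothesis kl : kap < l.
Hypothesis dphi : forall z, is_derive z (1 : R) phi (phi1 z).
Hypothesis dphi1 : forall z, is_derive z (1 : R) phi1 (phi2 z).
Hypothesis cphi2 : continuous phi2.
Hypothesis phi_le0 : forall z, phi z <= 0.
Hypothesis phi_out : forall z, d <= `|z| -> [/\ phi z = 0, phi1 z = 0 & phi2 z = 0].
Hypothesis phi2_ge : forall z, - kap <= phi2 z.
Hypothesis s00 : s 0 = 0.
Hypothesis phi10 : phi1 0 = 0.

Let HCo := curve_of_opp sC HC.

Definition mod_height z := h z + phi z.
Definition mod_slope z := s z + phi1 z.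
Definition above_tangent z q :=
  b.2 + mod_height z + mod_slope z * (q.1 - b.1 - z) <= q.2.

Definition unmodified p := forall z, `|z| < r ->
  p <> (b.1 + z, b.2 + h z) /\ - p <> (b.1 + z, b.2 + h z).

(* Only the tangents at the points lying over the two windows are replaced. *)
Definition modified : set (R * R) := [set q |
  (forall u p, outer_normal C u p -> unmodified p -> dot u q <= dot u p) /\
  forall z, `|z| < r -> above_tangent z q /\ above_tangent z (- q)].

Lemma phi1_mono z w : z <= w -> - kap * (w - z) <= phi1 w - phi1 z.
Proof.
move=> zw; have := @is_derive_le R (fun u => phi1 u + kap * u) (fun u => phi2 u + kap) z w zw.
have h1 : forall u, z <= u <= w -> is_derive u (1 : R) (fun u => phi1 u + kap * u) (phi2 u + kap).
  by move=> u _; apply: is_derive_eq; rewrite -![_ *: _]/(_ * _) /cst; ring.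
move=> /(_ h1) k; have h2 : forall u, z <= u <= w -> 0 <= phi2 u + kap.
  by move=> u _; have := phi2_ge u; lra.
by move: (k h2); lra.
Qed.

Lemma mod_slope_mono z w : `|z| <= r -> `|w| <= r -> z <= w ->
  (l - kap) * (w - z) <= mod_slope w - mod_slope z.
Proof.
by move=> zr wr zw; have := Gs zr wr zw; have := phi1_mono zw; rewrite /mod_slope; lra.
Qed.

Lemma mod_height_convex z w : `|z| <= r -> `|w| <= r ->
  mod_height z + mod_slope z * (w - z) <= mod_height w.
Proof.
move=> zr wr; have := Gh zr wr.
have := @second_order R (fun u => phi u - phi1 z * (u - z)) (fun u => phi1 u - phi1 z) phi2
  (- kap) (`|w - z|) z w (subrr _).
have e1 : forall u, is_derive u (1 : R) (fun u => phi u - phi1 z * (u - z)) (phi1 u - phi1 z).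
  by move=> u; apply: is_derive_eq; rewrite -![_ *: _]/(_ * _) /cst; ring.
have e2 : forall u, is_derive u (1 : R) (fun u => phi1 u - phi1 z) (phi2 u).
  by move=> u; apply: is_derive_eq; rewrite subr0.
move=> /(_ e1 e2 (fun u _ => phi2_ge u) (lexx _)).
have k := kl; have q := sqr_ge0 (w - z).
have : 0 <= (l - kap) / 2 * (w - z) ^+ 2 by rewrite mulr_ge0// divr_ge0//; lra.
by rewrite subrr mulr0 subr0 /mod_height /mod_slope; lra.
Qed.

Lemma mod_out z : d <= `|z| -> mod_height z = h z /\ mod_slope z = s z.
Proof. by move=> /phi_out[e1 e2 _]; rewrite /mod_height /mod_slope e1 e2 !addr0. Qed.

(** The parameter and the abscissa are kept. The ordinate is moved by [phi] on the lower side, where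
    [x1] is positive, and by its reflection on the upper side; near vertical tangents [phi]
    vanishes, so the branches join smoothly. *)
Definition ymod t := if 0 < x1 t then y t + phi (x t - b.1) else y t - phi (- x t - b.1).
Definition ymod1 t := if 0 < x1 t then y1 t + phi1 (x t - b.1) * x1 t
  else y1 t + phi1 (- x t - b.1) * x1 t.
Definition ymod2 t :=
  if 0 < x1 t then y2 t + phi2 (x t - b.1) * x1 t ^+ 2 + phi1 (x t - b.1) * x2 t
  else y2 t - phi2 (- x t - b.1) * x1 t ^+ 2 + phi1 (- x t - b.1) * x2 t.

Definition lower_case t := 0 < x1 t /\ `|x t - b.1| < r.
Definition upper_case t := x1 t < 0 /\ `|- x t - b.1| < r.

Lemma lower_on t : lower_case t -> (x t, y t) = (b.1 + (x t - b.1), b.2 + h (x t - b.1)).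
Proof.
move=> [x0 zr]; have [e _] := graph_of_curve G1 HC x0 (ltW zr).
by rewrite subrKC -e.
Qed.

Lemma upper_on t : upper_case t ->
  - (x t, y t) = (b.1 + (- x t - b.1), b.2 + h (- x t - b.1)).
Proof.
move=> [x0 zr]; have x0' : 0 < - x1 t by rewrite oppr_gt0.
have [e _] := graph_of_curve G1 HCo x0' (ltW zr).
by rewrite subrKC -e.
Qed.

Lemma lower_ahead t q : lower_case t ->
  ahead x ymod x1 ymod1 q t <= 0 <-> above_tangent (x t - b.1) q.
Proof.
move=> [x0 zr]; have [e1 e2] := graph_of_curve G1 HC x0 (ltW zr).
have -> : ahead x ymod x1 ymod1 q t = x1 t * (b.2 + mod_height (x t - b.1) +
    mod_slope (x t - b.1) * (q.1 - b.1 - (x t - b.1)) - q.2).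
  by rewrite /ahead /ymod /ymod1 x0 e1 e2 /mod_height /mod_slope; ring.
by rewrite pmulr_rle0// subr_le0.
Qed.

Lemma upper_ahead t q : upper_case t ->
  ahead x ymod x1 ymod1 q t <= 0 <-> above_tangent (- x t - b.1) (- q).
Proof.
move=> [x0 zr]; have x0' : 0 < - x1 t by rewrite oppr_gt0.
have [e1 e2] := graph_of_curve G1 HCo x0' (ltW zr).
have -> : ahead x ymod x1 ymod1 q t = - x1 t * (b.2 + mod_height (- x t - b.1) +
    mod_slope (- x t - b.1) * (- q.1 - b.1 - (- x t - b.1)) - (- q.2)).
  have ey : y t = - (b.2 + h (- x t - b.1)) by rewrite -e1 opprK.
  have ey1 : y1 t = s (- x t - b.1) * x1 t by apply: oppr_inj; rewrite e2 mulrN.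
  by rewrite /ahead /ymod /ymod1 ltNge (ltW x0)/= ey ey1 /mod_height /mod_slope; ring.
by rewrite pmulr_rle0// subr_le0.
Qed.

Lemma window_normal_case z t : `|z| < r -> (x t, y t) = (b.1 + z, b.2 + h z) -> lower_case t.
Proof.
move=> zr E; have zn := G1 (ltW zr); rewrite -E in zn.
have u0 : ((s z, -1) : R * R) != 0 by apply/eqP => -[_ /eqP]; rewrite oppr_eq0 oner_eq0.
have [m m0 [_ e2]] := curve_normal_unique HC u0 zn.
case: E => ex _; split; last by rewrite ex addrAC subrr add0r.
by rewrite -(pmulr_rgt0 _ m0); move: e2; lra.
Qed.

Lemma window_normal_case_opp z t : `|z| < r -> - (x t, y t) = (b.1 + z, b.2 + h z) ->
  upper_case t.
Proof.
move=> zr E; have zn := G1 (ltW zr); rewrite -E in zn.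
have u0 : ((s z, -1) : R * R) != 0 by apply/eqP => -[_ /eqP]; rewrite oppr_eq0 oner_eq0.
have [m m0 [_ e2]] := curve_normal_unique HCo u0 zn.
case: E => ex _; split; last by rewrite ex addrAC subrr add0r.
by rewrite -oppr_gt0 -(pmulr_rgt0 _ m0); move: e2; lra.
Qed.

Lemma case_of t : [\/ lower_case t, upper_case t |
  [/\ unmodified (x t, y t), ymod t = y t & ymod1 t = y1 t]].
Proof.
have dr' := dr.
have P : ~ lower_case t -> ~ upper_case t -> unmodified (x t, y t).
  move=> nB nT z zr; split => E; first exact/nB/(window_normal_case zr E).
  exact/nT/(window_normal_case_opp zr E).
have out z : r <= `|z| -> phi z = 0 /\ phi1 z = 0.
  by move=> rz; have [|] := phi_out (z := z) => //; apply: le_trans rz; exact: ltW.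
have [xp|xn|xe] := ltgtP (x1 t) 0.
- have [zr|rz] := ltP `|- x t - b.1| r; first by apply: Or32.
  apply: Or33; have [e1 e2] := out _ rz; split.
  + apply: P => -[h1 h2]; first by rewrite ltNge (ltW xp) in h1.
    by rewrite ltNge rz in h2.
  + by rewrite /ymod ltNge (ltW xp)/= e1 subr0.
  by rewrite /ymod1 ltNge (ltW xp)/= e2 mul0r addr0.
- have [zr|rz] := ltP `|x t - b.1| r; first by apply: Or31.
  apply: Or33; have [e1 e2] := out _ rz; split.
  + apply: P => -[h1 h2]; last by rewrite ltNge (ltW xn) in h1.
    by rewrite ltNge rz in h2.
  + by rewrite /ymod xn e1 addr0.
  by rewrite /ymod1 xn e2 mul0r addr0.
have xe' : - x1 t = 0 by rewrite xe oppr0.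
have [e1 e2] := out _ (vertical_of_curve r0 G1 HCo xe').
apply: Or33; split.
- by apply: P => -[]; rewrite xe ltxx.
- by rewrite /ymod xe ltxx e1 subr0.
by rewrite /ymod1 xe ltxx e2 mul0r addr0.
Qed.

(** The set is also the intersection of the tangent half-planes of the new curve, a form from which
    convexity, closedness and the boundary are read off. *)
Lemma modifiedP q : modified q <-> forall t, ahead x ymod x1 ymod1 q t <= 0.
Proof.
have [cD _ _ _ [_ bd _]] := HC; have [Kc _ _] := cD.
split.
  move=> [Hp Hw] t; have [B|T|[P e1 e2]] := case_of t.
  - by apply/(lower_ahead q B); case: (Hw _ B.2).
  - by apply/(upper_ahead q T); case: (Hw _ T.2).
  by have := Hp _ _ (curve_outer_normal HC t) P; rewrite /ahead /dot/= e1 e2; lra.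
move=> H; split.
  move=> u p up np; have [->|u0] := eqVneq u 0; first by rewrite /dot !mul0r.
  have [t pE] := curve_boundary HC (normal_boundary Kc u0 up).
  rewrite pE in np up *; have [m m0 ->] := curve_normal_unique HC u0 up.
  have [B|T|[_ e1 e2]] := case_of t.
  - by case: (np _ B.2) => + _; rewrite -(lower_on B).
  - by case: (np _ T.2) => _; rewrite -(upper_on T).
  have : m * ahead x ymod x1 ymod1 q t <= 0 by rewrite pmulr_rle0.
  by rewrite /ahead /dot/= e1 e2; lra.
move=> z zr; have zn := G1 (ltW zr).
have u0 : ((s z, -1) : R * R) != 0 by apply/eqP => -[_ /eqP]; rewrite oppr_eq0 oner_eq0.
have bz := normal_boundary Kc u0 zn; split.
  have [t E] := curve_boundary HC bz.
  have B := window_normal_case zr (esym E).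
  have -> : z = x t - b.1 by case: E => <- _; rewrite addrAC subrr add0r.
  exact/(lower_ahead q B)/H.
have [t E] := curve_boundary HCo bz.
have T := window_normal_case_opp zr (esym E).
have -> : z = - x t - b.1 by case: E => <- _; rewrite addrAC subrr add0r.
exact/(upper_ahead q T)/H.
Qed.

Lemma modified_sym : origin_symmetric modified.
Proof.
move=> q [Hp Hw]; split.
  move=> u p up np.
  have up' : outer_normal C (- u) (- p).
    split; first exact/sC/up.1.
    by move=> z /sC/up.2; rewrite /dot/= !mulrNN; lra.
  have np' : unmodified (- p) by move=> z zr; rewrite opprK; have [h1 h2] := np z zr.
  by have := Hp _ _ up' np'; rewrite /dot/=; lra.
by move=> z /Hw[h1 h2]; rewrite opprK.
Qed.

(** The new tangents leave [C] above them. Over the dent this holds because the graph was only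
    lowered; beyond it the new tangent stays under the tangent at [d] or [- d], which is unchanged,
    because slopes increase. *)
Lemma above_tangent_sub q z : C q -> `|z| < r -> above_tangent z q.
Proof.
have d0' := d0; have dr' := dr; have b0 := phi_le0.
have dn : `|d| <= r by rewrite gtr0_norm// ltW.
have dn' : `|- d| <= r by rewrite normrN.
have dd : d <= `|d| by rewrite ler_norm.
have dd' : d <= `|- d| by rewrite normrN ler_norm.
move=> Cq zr; rewrite /above_tangent; have [dz|zd] := leP d `|z|.
  have [-> ->] := mod_out dz.
  by have := outer_normal_low (G1 (ltW zr)) Cq; rewrite /= opprD !addrA.
set w := q.1 - b.1; have qE : q.1 = b.1 + w by rewrite /w subrKC.
move: zd; rewrite ltr_norml => /andP[z1 z2].
have [wd|dw] := leP w d; last first.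
  have [e1 e2] := mod_out dd.
  have := outer_normal_low (G1 dn) Cq; rewrite /= qE.
  have := mod_height_convex (ltW zr) dn; rewrite e1 => k1.
  have := mod_slope_mono (ltW zr) dn (ltW z2); rewrite e2 => k2.
  have k3 : 0 <= (l - kap) * (d - z) by rewrite mulr_ge0// subr_ge0 ltW.
  have k4 : 0 <= (s d - mod_slope z) * (w - d).
    by rewrite mulr_ge0// subr_ge0; [move: k2 k3; lra|exact: ltW].
  by move: k1 k4; lra.
have [dw|wd'] := leP (- d) w; last first.
  have [e1 e2] := mod_out dd'.
  have := outer_normal_low (G1 dn') Cq; rewrite /= qE.
  have := mod_height_convex (ltW zr) dn'; rewrite e1 => k1.
  have := mod_slope_mono dn' (ltW zr) (ltW z1); rewrite e2 => k2.
  have k3 : 0 <= (l - kap) * (z - - d) by rewrite mulr_ge0// subr_ge0 ltW.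
  have k4 : 0 <= (s (- d) - mod_slope z) * (w - - d).
    by rewrite mulr_le0// subr_le0; [move: k2 k3; lra|exact: ltW].
  by move: k1 k4; lra.
have wr : `|w| <= r by rewrite ler_norml; apply/andP; split; lra.
have := mod_height_convex (ltW zr) wr.
have := outer_normal_low (G1 wr) Cq; rewrite /= qE subrr mulr0 addr0.
by have := b0 w; rewrite [mod_height w]/mod_height; lra.
Qed.

Lemma sub_modified : C `<=` modified.
Proof.
move=> q Cq; split; first by move=> u p [_ up] _; exact: up.
by move=> z zr; split; apply: above_tangent_sub => //; exact: sC.
Qed.

(** Conversely, the new graph meets all the constraints. A kept tangent with downward normal touches
    outside the window, so over the dent it lies under the tangent at [d] or [- d], which the convex
    new graph dominates; for the other normals, lowering a point only helps. *)
Lemma window_modified w : `|w| < r -> modified (b.1 + w, b.2 + mod_height w).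
Proof.
have d0' := d0; have dr' := dr; have b0 := phi_le0.
have dn : `|d| <= r by rewrite gtr0_norm// ltW.
have dn' : `|- d| <= r by rewrite normrN.
have dd : d <= `|d| by rewrite ler_norm.
have dd' : d <= `|- d| by rewrite normrN ler_norm.
move=> wr; have Cw := (G1 (ltW wr)).1.
have [dw|wd] := leP d `|w|.
  by have [-> _] := mod_out dw; exact: sub_modified.
split; last first.
  move=> z zr; split.
    have := mod_height_convex (ltW zr) (ltW wr); rewrite /above_tangent/=.
    by lra.
  have := above_tangent_sub (sC Cw) zr; rewrite /above_tangent/=.
  by have := b0 w; rewrite [mod_height w]/mod_height; lra.
move=> u p up np.
have [u2|u2] := leP 0 u.2.
  have := up.2 _ Cw; rewrite /dot/= [mod_height w]/mod_height.
  by have := mulr_ge0_le0 u2 (b0 w); lra.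
pose m := - (u.1 / u.2).
have mp : outer_normal C (m, -1) p by exact: normal_slope.
have -> : u = ((- u.2) * m, - u.2 * -1).
  by apply: pair_ext => /=; rewrite /m ?mulrNN ?mulr1// mulrC divfK// lt_eqF.
suff : p.2 + m * (b.1 + w - p.1) <= b.2 + mod_height w.
  have nu2 : 0 <= - u.2 by rewrite oppr_ge0 ltW.
  move=> k; rewrite -subr_ge0 /dot/=.
  have : 0 <= - u.2 * (b.2 + mod_height w - (p.2 + m * (b.1 + w - p.1))).
    by rewrite mulr_ge0// subr_ge0.
  by lra.
move: wd; rewrite ltr_norml => /andP[w1 w2].
have rp : r <= `|p.1 - b.1|.
  rewrite leNgt; apply/negP => pr; have [+ _] := np _ pr; apply.
  by apply: low_unique mp (G1 (ltW pr)) _; rewrite /= subrKC.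
have [pb|pb] := leP 0 (p.1 - b.1).
  rewrite ger0_norm// in rp; have [e1 e2] := mod_out dd.
  have ms : s d <= m by apply: slope_le (G1 dn) mp _; rewrite /=; lra.
  have := mod_height_convex dn (ltW wr); rewrite e1 e2 => k1.
  have := outer_normal_low mp (G1 dn).1; rewrite /= => k2.
  have : 0 <= (m - s d) * (d - w) by rewrite mulr_ge0// subr_ge0// ltW.
  by move: k1 k2; lra.
rewrite ltr0_norm// in rp; have [e1 e2] := mod_out dd'.
have ms : m <= s (- d) by apply: slope_le mp (G1 dn') _; rewrite /=; lra.
have := mod_height_convex dn' (ltW wr); rewrite e1 e2 => k1.
have := outer_normal_low mp (G1 dn').1; rewrite /= => k2.
have : 0 <= (s (- d) - m) * (w - - d) by rewrite mulr_ge0// subr_ge0// ltW.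
by move: k1 k2; lra.
Qed.

Lemma modified_normal z : `|z| < r ->
  outer_normal modified (mod_slope z, -1) (b.1 + z, b.2 + mod_height z).
Proof.
move=> zr; apply: low_outer_normal; first exact: window_modified.
by move=> q [_ /(_ z zr)[+ _]]; rewrite /above_tangent/= opprD !addrA.
Qed.

Lemma curve_modified t : modified (x t, ymod t).
Proof.
have [B|T|[_ -> _]] := case_of t; last first.
- apply: sub_modified; have [[Kc _ _] _ _ _ [_ bd _]] := HC.
  suff : boundary C (x t, y t) by case/(boundary_closed _ (compact_plane_closed Kc)).
  by rewrite -bd; exists t.
- rewrite -(opprK (x t, ymod t)); apply: modified_sym.
  have := window_modified T.2; have [x0 zr] := T.
  have x0' : 0 < - x1 t by rewrite oppr_gt0.
  have [e1 e2] := graph_of_curve G1 HCo x0' (ltW zr).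
  congr modified; apply: pair_ext; rewrite /= ?subrKC//.
  by rewrite /ymod ltNge (ltW x0)/= /mod_height; move: e1; lra.
have := window_modified B.2; have [x0 zr] := B.
have [e1 e2] := graph_of_curve G1 HC x0 (ltW zr).
by congr modified; apply: pair_ext; rewrite /= ?subrKC// /ymod x0 e1 addrA.
Qed.

Let dx : forall t, is_derive t (1 : R) x (x1 t). Proof. by case: HC => _ []. Qed.
Let dy : forall t, is_derive t (1 : R) y (y1 t). Proof. by case: HC => _ []. Qed.
Let dx1 : forall t, is_derive t (1 : R) x1 (x2 t). Proof. by case: HC => _ []. Qed.
Let dy1 : forall t, is_derive t (1 : R) y1 (y2 t). Proof. by case: HC => _ []. Qed.
Let cx2 : continuous x2. Proof. by case: HC => _ _ [] + _. Qed.
Let cy2 : continuous y2. Proof. by case: HC => _ _ [] _ +. Qed.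
Let L0 : 0 < L. Proof. by case: HC => _ _ _ []. Qed.
Let px : forall t, x (t + L) = x t. Proof. by case: HC => _ _ _ []. Qed.
Let py : forall t, y (t + L) = y t. Proof. by case: HC => _ _ _ []. Qed.
Let curv : forall t, 0 < x1 t * y2 t - y1 t * x2 t. Proof. by case: HC => _ _ _ _ []. Qed.
Let cx : continuous x. Proof. exact: is_derive_continuous dx. Qed.
Let cx1 : continuous x1. Proof. exact: is_derive_continuous dx1. Qed.

Lemma turning_near t : x1 t = 0 ->
  \forall u \near t, d <= `|x u - b.1| /\ d <= `|- x u - b.1|.
Proof.
move=> x0; have x0' : - x1 t = 0 by rewrite x0 oppr0.
have v1 := vertical_of_curve r0 G1 HC x0; have v2 := vertical_of_curve r0 G1 HCo x0'.
have c1 : (fun u => `|x u - b.1|) @ t --> `|x t - b.1|.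
  by apply: cvg_norm; apply: cvgB; [exact: cx|exact: cvg_cst].
have c2 : (fun u => `|- x u - b.1|) @ t --> `|- x t - b.1|.
  by apply: cvg_norm; apply: cvgB; [apply: cvgN; exact: cx|exact: cvg_cst].
by apply: filterS2 (cvgr_gt _ c1 _ (lt_le_trans dr v1)) (cvgr_gt _ c2 _ (lt_le_trans dr v2)) =>
  u /ltW ? /ltW.
Qed.

Lemma negative_near t : x1 t < 0 -> \forall u \near t, x1 u < 0.
Proof.
move=> xn; have xn' : 0 < - x1 t by rewrite oppr_gt0.
have c : x1 @ t --> x1 t by exact: cx1.
have k : \forall u \near t, 0 < - x1 u by apply: (cvgr_gt _ (cvgN c)).
by apply: filterS k => u; rewrite oppr_gt0.
Qed.

Lemma positive_near t : 0 < x1 t -> \forall u \near t, 0 < x1 u.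
Proof.
move=> xp; have c : x1 @ t --> x1 t by exact: cx1.
exact: cvgr_gt _ c _ xp.
Qed.

Lemma is_derive_comp_x (f f1 : R -> R) t : (forall z, is_derive z (1 : R) f (f1 z)) ->
  is_derive t (1 : R) (fun u => f (x u - b.1)) (f1 (x t - b.1) * x1 t) /\
  is_derive t (1 : R) (fun u => f (- x u - b.1)) (- (f1 (- x t - b.1) * x1 t)).
Proof.
have dx_ := dx; move=> df; split.
  have e : is_derive t (1 : R) (fun u => x u - b.1) (x1 t).
    by apply: is_derive_eq; rewrite subr0.
  exact: (@is_derive1_comp _ f (fun u => x u - b.1) t _ _ (df _) e).
have e : is_derive t (1 : R) (fun u => - x u - b.1) (- x1 t).
  by apply: is_derive_eq; rewrite subr0.
by have := @is_derive1_comp _ f (fun u => - x u - b.1) t _ _ (df _) e; rewrite mulrN.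
Qed.

Lemma is_derive_ymod t : is_derive t (1 : R) ymod (ymod1 t).
Proof.
have dy_ := dy; have [e1 e2] := is_derive_comp_x t dphi.
have [xn|xp|x0] := ltgtP (x1 t) 0.
- apply: (@is_derive_near _ _ (fun u => y u - phi (- x u - b.1))).
    by have k := negative_near xn; apply: filterS k => u xu; rewrite /ymod ltNge (ltW xu).
  by apply: is_derive_eq; rewrite /ymod1 ltNge (ltW xn)/= opprK.
- apply: (@is_derive_near _ _ (fun u => y u + phi (x u - b.1))).
    by have k := positive_near xp; apply: filterS k => u xu; rewrite /ymod xu.
  by apply: is_derive_eq; rewrite /ymod1 xp.
rewrite /ymod1 x0 ltxx mulr0 addr0.
apply: (@is_derive_near _ _ y) => //.
have k := turning_near x0; apply: filterS k => u [/phi_out[h1 _ _] /phi_out[h2 _ _]].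
by rewrite /ymod h1 h2 subr0 addr0 if_same.
Qed.

Lemma is_derive_ymod1 t : is_derive t (1 : R) ymod1 (ymod2 t).
Proof.
have dy1_ := dy1; have dx1_ := dx1; have [e1 e2] := is_derive_comp_x t dphi1.
have [xn|xp|x0] := ltgtP (x1 t) 0.
- apply: (@is_derive_near _ _ (fun u => y1 u + phi1 (- x u - b.1) * x1 u)).
    by have k := negative_near xn; apply: filterS k => u xu; rewrite /ymod1 ltNge (ltW xu).
  by apply: is_derive_eq; rewrite -![_ *: _]/(_ * _) /ymod2 ltNge (ltW xn)/=; ring.
- apply: (@is_derive_near _ _ (fun u => y1 u + phi1 (x u - b.1) * x1 u)).
    by have k := positive_near xp; apply: filterS k => u xu; rewrite /ymod1 xu.
  by apply: is_derive_eq; rewrite -![_ *: _]/(_ * _) /ymod2 xp/=; ring.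
have -> : ymod2 t = y2 t.
  have [_ /phi_out[_ h2 _]] := nbhs_singleton (turning_near x0).
  by rewrite /ymod2 x0 ltxx h2 expr0n/= mulr0 mul0r subr0 addr0.
apply: (@is_derive_near _ _ y1) => //.
have k := turning_near x0; apply: filterS k => u [/phi_out[_ h1 _] /phi_out[_ h2 _]].
by rewrite /ymod1 h1 h2 !mul0r addr0 if_same.
Qed.

Lemma ymod2_continuous : continuous ymod2.
Proof.
have cphi1 : continuous phi1 := is_derive_continuous dphi1.
have cc (f : R -> R) : continuous f -> continuous (fun u => f (x u - b.1)).
  move=> cf u; apply: (@continuous_comp _ _ _ (fun u => x u - b.1)); last exact: cf.
  by apply: cvgB; [exact: cx|exact: cvg_cst].
have cc' (f : R -> R) : continuous f -> continuous (fun u => f (- x u - b.1)).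
  move=> cf u; apply: (@continuous_comp _ _ _ (fun u => - x u - b.1)); last exact: cf.
  by apply: cvgB; [apply: cvgN; exact: cx|exact: cvg_cst].
have csq : continuous (fun u => x1 u ^+ 2).
  by move=> u; apply: (@continuous_comp _ _ _ x1 (fun u : R => u ^+ 2)); [exact: cx1|exact: exprn_continuous].
move=> t; have [xn|xp|x0] := ltgtP (x1 t) 0.
- apply: (@continuous_near _ _ (fun t => y2 t - phi2 (- x t - b.1) * x1 t ^+ 2 + phi1 (- x t - b.1) * x2 t)).
    by have k := negative_near xn; apply: filterS k => u xu; rewrite /ymod2 ltNge (ltW xu).
  apply: cvgD; [apply: cvgB|]; first exact: cy2.
    by apply: cvgM; [exact: (cc' _ cphi2 t)|exact: csq].
  by apply: cvgM; [exact: (cc' _ cphi1 t)|exact: cx2].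
- apply: (@continuous_near _ _ (fun t => y2 t + phi2 (x t - b.1) * x1 t ^+ 2 + phi1 (x t - b.1) * x2 t)).
    by have k := positive_near xp; apply: filterS k => u xu; rewrite /ymod2 xu.
  apply: cvgD; [apply: cvgD|]; first exact: cy2.
    by apply: cvgM; [exact: (cc _ cphi2 t)|exact: csq].
  by apply: cvgM; [exact: (cc _ cphi1 t)|exact: cx2].
apply: (@continuous_near _ _ y2); last exact: cy2.
have k := turning_near x0; apply: filterS k => u [/phi_out[_ h1 k1] /phi_out[_ h2 k2]].
by rewrite /ymod2 h1 h2 k1 k2 !mul0r subr0 !addr0 if_same.
Qed.

(** The perturbation adds [phi2] times the cube of the absolute value of [x1] to the numerator, and
    [kap < l] keeps the sum positive. *)
Lemma curvature_modified t : 0 < x1 t * ymod2 t - ymod1 t * x2 t.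
Proof.
have kl' := kl; have dr' := dr; have c := curv t.
have [xn|xp|x0] := ltgtP (x1 t) 0.
- have -> : x1 t * ymod2 t - ymod1 t * x2 t =
      x1 t * y2 t - y1 t * x2 t + phi2 (- x t - b.1) * (- x1 t) ^+ 3.
    by rewrite /ymod2 /ymod1 ltNge (ltW xn)/=; ring.
  have xn' : 0 < - x1 t by rewrite oppr_gt0.
  have [zr|rz] := ltP `|- x t - b.1| r; last first.
    have [|_ _ ->] := phi_out (z := - x t - b.1); last by rewrite mul0r addr0.
    by apply: le_trans rz; exact: ltW.
  have := curvature_of_curve G1 Gs HCo xn' zr; rewrite !mulrNN => k1.
  have x3 : 0 < (- x1 t) ^+ 3 by rewrite exprn_gt0.
  have k2 : - kap * (- x1 t) ^+ 3 <= phi2 (- x t - b.1) * (- x1 t) ^+ 3.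
    by rewrite ler_pM2r// phi2_ge.
  have k3 : 0 < (l - kap) * (- x1 t) ^+ 3 by rewrite mulr_gt0// subr_gt0.
  by move: ((- x1 t) ^+ 3) k1 k2 k3 => X; lra.
- have -> : x1 t * ymod2 t - ymod1 t * x2 t =
      x1 t * y2 t - y1 t * x2 t + phi2 (x t - b.1) * x1 t ^+ 3.
    by rewrite /ymod2 /ymod1 xp/=; ring.
  have [zr|rz] := ltP `|x t - b.1| r; last first.
    have [|_ _ ->] := phi_out (z := x t - b.1); last by rewrite mul0r addr0.
    by apply: le_trans rz; exact: ltW.
  have k1 := curvature_of_curve G1 Gs HC xp zr.
  have x3 : 0 < x1 t ^+ 3 by rewrite exprn_gt0.
  have k2 : - kap * x1 t ^+ 3 <= phi2 (x t - b.1) * x1 t ^+ 3.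
    by rewrite ler_pM2r// phi2_ge.
  have k3 : 0 < (l - kap) * x1 t ^+ 3 by rewrite mulr_gt0// subr_gt0.
  by move: (x1 t ^+ 3) k1 k2 k3 => X; lra.
by move: c; rewrite /ymod1 x0 ltxx !mul0r mulr0 addr0.
Qed.

Lemma modified_cvx : cvx modified.
Proof.
move=> p q t /modifiedP Hp /modifiedP Hq /andP[t0 t1]; apply/modifiedP => u.
have u1 : 0 <= 1 - t by rewrite subr_ge0.
have := mulr_ge0_le0 u1 (Hp u); have := mulr_ge0_le0 t0 (Hq u).
by rewrite /ahead/=; lra.
Qed.

Lemma modified_closed : closed modified.
Proof.
have -> : modified = \bigcap_t [set q : R * R |
    ymod1 t * q.1 + - x1 t * q.2 + (x1 t * ymod t - ymod1 t * x t) <= 0].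
  apply/seteqP; split => q.
    by move=> /modifiedP H t _; have := H t; rewrite /ahead/=; lra.
  by move=> H; apply/modifiedP => t; have := H t Logic.I; rewrite /ahead/=; lra.
by apply: closed_bigI => t _; exact: closed_affine.
Qed.

(** The normals [(1, 0)] and [(-1, 0)] belong to points with vertical tangents, which are unmodified
    and bound the abscissa; the horizontal tangent at [z = 0] and its reflection bound the
    ordinate. *)
Lemma modified_compact : compact modified.
Proof.
have [[Kc _ [z /interior_subset Cz]] _ _ _ _] := HC.
have hor (e : R) : e != 0 -> exists c : R, forall q, modified q -> e * q.1 <= c.
  move=> e0; have [p Hp] := @normal_exists R C (e, 0) Kc (ex_intro _ z Cz).
  have u0 : ((e, 0) : R * R) != 0 by apply: contra e0 => /eqP[->].
  have [t pE] := curve_boundary HC (normal_boundary Kc u0 Hp).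
  rewrite pE in Hp; have [m m0 [_ /eqP]] := curve_normal_unique HC u0 Hp.
  rewrite eq_sym oppr_eq0 mulf_eq0 gt_eqF//= => /eqP x10.
  exists (e * x t) => q [Hq _]; have := Hq _ _ Hp; rewrite /dot/= !mul0r !addr0; apply.
  move=> w wr; split => E.
    by have [] := window_normal_case wr E; rewrite x10 ltxx.
  by have [] := window_normal_case_opp wr E; rewrite x10 ltxx.
have [|c1 H1] := hor 1; first exact: oner_neq0.
have [|c2 H2] := hor (-1); first by rewrite oppr_eq0 oner_neq0.
pose c := b.2 + mod_height 0.
apply: (@subclosed_compact _ _ ((`[- c2, c1] : set R) `*` (`[c, - c] : set R))).
- exact: modified_closed.
- by apply: compact_setX; exact: segment_compact.
have z0 : `|0 : R| < r by rewrite normr0.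
have st0 : mod_slope 0 = 0 by rewrite /mod_slope s00 phi10 addr0.
move=> q mq; have [h1 h2] := mq.2 0 z0; move: h1 h2.
rewrite /above_tangent st0 !mul0r !addr0 -/c /= => h1 h2.
have := H1 _ mq; have := H2 _ mq; rewrite mul1r mulN1r => k1 k2.
by split; rewrite /= in_itv/=; apply/andP; split; lra.
Qed.

Lemma ymod_periodic t : ymod (t + L) = ymod t.
Proof. by rewrite /ymod px py (periodic_derive px dx). Qed.

(** If a boundary point were on no tangent, the maximum of [ahead] over a period would be negative,
    and a whole neighbourhood of the point would satisfy the inequalities of [modifiedP]. *)
Lemma modified_boundary : range (fun t => (x t, ymod t)) = boundary modified.
Proof.
have cv := curvature_modified; have d1 := is_derive_ymod; have d2 := is_derive_ymod1.
apply/seteqP; split => p.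
  move=> [t _ <-]; apply: (@normal_boundary _ _ modified_compact (ymod1 t, - x1 t)).
    apply/eqP => -[e1 /eqP]; rewrite oppr_eq0 => /eqP e2.
    by have := cv t; rewrite e1 e2 !mul0r subrr ltxx.
  split; first exact: curve_modified.
  by move=> q /modifiedP/(_ t); rewrite /ahead /dot/=; lra.
move=> bp; have [mp ip] := (boundary_closed _ modified_closed).1 bp.
have H := (modifiedP p).1 mp.
pose f t := ahead x ymod x1 ymod1 p t.
have cf : continuous f := is_derive_continuous (is_derive_ahead dx d1 dx1 d2 p).
have [||c _ Hc] := @EVT_max R f 0 L; [exact: ltW|exact: continuous_subspaceT|].
have [E|ne] := eqVneq (f c) 0; first by exists c => //; rewrite (touch dx d1 dx1 d2 cv H E).
have fc : f c < 0 by rewrite lt_neqAle ne H.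
have pymod1 := periodic_derive ymod_periodic d1.
have px1 := periodic_derive px dx.
have pf t : f (t + L) = f t by rewrite /f /ahead px ymod_periodic px1 pymod1.
have ball t : f t <= f c.
  have [k /andP[k0 kL]] := periodic_reduce t L0.
  by rewrite -(periodic_int t k pf); apply: Hc; rewrite in_itv/= k0 ltW.
have [M1 M10 B1] := periodic_bounded L0 px1 cx1.
have [M2 M20 B2] := periodic_bounded L0 pymod1 (is_derive_continuous d2).
exfalso; apply: ip; apply/interiorP; exists (- f c / (M1 + M2)).
  by rewrite divr_gt0 ?oppr_gt0// addr_gt0.
move=> q q1 q2; apply/modifiedP => t.
set e := - f c / (M1 + M2) in q1 q2.
have -> : ahead x ymod x1 ymod1 q t = f t + (ymod1 t * (q.1 - p.1) - x1 t * (q.2 - p.2)).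
  by rewrite /f /ahead; ring.
have eE : e * (M1 + M2) = - f c by rewrite /e divfK// gt_eqF// addr_gt0.
have e0 : 0 <= e by rewrite divr_ge0 ?oppr_ge0 ?addr_ge0// ltW.
have k1 : ymod1 t * (q.1 - p.1) <= M2 * e.
  by apply: (le_trans (ler_norm _)); rewrite normrM ler_pM// ltW.
have k2 : - (x1 t * (q.2 - p.2)) <= M1 * e.
  by apply: (le_trans (ler_norm _)); rewrite normrN normrM ler_pM// ltW.
by have := ball t; move: k1 k2 eE; lra.
Qed.

Lemma modified_disk : convex_disk modified.
Proof.
have [[_ _ [z Cz]] _ _ _ _] := HC.
split; [exact: modified_compact|by apply/cvxP; exact: modified_cvx|].
by exists z; apply: interiorS Cz; exact: sub_modified.
Qed.

Lemma modified_curve : curve_of modified L x ymod x1 ymod1 x2 ymod2.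
Proof.
have cv := curvature_modified; have d1 := is_derive_ymod; have d2 := is_derive_ymod1.
have [_ _ intm] := modified_disk; have [_ _ _ _ [inj _ _]] := HC.
split; [exact: modified_disk|by split| |by split => //; exact: ymod_periodic|].
  by split; [exact: cx2|exact: ymod2_continuous].
split; [|exact: modified_boundary|exact: cv].
have onK t : boundary modified (x t, ymod t) by rewrite -modified_boundary; exists t.
move=> u t uL tL [ex ey]; apply: inj => //=.
(* Equal points have the same normal, hence the same sign of [x1] and the same branch of [ymod], so
   the old ordinates agree too. *)
suff : y u = y t by rewrite ex => ->.
have u0 : ((ymod1 u, - x1 u) : R * R) != 0.
  apply/eqP => -[e1 /eqP]; rewrite oppr_eq0 => /eqP e2.
  by have := cv u; rewrite e1 e2 !mul0r subrr ltxx.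
have nu : outer_normal modified (ymod1 u, - x1 u) (x t, ymod t).
  rewrite -ex -ey; split; first exact: curve_modified.
  by move=> q /modifiedP/(_ u); rewrite /ahead /dot/=; lra.
have [m m0 [_ /oppr_inj em]] := normal_unique dx d1 dx1 d2 cv modified_cvx modified_compact onK intm u0 nu.
move: ey; rewrite /ymod em pmulr_rgt0// ex; case: ifP => _; first exact: addIr.
by move=> e; apply: addIr e.
Qed.

End modification.

(** * Perimeter distance to the dented disk *)

Section transfer.
Context {R : realType}.
Implicit Types (K : set (R * R)) (p q b : R * R) (z w r l k mu d : R).

(** Strict convexity and differentiability without a parametrization: a normal determines its point,
    and a point its normal up to scaling. *)
Definition smooth K :=
  (forall u p q, u != 0 -> outer_normal K u p -> outer_normal K u q -> p = q) /\
  forall u v p, u != 0 -> v != 0 -> outer_normal K u p -> outer_normal K v p ->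
    exists2 c : R, 0 < c & v = (c * u.1, c * u.2).

Lemma curve_smooth K L (x y x1 y1 x2 y2 : R -> R) : curve_of K L x y x1 y1 x2 y2 -> smooth K.
Proof.
move=> HC; split; first exact: curve_normal_point HC.
move=> u v p u0 v0 up vp; have Kc : compact K by case: HC => -[].
have [t pE] := curve_boundary HC (normal_boundary Kc u0 up).
rewrite pE in up vp; have [m m0 ->] := curve_normal_unique HC u0 up.
have [n n0 ->] := curve_normal_unique HC v0 vp.
exists (n / m); first exact: divr_gt0.
by apply: pair_ext; rewrite /= ?mulrN mulrA divfK// lt0r_neq0.
Qed.

Lemma slope_neq0 (m : R) : ((m, -1) : R * R) != 0.
Proof. by apply/eqP => -[_ /eqP]; rewrite oppr_eq0 oner_eq0. Qed.

Lemma smooth_slope K (m n : R) p : smooth K -> outer_normal K (m, -1) p ->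
  outer_normal K (n, -1) p -> m = n.
Proof.
move=> [_ sm] mp np; have [c c0 [e1 e2]] := sm _ _ _ (slope_neq0 m) (slope_neq0 n) mp np.
by rewrite e1 (_ : c = 1) ?mul1r//; move: e2; lra.
Qed.

(* Over ]b.1 - r, b.1 + r[ the lower boundary of [K] is the graph of
   [b.2 + h (_ - b.1)], with derivative [s (_ - b.1)]. *)
Definition window K b r l k mu (h s : R -> R) := [/\
  forall z, `|z| < r -> outer_normal K (s z, -1) (b.1 + z, b.2 + h z),
  forall z w, `|z| < r -> `|w| < r -> z <= w -> l * (w - z) <= s w - s z <= k * (w - z)
  & forall z, `|z| < r -> `|s z| <= mu].

Lemma window_lipschitz K b r l k mu h s z w : window K b r l k mu h s ->
  `|z| < r -> `|w| < r -> `|h w - h z| <= mu * `|w - z|.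
Proof.
move=> [W _ B] zr wr.
have := outer_normal_low (W _ zr) (W _ wr).1; have := outer_normal_low (W _ wr) (W _ zr).1.
rewrite /= => h1 h2.
have k1 : - (mu * `|w - z|) <= s z * (w - z).
  have : `|s z * (w - z)| <= mu * `|w - z| by rewrite normrM ler_wpM2r// B.
  by rewrite ler_norml => /andP[].
have k2 : s w * (w - z) <= mu * `|w - z|.
  by apply: (le_trans (ler_norm _)); rewrite normrM ler_wpM2r// B.
by rewrite ler_norml; apply/andP; split; move: h1 h2 k1 k2; lra.
Qed.

(** As [q] lies below points of [K] on both of its sides, a normal at [q] with nonnegative second
    coordinate would have to vanish. *)
Lemma low_normal K v q p1 p2 : v != 0 -> outer_normal K v q -> K p1 -> K p2 ->
  p1.1 < q.1 -> q.1 < p2.1 -> q.2 < p1.2 -> q.2 < p2.2 -> v.2 < 0.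
Proof.
move=> v0 [_ vq] /vq h1 /vq h2 a1 a2 c1 c2; rewrite ltNge; apply/negP => v2.
move: h1 h2; rewrite /dot => h1 h2.
have k1 : 0 <= v.2 * (p1.2 - q.2) by rewrite mulr_ge0// subr_ge0 ltW.
have k2 : 0 <= v.2 * (p2.2 - q.2) by rewrite mulr_ge0// subr_ge0 ltW.
have v1 : v.1 = 0.
  apply/eqP; rewrite eq_le; apply/andP; split.
    have : v.1 * (p2.1 - q.1) <= 0 by move: h2 k2; lra.
    by rewrite pmulr_lle0// subr_gt0.
  have : 0 <= v.1 * (q.1 - p1.1) by move: h1 k1; lra.
  by rewrite pmulr_lge0// subr_gt0.
have v20 : v.2 = 0.
  apply/eqP; rewrite eq_le v2 andbT.
  have : v.2 * (p1.2 - q.2) <= 0 by rewrite v1 in h1; move: h1; lra.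
  by rewrite pmulr_lle0// subr_gt0.
by move/eqP: v0; apply; apply: pair_ext.
Qed.

Definition cap b d (h1 h2 : R -> R) p p' := exists z w, [/\ `|z| <= d, `|w| <= d,
  p = (b.1 + z, b.2 + h1 z) & p' = (b.1 + w, b.2 + h2 w)].

Section one_way.
Variables (K1 K2 : set (R * R)) (b : R * R) (r l k mu d e : R) (h1 s1 h2 s2 : R -> R).
Hypotheses (sm1 : smooth K1) (sm2 : smooth K2).
Hypotheses (sy1 : origin_symmetric K1) (sy2 : origin_symmetric K2).
Hypotheses (W1 : window K1 b r l k mu h1 s1) (W2 : window K2 b r l k mu h2 s2).
Hypotheses (l0 : 0 < l) (lk : l <= k) (mu0 : 0 <= mu) (d0 : 0 < d) (dr : 2 * d < r).
Hypotheses (e0 : 0 < e) (ed : e < d).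
Hypothesis agree : forall z, d <= `|z| -> h1 z = h2 z /\ s1 z = s2 z.
Hypothesis gap : forall z, `|z| <= d -> h1 z + e < h1 (2 * d) /\ h1 z + e < h1 (- (2 * d)).
Hypothesis dicho : forall u p p', u != 0 -> outer_normal K1 u p -> outer_normal K2 u p' ->
  [\/ p = p', cap b d h1 h2 p p' | cap b d h1 h2 (- p) (- p')].

Lemma window_transfer w v q' : `|w| < r -> v != 0 ->
  outer_normal K1 v (b.1 + w, b.2 + h1 w) -> outer_normal K2 v q' ->
  exists w', [/\ `|w'| < r, q' = (b.1 + w', b.2 + h2 w') & s1 w = s2 w'].
Proof.
have d0' := d0; have dr' := dr.
have [N1 S1 _] := W1; have [N2 S2 _] := W2.
move=> wr v0 vq vq'.
have [c c0 E] := sm1.2 _ _ _ v0 (slope_neq0 (s1 w)) vq (N1 _ wr).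
have mq' : outer_normal K2 (s1 w, -1) q' by rewrite E; exact: outer_normal_scale.
have [dw|wd] := leP d `|w|.
  have [e1 e2] := agree dw; exists w; split => //.
  by apply: sm2.1 (slope_neq0 (s1 w)) mq' _; rewrite e2; exact: N2.
have dr1 : `|d| < r by rewrite gtr0_norm//; lra.
have dr2 : `|- d| < r by rewrite normrN.
have [a1 a2] : h1 d = h2 d /\ s1 d = s2 d by apply: agree; exact: ler_norm.
have [a3 a4] : h1 (- d) = h2 (- d) /\ s1 (- d) = s2 (- d).
  by apply: agree; rewrite normrN; exact: ler_norm.
move: wd; rewrite ltr_norml => /andP[w1 w2].
have b1 : q'.1 - b.1 <= d.
  rewrite leNgt; apply/negP => lt.
  have : s2 d <= s1 w by apply: slope_le (N2 _ dr1) mq' _; rewrite /=; lra.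
  have /andP[+ _] := S1 _ _ wr dr1 (ltW w2); rewrite a2 => t1 t2.
  have : 0 < l * (d - w) by rewrite mulr_gt0// subr_gt0.
  by move: t1 t2; lra.
have b2 : - d <= q'.1 - b.1.
  rewrite leNgt; apply/negP => lt.
  have : s1 w <= s2 (- d) by apply: slope_le mq' (N2 _ dr2) _; rewrite /=; lra.
  have /andP[+ _] := S1 _ _ dr2 wr (ltW w1); rewrite a4 => t1 t2.
  have : 0 < l * (w - - d) by rewrite mulr_gt0// subr_gt0.
  by move: t1 t2; lra.
have w'r : `|q'.1 - b.1| < r by rewrite ltr_norml; apply/andP; split; lra.
have q'E := low_unique mq' (N2 _ w'r); rewrite /= subrKC in q'E.
exists (q'.1 - b.1); split => //; first by rewrite subrKC; exact: q'E.
have q'E' : q' = (b.1 + (q'.1 - b.1), b.2 + h2 (q'.1 - b.1)) by rewrite subrKC; exact: q'E.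
by apply: smooth_slope sm2 mq' _; rewrite {2}q'E'; exact: N2.
Qed.

(** Both slopes grow at rates between [l] and [k], so passing to the points of equal slope stretches
    horizontal distances by at most [k / l]; the factor [1 + mu] accounts for the heights. *)
Lemma window_dist z w z' w' : `|z| < r -> `|w| < r -> `|z'| < r -> `|w'| < r ->
  s1 z = s2 z' -> s1 w = s2 w' ->
  dist (b.1 + z', b.2 + h2 z') (b.1 + w', b.2 + h2 w') <=
  (1 + mu) * (k / l) * dist (b.1 + z, b.2 + h1 z) (b.1 + w, b.2 + h1 w).
Proof.
have [N1 S1 _] := W1; have [N2 S2 _] := W2; have mu0' := mu0.
move=> zr wr z'r w'r ez ew.
have k0 : 0 < k by apply: lt_le_trans lk.
have key (a c a' c' : R) : `|a| < r -> `|c| < r -> `|a'| < r -> `|c'| < r ->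
    s1 a = s2 a' -> s1 c = s2 c' -> a <= c -> `|a' - c'| <= k / l * `|a - c|.
  move=> ar cr a'r c'r ea ec ac; have /andP[t0 t1] := S1 _ _ ar cr ac.
  have l1 : 0 <= l * (c - a) by rewrite mulr_ge0 ?subr_ge0// ltW.
  have a'c' : a' <= c'.
    rewrite leNgt; apply/negP => lt; have /andP[t2 _] := S2 _ _ c'r a'r (ltW lt).
    have : 0 < l * (a' - c') by rewrite mulr_gt0// subr_gt0.
    by move: t0 t2 l1; rewrite ea ec; lra.
  have /andP[t2 _] := S2 _ _ a'r c'r a'c'.
  rewrite distrC (ger0_norm (_ : 0 <= c' - a')) ?subr_ge0//.
  rewrite distrC (ger0_norm (_ : 0 <= c - a)) ?subr_ge0//.
  by rewrite mulrAC ler_pdivlMr// mulrC; move: t1 t2; rewrite ea ec; lra.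
have dd : `|z' - w'| <= k / l * `|z - w|.
  have [zw|/ltW wz] := leP z w; first exact: key.
  by rewrite distrC [`|z - w|]distrC; exact: key.
apply: (@le_trans _ _ ((1 + mu) * `|z' - w'|)).
  have hl := window_lipschitz W2 w'r z'r.
  have nn := normr_ge0 (z' - w').
  rewrite dist_le ?mulr_ge0 ?addr_ge0//= !opprD !addrA.
  have -> : b.1 + z' - b.1 - w' = z' - w' by ring.
  have -> : b.2 + h2 z' - b.2 - h2 w' = h2 z' - h2 w' by ring.
  rewrite -(real_normK (num_real (z' - w'))) -(real_normK (num_real (h2 z' - h2 w'))).
  have hn := normr_ge0 (h2 z' - h2 w').
  move: (`|z' - w'|) (`|h2 z' - h2 w'|) nn hn hl => X Y X0 Y0 YX.
  have : Y ^+ 2 <= (mu * X) ^+ 2 by rewrite ler_sqr ?nnegrE// mulr_ge0.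
  have : 0 <= mu * X ^+ 2 by rewrite mulr_ge0// sqr_ge0.
  by lra.
rewrite -mulrA ler_pM2l; last by lra.
apply: (le_trans dd); rewrite ler_pM2l ?divr_gt0//.
apply: le_trans (dist_fst _ _); rewrite /= opprD !addrA.
by have -> : b.1 + z - b.1 - w = z - w by ring.
Qed.

(** By [gap], a point within [e] of the dent is still lower than the points at [2 * d] and
    [- (2 * d)]; hence its normal points downwards and it lies on the graph. *)
Lemma bottom_pair u v p p' q q' : u != 0 -> v != 0 ->
  outer_normal K1 u p -> outer_normal K2 u p' ->
  outer_normal K1 v q -> outer_normal K2 v q' ->
  cap b d h1 h2 p p' -> dist p q <= e -> dist p' q' <= (1 + mu) * (k / l) * dist p q.
Proof.
have d0' := d0; have dr' := dr; have ed' := ed.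
have [N1 _ _] := W1.
move=> u0 v0 up up' vq vq' [z [_ [zd _ pE _]]] dpq.
have zr : `|z| < r by apply: (le_lt_trans zd); lra.
have [g1 g2] := gap zd.
have := le_trans (dist_fst p q) dpq; have := le_trans (dist_snd p q) dpq.
rewrite pE /= !ler_norml => /andP[y1 y2] /andP[x1 x2].
move: zd; rewrite ler_norml => /andP[z1 z2].
have r1 : `|2 * d| < r by rewrite gtr0_norm//; lra.
have r2 : `|- (2 * d)| < r by rewrite normrN.
have v2 : v.2 < 0.
  apply: (low_normal v0 vq (N1 _ r2).1 (N1 _ r1).1); rewrite /=; lra.
have wr : `|q.1 - b.1| < r by rewrite ltr_norml; apply/andP; split; lra.
have qE := low_unique (normal_slope vq v2) (N1 _ wr); rewrite /= subrKC in qE.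
have qE' : q = (b.1 + (q.1 - b.1), b.2 + h1 (q.1 - b.1)) by rewrite subrKC; exact: qE.
rewrite pE in up; have vqw := vq; rewrite qE' in vqw.
have [z' [z'r p'E ez]] := window_transfer zr u0 up up'.
have [w' [w'r q'E ew]] := window_transfer wr v0 vqw vq'.
by have := window_dist zr wr z'r w'r ez ew; rewrite -qE' -p'E -q'E.
Qed.

(** If neither pair is on a dent, the points do not move at all; otherwise [bottom_pair] applies
    after a reflection or an exchange of the two pairs. *)
Lemma pair_dist u v p p' q q' : u != 0 -> v != 0 ->
  outer_normal K1 u p -> outer_normal K2 u p' ->
  outer_normal K1 v q -> outer_normal K2 v q' ->
  dist p q <= e -> dist p' q' <= (1 + mu) * (k / l) * dist p q.
Proof.
have distC (a c : R * R) : dist a c = dist c a.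
  by rewrite /dist /dot/=; congr Num.sqrt; ring.
have distN (a c : R * R) : dist (- a) (- c) = dist a c.
  by rewrite /dist /dot/=; congr Num.sqrt; ring.
have opp K (a c : R * R) : origin_symmetric K -> outer_normal K a c -> outer_normal K (- a) (- c).
  move=> sK [Kc H]; split; first exact: sK.
  by move=> x /sK/H; rewrite /dot/= !mulrNN; lra.
have main (u' v' a a' c c' : R * R) : u' != 0 -> v' != 0 ->
    outer_normal K1 u' a -> outer_normal K2 u' a' ->
    outer_normal K1 v' c -> outer_normal K2 v' c' ->
    cap b d h1 h2 a a' \/ cap b d h1 h2 (- a) (- a') -> dist a c <= e ->
    dist a' c' <= (1 + mu) * (k / l) * dist a c.
  move=> u0 v0 ua ua' vc vc' [cp|cp] ace; first exact: (bottom_pair u0 v0 ua ua' vc vc').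
  rewrite -(distN a') -(distN a); apply: (@bottom_pair (- u') (- v')); rewrite ?oppr_eq0//;
    try exact: opp.
  by rewrite distN.
move=> u0 v0 up up' vq vq' dpq.
have [pp'|cp|cp] := dicho u0 up up'; last 2 first.
- by apply: main dpq => //; [exact: u0|exact: v0|..]; try eassumption; left.
- by apply: main dpq => //; [exact: u0|exact: v0|..]; try eassumption; right.
have [qq'|cq|cq] := dicho v0 vq vq'; last 2 first.
- by rewrite distC (distC p); apply: (main v u) => //; [left|rewrite distC].
- by rewrite distC (distC p); apply: (main v u) => //; [right|rewrite distC].
rewrite pp' qq' ler_peMl ?dist_ge0//.
have : 1 <= k / l by rewrite ler_pdivlMr// mul1r.
by have := mu0; move: (k / l) => t ? ?; nra.
Qed.

Lemma preimage_le sigma : sigma `<=` unit_circle -> compact K1 -> compact K2 -> K1 !=set0 ->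
  (surface_area_measure K2 sigma <=
   ((1 + mu) * (k / l))%:E * surface_area_measure K1 sigma)%E.
Proof.
move=> su c1 c2 K10.
have neq0 u : sigma u -> u != 0.
  move=> /su; rewrite /unit_circle/= => u1; apply/eqP => u0; move: u1.
  by rewrite u0 /dot/= mulr0 addr0 => /eqP; rewrite eq_sym oner_eq0.
have k0 : 0 < k by apply: lt_le_trans lk.
apply: (@hausdorff1_lipschitz _ (fun p p' => exists u, [/\ sigma u, outer_normal K1 u p & outer_normal K2 u p']) _ _ _ e) => //.
- by apply: mulr_gt0; [have := mu0; lra|exact: divr_gt0].
- move=> p' [_ [u sgu up']]; have [p up] := normal_exists u c1 K10.
  exists p; last by exists u.
  by split; [apply: (@normal_boundary _ K1 c1 u) => //; exact: neq0|exists u].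
move=> a c a' c' _ _ [u [su1 ua ua']] [v [sv vc vc']].
exact: pair_dist (neq0 _ su1) (neq0 _ sv) ua ua' vc vc'.
Qed.

End one_way.

(** Relative bounds in both directions make the difference at most [(c - 1) * c] times the measure
    of [K1], and the Lipschitz inverse of the Gauss map bounds the latter by [M] times the length of
    [sigma]. *)
Lemma window_pm_close (K1 K2 : set (R * R)) (b : R * R) (r l k mu d e M : R)
    (h1 s1 h2 s2 : R -> R) :
  smooth K1 -> smooth K2 -> origin_symmetric K1 -> origin_symmetric K2 ->
  window K1 b r l k mu h1 s1 -> window K2 b r l k mu h2 s2 ->
  0 < l -> l <= k -> 0 <= mu -> 0 < d -> 2 * d < r -> 0 < e -> e < d ->
  (forall z, d <= `|z| -> h1 z = h2 z /\ s1 z = s2 z) ->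
  (forall z, `|z| <= d -> h1 z + e < h1 (2 * d) /\ h1 z + e < h1 (- (2 * d))) ->
  (forall z, `|z| <= d -> h2 z + e < h2 (2 * d) /\ h2 z + e < h2 (- (2 * d))) ->
  (forall u p p', u != 0 -> outer_normal K1 u p -> outer_normal K2 u p' ->
    [\/ p = p', cap b d h1 h2 p p' | cap b d h1 h2 (- p) (- p')]) ->
  compact K1 -> compact K2 -> K1 !=set0 -> K2 !=set0 ->
  (hausdorff1 (boundary K1) < +oo)%E -> (hausdorff1 (boundary K2) < +oo)%E ->
  0 < M -> (forall u v p q, dot u u = 1 -> dot v v = 1 ->
    outer_normal K1 u p -> outer_normal K1 v q -> dist p q <= M * dist u v) ->
  let c := (1 + mu) * (k / l) in pm_close ((c - 1) * c * M) K1 K2.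
Proof.
move=> sm1 sm2 sy1 sy2 W1 W2 l0 lk mu0 d0 dr e0 ed agree gap1 gap2 dicho c1 c2 K10 K20 f1 f2 M0 lipM c.
move=> sigma ms su.
have a12 := @preimage_le K1 K2 b r l k mu d e h1 s1 h2 s2 sm1 sm2 sy1 sy2 W1 W2 l0 lk mu0 d0 dr e0 ed agree gap1 dicho sigma su c1 c2 K10.
have a21 : (surface_area_measure K1 sigma <= c%:E * surface_area_measure K2 sigma)%E.
  apply: (@preimage_le K2 K1 b r l k mu d e h2 s2 h1 s1) => //.
    by move=> z /agree[-> ->].
  move=> u p p' u0 up up'; case: (dicho u p' p u0 up' up).
  - by move=> ->; apply: Or31.
  - by move=> [z [w [? ? ? ?]]]; apply: Or32; exists w, z.
  by move=> [z [w [? ? ? ?]]]; apply: Or33; exists w, z.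
have aM : (surface_area_measure K1 sigma <= M%:E * hausdorff1 sigma)%E.
  apply: (@hausdorff1_lipschitz _ (fun u p => outer_normal K1 u p) _ _ M 1) => //.
    by move=> p [_ [u sgu up]]; exists u.
  by move=> u v p q /su u1 /su v1 up vq _; exact: lipM u1 v1 up vq.
have fin K : (hausdorff1 (boundary K) < +oo)%E -> surface_area_measure K sigma \is a fin_num.
  move=> f; rewrite ge0_fin_numE ?hausdorff1_ge0//; apply: le_lt_trans f.
  by apply: le_hausdorff1 => p [].
have c11 : 1 <= c.
  have : 1 <= k / l by rewrite ler_pdivlMr// mul1r.
  by rewrite /c; move: (k / l) => t ?; nra.
have c0 : 0 <= c by exact: le_trans c11.
move: (fin _ f1) (fin _ f2) a12 a21 aM.
have := hausdorff1_ge0 (normal_preimage K1 sigma); have := hausdorff1_ge0 (normal_preimage K2 sigma).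
rewrite -/(surface_area_measure K1 sigma) -/(surface_area_measure K2 sigma).
case: (surface_area_measure K1 sigma) (surface_area_measure K2 sigma) => [a| |] [a'| |] //.
rewrite !lee_fin => a'0 a0 _ _ a12 a21 aM.
apply: (@le_trans _ _ (((c - 1) * c) * a)%:E); last first.
  have cc : 0 <= (c - 1) * c by rewrite mulr_ge0// subr_ge0.
  rewrite EFinM [((c - 1) * c * M)%:E]EFinM -muleA.
  by apply: lee_wpmul2l; rewrite ?lee_fin.
rewrite -EFinB lee_fin ler_norml; apply/andP; split.
  have : (c - 1) * a <= (c - 1) * c * a.
    by rewrite -mulrA ler_wpM2l ?subr_ge0// ler_peMl.
  by move: a12; rewrite -/c; lra.
have : (c - 1) * a' <= (c - 1) * (c * a) by rewrite ler_wpM2l// subr_ge0.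
by move: a21; rewrite -/c; lra.
Qed.

End transfer.

(** * Stability under the perimeter distance *)

Section normal_arc.
Context {R : realType}.
Implicit Types (K : set (R * R)) (p q : R * R) (m n : R).

(* The unit normals of slope between [m] and [n], pointing downwards. *)
Definition normal_arc m n : set (R * R) :=
  [set u | [/\ dot u u = 1, u.2 <= 0, u.1 + m * u.2 >= 0 & u.1 + n * u.2 <= 0]].

Lemma normal_arc_measurable m n : measurable (normal_arc m n).
Proof.
apply: closed_measurable_plane.
have -> : normal_arc m n = [set u | dot u u = 1] `&` ([set u : R * R | 0 * u.1 + 1 * u.2 + 0 <= 0] `&`
    ([set u : R * R | -1 * u.1 + - m * u.2 + 0 <= 0] `&` [set u : R * R | 1 * u.1 + n * u.2 + 0 <= 0])).
  apply/seteqP; split => u /=.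
    by move=> [h1 h2 h3 h4]; split => //; split; [lra|split; lra].
  by move=> [h1 [h2 [h3 h4]]]; split => //; lra.
apply: closedI; last by do 2?apply: closedI; exact: closed_affine.
have -> : [set u : R * R | dot u u = 1] = (fun u : R * R => dot u u) @^-1` [set 1] by [].
apply: preimage_closed; last exact: closed_eq.
by move=> u _; apply: cvgD; apply: cvgM; (exact: cvg_fst || exact: cvg_snd).
Qed.

Lemma normal_arc_unit m n : normal_arc m n `<=` unit_circle.
Proof. by move=> u []. Qed.

Lemma normal_arc_lt0 m n u : normal_arc m n u -> u.2 < 0.
Proof.
move=> [u1 u2 h1 h2]; rewrite lt_neqAle u2 andbT; apply/eqP => e.
rewrite e !mulr0 !addr0 in h1 h2; have e1 : u.1 = 0 by apply/eqP; rewrite eq_le h1 h2.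
by move: u1; rewrite /dot e e1 !mulr0 addr0 => /eqP; rewrite eq_sym oner_eq0.
Qed.

Lemma normal_arc_slope m n u : normal_arc m n u -> m <= - (u.1 / u.2) <= n.
Proof.
move=> au; have u2 := normal_arc_lt0 au; case: au => _ _ h1 h2.
have nu2 : 0 < - u.2 by rewrite oppr_gt0.
have -> : - (u.1 / u.2) = u.1 / - u.2 by rewrite invrN mulrN.
by rewrite ler_pdivlMr// ler_pdivrMr//; apply/andP; split; move: h1 h2; lra.
Qed.

(** A downward unit normal is the radial projection of a point [(m, -1)] to the circle, and this
    projection does not increase distances; [A] and [B] are the factors at least [1] that scale [u]
    and [v] back to the line. *)
Lemma normal_arc_length m n : m <= n -> (hausdorff1 (normal_arc m n) <= (n - m)%:E)%E.
Proof.
move=> mn; have seg := hausdorff1_segment mn.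
apply: le_trans seg; rewrite -[leRHS]mul1e.
apply: (@hausdorff1_lipschitz _ (fun a u => normal_arc m n u /\ a.1 = - (u.1 / u.2)) _ _ 1 1) => //.
  move=> u au; exists (- (u.1 / u.2), 0); last by [].
  by exists (- (u.1 / u.2)) => //=; rewrite in_itv/= normal_arc_slope.
move=> a c u v _ _ [au ea] [av ec] _; rewrite mul1r.
apply: le_trans (dist_fst a c); rewrite dist_le// real_normK ?num_real//.
have u2 := normal_arc_lt0 au; have v2 := normal_arc_lt0 av.
case: au => u1 _ _ _; case: av => v1 _ _ _; rewrite /dot in u1 v1.
set A := - u.2^-1; set B := - v.2^-1.
have A0 : 0 < A by rewrite /A oppr_gt0 invr_lt0.
have B0 : 0 < B by rewrite /B oppr_gt0 invr_lt0.
have Au : A * u.2 = -1 by rewrite /A mulNr mulVf// lt_eqF.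
have Bv : B * v.2 = -1 by rewrite /B mulNr mulVf// lt_eqF.
have ge1 (c0 t : R) : 0 < c0 -> c0 * t = -1 -> t ^+ 2 <= 1 -> 1 <= c0.
  move=> c0p ct t1; rewrite -ler_sqr ?nnegrE ?(ltW c0p)//.
  have : c0 ^+ 2 * t ^+ 2 <= c0 ^+ 2 * 1 by rewrite ler_wpM2l ?sqr_ge0.
  by rewrite -exprMn ct sqrrN expr1n mulr1.
have A1 : 1 <= A.
  by apply: ge1 Au _ => //; have := sqr_ge0 u.1; rewrite -u1 !expr2; lra.
have B1 : 1 <= B.
  by apply: ge1 Bv _ => //; have := sqr_ge0 v.1; rewrite -v1 !expr2; lra.
pose kp := u.1 * v.1 + u.2 * v.2.
have kp1 : 0 <= 1 - kp.
  have := addr_ge0 (sqr_ge0 (u.1 - v.1)) (sqr_ge0 (u.2 - v.2)); rewrite /kp; move: u1 v1; lra.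
have -> : (u.1 - v.1) ^+ 2 + (u.2 - v.2) ^+ 2 = 2 * (1 - kp) by rewrite /kp; move: u1 v1; lra.
have -> : a.1 - c.1 = A * u.1 - B * v.1 by rewrite ea ec /A /B; ring.
have E : (A * u.1 - B * v.1) ^+ 2 = (A - B) ^+ 2 + 2 * (A * B * (1 - kp)).
  transitivity (A ^+ 2 * (u.1 * u.1 + u.2 * u.2) + B ^+ 2 * (v.1 * v.1 + v.2 * v.2) - 2 * (A * B * kp) - (A * u.2 - B * v.2) ^+ 2).
    by rewrite /kp; ring.
  by rewrite u1 v1 Au Bv subrr; ring.
rewrite E; have : 1 - kp <= A * B * (1 - kp).
  by rewrite ler_peMl//; rewrite -[leLHS]mulr1 ler_pM.
by have := sqr_ge0 (A - B); lra.
Qed.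

Lemma low_between K p q (x : R) : cvx K -> K p -> K q -> p.1 <= x <= q.1 ->
  exists2 y, K (x, y) & y <= Num.max p.2 q.2.
Proof.
move=> cK Kp Kq /andP[px xq]; have [e|ne] := eqVneq p.1 q.1.
  exists p.2; last by rewrite le_max lexx.
  have -> : x = p.1 by apply/eqP; rewrite eq_le px andbT e.
  by case: (p) Kp.
have pq : 0 < q.1 - p.1 by rewrite subr_gt0 lt_neqAle ne (le_trans px xq).
pose t := (x - p.1) / (q.1 - p.1).
have t0 : 0 <= t by apply: divr_ge0; [rewrite subr_ge0|exact: ltW].
have t1 : t <= 1 by rewrite ler_pdivrMr// mul1r lerD2r.
exists ((1 - t) * p.2 + t * q.2).
  apply: (cvx_comb cK Kp Kq t0 t1) => //=.
  have tE : t * (q.1 - p.1) = x - p.1 by rewrite divfK// gt_eqF.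
  by move: tE; lra.
have u0 : 0 <= 1 - t by rewrite subr_ge0.
have h1 : p.2 <= Num.max p.2 q.2 by rewrite le_max lexx.
have h2 : q.2 <= Num.max p.2 q.2 by rewrite le_max lexx orbT.
by have := ler_wpM2l u0 h1; have := ler_wpM2l t0 h2; lra.
Qed.

(** The arc of [K] with these normals has its shadow between [p] and [q] and its slopes bounded by
    [mu], so its length is that of the shadow up to the factor [1 + mu]. *)
Lemma curve_arc K L (x y x1 y1 x2 y2 : R -> R) (mu m n : R) p q :
  curve_of K L x y x1 y1 x2 y2 -> - mu <= m -> m < n -> n <= mu ->
  outer_normal K (m, -1) p -> outer_normal K (n, -1) q ->
  ((q.1 - p.1)%:E <= surface_area_measure K (normal_arc m n) <=
   ((1 + mu) * (q.1 - p.1))%:E)%E.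
Proof.
move=> HC mm mn nm mp nq; have mu0 : 0 <= mu by lra.
have sm := curve_smooth HC.
have [[Kc /cvxP cK intK] [dx dy dx1 dy1] _ _ [_ bd curv]] := HC.
have pq : p.1 <= q.1.
  by rewrite leNgt; apply/negP => /(slope_le nq mp); rewrite leNgt mn.
apply/andP; split.
  apply: hausdorff1_ge => // z /andP[pz zq].
  have [|w Kzw _] := @low_between K p q z cK mp.1 nq.1; first by rewrite (ltW pz) ltW.
  have [k0 low0] := low_exists Kc Kzw.
  have bz : boundary K (z, k0).
    apply/(boundary_closed _ (compact_plane_closed Kc)); split; first exact: low0.1.
    by apply: low_not_interior; exact: low0.2.
  have [t tE] := curve_boundary HC bz.
  have zx : z = x t by case: tE.
  have ky : k0 = y t by case: tE.
  (* Otherwise the tangent at [t] would have to contain both [p] and [q], and [touch] would identify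
     them. *)
  have x0 : 0 < x1 t.
    rewrite ltNge; apply/negP => x0.
    have hp := curve_ahead_le0 HC t mp.1; have hq := curve_ahead_le0 HC t nq.1.
    pose c := (z - p.1) / (q.1 - p.1).
    have qp : 0 < q.1 - p.1 by rewrite subr_gt0 (lt_trans pz zq).
    have c0 : 0 < c by rewrite divr_gt0// subr_gt0.
    have c1 : c < 1 by rewrite ltr_pdivrMr// mul1r ltrD2r.
    have cE : c * (q.1 - p.1) = z - p.1 by rewrite divfK// gt_eqF.
    have Kc' : K (z, (1 - c) * p.2 + c * q.2).
      by apply: (cvx_comb cK mp.1 nq.1 (ltW c0) (ltW c1)) => //=; move: cE; lra.
    have lo := low0.2 _ Kc'; rewrite /= in lo.
    have E : (1 - c) * ahead x y x1 y1 p t + c * ahead x y x1 y1 q t =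
        - x1 t * ((1 - c) * p.2 + c * q.2 - k0).
      have e0 : (1 - c) * p.1 + c * q.1 - x t = 0 by rewrite -zx; move: cE; lra.
      transitivity (y1 t * ((1 - c) * p.1 + c * q.1 - x t) - x1 t * ((1 - c) * p.2 + c * q.2 - y t)).
        by rewrite /ahead; ring.
      by rewrite e0 ky; ring.
    have E0 : 0 <= - x1 t * ((1 - c) * p.2 + c * q.2 - k0).
      by rewrite mulr_ge0 ?oppr_ge0// subr_ge0.
    have c1' : 0 < 1 - c by rewrite subr_gt0.
    have k1 : (1 - c) * ahead x y x1 y1 p t <= 0 by rewrite pmulr_rle0.
    have k2 : c * ahead x y x1 y1 q t <= 0 by rewrite pmulr_rle0.
    have z1 : ahead x y x1 y1 p t = 0.
      apply: (mulfI (lt0r_neq0 c1')); rewrite mulr0; apply/eqP; rewrite eq_le k1/=.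
      by move: E E0 k2; lra.
    have z2 : ahead x y x1 y1 q t = 0.
      apply: (mulfI (lt0r_neq0 c0)); rewrite mulr0; apply/eqP; rewrite eq_le k2/=.
      by move: E E0 k1; lra.
    have p1 := touch dx dy dx1 dy1 curv (fun s => curve_ahead_le0 HC s mp.1) z1.
    have q1 := touch dx dy dx1 dy1 curv (fun s => curve_ahead_le0 HC s nq.1) z2.
    by move: qp; rewrite p1 q1 subrr ltxx.
  have tn := slope_outer_normal HC x0; set a := y1 t / x1 t in tn.
  have ma : m <= a by apply: slope_le mp tn _; rewrite /= -zx.
  have an : a <= n by apply: slope_le tn nq _; rewrite /= -zx.
  exists k0; split=> //.
  pose g := (Num.sqrt (1 + a ^+ 2))^-1.
  have s0 : 0 < 1 + a ^+ 2 by rewrite ltr_wpDr// sqr_ge0.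
  have g0 : 0 < g by rewrite invr_gt0 sqrtr_gt0.
  have gE : g ^+ 2 * (1 + a ^+ 2) = 1.
    by rewrite /g exprVn sqr_sqrtr ?ltW// mulVf// gt_eqF.
  exists (g * a, g * -1); last by rewrite zx ky; exact: (outer_normal_scale g0 tn).
  split; rewrite /dot/=.
  - by move: gE; lra.
  - by lra.
  - by have : 0 <= g * (a - m) by [rewrite mulr_ge0 ?subr_ge0// ltW|]; lra.
  by have : 0 <= g * (n - a) by [rewrite mulr_ge0 ?subr_ge0// ltW|]; lra.
have seg := hausdorff1_segment pq.
rewrite EFinM; apply: (@le_trans _ _ ((1 + mu)%:E *
   hausdorff1 [set ((z, 0) : R * R)%R | z in (`[p.1, q.1] : set R)])%E); last first.
  by apply: lee_wpmul2l => //; rewrite lee_fin addr_ge0.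
apply: (@hausdorff1_lipschitz _ (fun a v => a.1 = v.1 /\
    exists2 c, - mu <= c <= mu & outer_normal K (c, -1) v) _ _ (1 + mu) 1) => //.
- by rewrite ltr_wpDr.
- move=> v [_ [u au uv]]; have u2 := normal_arc_lt0 au.
  have /andP[c1 c2] := normal_arc_slope au; have cv := normal_slope uv u2.
  exists (v.1, 0); last first.
    by split=> //; exists (- (u.1 / u.2)) => //; rewrite (le_trans mm c1) (le_trans c2 nm).
  exists v.1 => //=; rewrite in_itv/=; apply/andP; split; rewrite leNgt; apply/negP => lt.
    have e : m = - (u.1 / u.2) by apply/eqP; rewrite eq_le c1 (slope_le cv mp lt).
    by rewrite -e in cv; rewrite (sm.1 _ _ _ (slope_neq0 m) cv mp) ltxx in lt.
  have e : n = - (u.1 / u.2) by apply/eqP; rewrite eq_le c2 (slope_le nq cv lt).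
  by rewrite -e in cv; rewrite (sm.1 _ _ _ (slope_neq0 n) cv nq) ltxx in lt.
move=> a c v w _ _ [av [cv /andP[cv1 cv2] nv]] [cw [dw /andP[dw1 dw2] nw]] _.
apply: (@le_trans _ _ ((1 + mu) * `|v.1 - w.1|)); last first.
  by rewrite -av -cw ler_wpM2l ?addr_ge0// dist_fst.
have h1 := outer_normal_low nv nw.1; have h2 := outer_normal_low nw nv.1.
have nn := normr_ge0 (v.1 - w.1).
have k1 : `|cv * (v.1 - w.1)| <= mu * `|v.1 - w.1|.
  by rewrite normrM ler_wpM2r// ler_norml cv1.
have k2 : `|dw * (v.1 - w.1)| <= mu * `|v.1 - w.1|.
  by rewrite normrM ler_wpM2r// ler_norml dw1.
have hl : `|v.2 - w.2| <= mu * `|v.1 - w.1|.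
  move: k1 k2; rewrite !ler_norml => /andP[a1 a2] /andP[a3 a4].
  by apply/andP; split; move: h1 h2; lra.
rewrite dist_le ?mulr_ge0 ?addr_ge0//.
rewrite -(real_normK (num_real (v.1 - w.1))) -(real_normK (num_real (v.2 - w.2))).
have hn := normr_ge0 (v.2 - w.2).
move: (`|v.1 - w.1|) (`|v.2 - w.2|) nn hn hl => X Y X0 Y0 YX.
have : Y ^+ 2 <= (mu * X) ^+ 2 by rewrite ler_sqr ?nnegrE// mulr_ge0.
have : 0 <= mu * X ^+ 2 by rewrite mulr_ge0// sqr_ge0.
by lra.
Qed.

End normal_arc.

Section stability.
Context {R : realType}.

(* Halving the interval halves the quadratic error term. *)
Lemma quadratic_lipschitz (f : R -> R) (r A B : R) :
  (forall z w, `|z| < r -> `|w| < r -> z <= w ->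
    `|f w - f z| <= A * (w - z) + B * (w - z) ^+ 2) ->
  forall z w, `|z| < r -> `|w| < r -> z <= w -> `|f w - f z| <= A * (w - z).
Proof.
move=> H z w zr wr zw.
have half (n : nat) : forall z w, `|z| < r -> `|w| < r -> z <= w ->
    `|f w - f z| <= A * (w - z) + B / 2 ^+ n * (w - z) ^+ 2.
  elim: n => [|n IH] a c ar cr ac; first by rewrite expr0 divr1; exact: H.
  pose m := (a + c) / 2.
  have mr : `|m| < r.
    by move: ar cr; rewrite !ltr_norml => /andP[? ?] /andP[? ?]; rewrite /m; apply/andP; split; lra.
  have am : a <= m by rewrite /m; lra.
  have mc : m <= c by rewrite /m; lra.
  have h1 := IH _ _ ar mr am; have h2 := IH _ _ mr cr mc.
  rewrite exprS invfM; set b := B / 2 ^+ n in h1 h2 *.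
  have -> : B * (2^-1 / 2 ^+ n) = b / 2 by rewrite /b; ring.
  have := ler_distD (f m) (f c) (f a) => h3.
  have e1 : m - a = (c - a) / 2 by rewrite /m; field.
  have e2 : c - m = (c - a) / 2 by rewrite /m; field.
  by rewrite e1 in h1; rewrite e2 in h2; move: h1 h2 h3; lra.
rewrite leNgt; apply/negP => lt.
pose g := `|f w - f z| - A * (w - z).
have g0 : 0 < g by rewrite subr_gt0.
pose Q := B * (w - z) ^+ 2.
have [n hn] : exists n : nat, `|Q| / g < n%:R.
  by exists (Num.bound (`|Q| / g)); apply: archi_boundP; rewrite divr_ge0// ltW.
have := half n z w zr wr zw.
have -> : B / 2 ^+ n * (w - z) ^+ 2 = Q / 2 ^+ n by rewrite /Q; ring.
have p0 : 0 < (2 : R) ^+ n by rewrite exprn_gt0.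
have : Q / 2 ^+ n < g.
  rewrite ltr_pdivrMr//; apply: (le_lt_trans (ler_norm Q)).
  rewrite ltr_pdivrMr// mulrC in hn; apply: (lt_le_trans hn); rewrite ler_pM2l//.
  by rewrite -natrX ler_nat ltnW// ltn_expl.
by rewrite /g; lra.
Qed.

Variables (K D : set (R * R)) (b : R * R) (r l k mu rho t : R) (h s : R -> R).
Variables (L L' : R) (x y x1 y1 x2 y2 x' y' x1' y1' x2' y2' : R -> R).
Hypothesis HK : curve_of K L x y x1 y1 x2 y2.
Hypothesis HD : curve_of D L' x' y' x1' y1' x2' y2'.
Hypothesis W : window K b r l k mu h s.
Hypotheses (l0 : 0 < l) (k0 : 0 < k) (mu0 : 0 < mu) (mu1 : mu <= 1 / 4).
Hypotheses (rho0 : 0 < rho) (rhor : 2 * rho < r) (t0 : 0 <= t) (tk : t * k <= mu).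
Hypothesis KD : pm_close t K D.

(** With [X] and [Z] the horizontal distances in [D] and in [K], the two measures lie between [X]
    and [(1 + mu) * X] and between [Z] and [(1 + mu) * Z], and they differ by at most [t * k * Z],
    hence by at most [mu * Z]. *)
Lemma normal_shift z w P Q : `|z| < r -> `|w| < r -> z <= w ->
  outer_normal D (s z, -1) P -> outer_normal D (s w, -1) Q ->
  `|Q.1 - P.1 - (w - z)| <= 2 * mu * (w - z).
Proof.
have [N S B] := W; have mu0' := mu0; have mu1' := mu1; have tk' := tk.
move=> zr wr; rewrite le_eqVlt => /predU1P[<- |zw] nP nQ.
  by rewrite ((curve_smooth HD).1 _ _ _ (slope_neq0 (s z)) nP nQ) !subrr mulr0 normr0.
have /andP[s1 s2] := S _ _ zr wr (ltW zw).
have szw : s z < s w.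
  by have : 0 < l * (w - z) by [rewrite mulr_gt0// subr_gt0|]; move: s1; lra.
have := B _ zr; have := B _ wr; rewrite !ler_norml => /andP[b1 b2] /andP[b3 b4].
have /andP[k1 k2] := curve_arc HK b3 szw b2 (N _ zr) (N _ wr).
have /andP[d1 d2] := curve_arc HD b3 szw b2 nP nQ.
have := KD (@normal_arc_measurable R (s z) (s w)) (@normal_arc_unit R (s z) (s w)).
have len := normal_arc_length (ltW szw).
have tl : (t%:E * hausdorff1 (normal_arc (s z) (s w)) <= (t * (s w - s z))%:E)%E.
  by rewrite EFinM; apply: lee_wpmul2l => //; rewrite lee_fin.
move=> /le_trans/(_ tl).
move: k1 k2 d1 d2; rewrite /= !opprD !addrA.
have -> : b.1 + w - b.1 - z = w - z by ring.
case: (surface_area_measure K _) (surface_area_measure D _) => [a| |] [c| |] //=; rewrite ?lee_fin.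
move=> k1 k2 d1 d2; rewrite ler_norml => /andP[c1 c2].
set X := Q.1 - P.1 in d1 d2 *; set Z := w - z in s1 s2 k1 k2 *.
have Z0 : 0 < Z by rewrite /Z subr_gt0.
have tZ : t * (s w - s z) <= mu * Z.
  apply: (@le_trans _ _ (t * (k * Z))); first by rewrite ler_wpM2l.
  by rewrite mulrA ler_wpM2r// ltW.
have mZ : 0 < mu * Z by rewrite mulr_gt0.
have X0 : 0 <= X.
  rewrite /X subr_ge0 leNgt; apply/negP => /(slope_le nQ nP); rewrite leNgt szw//.
have -> : X - w - - z = X - Z by rewrite /Z; ring.
apply/andP; split; last by move: d1 c1 k2 tZ; lra.
(* Multiplying by [1 - mu] stands in for dividing by [1 + mu]. *)
have XZ : (1 - mu) * ((1 + mu) * X) <= X.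
  have : 0 <= mu ^+ 2 * X by rewrite mulr_ge0// sqr_ge0.
  by lra.
have : (1 - mu) * ((1 - mu) * Z) <= (1 - mu) * ((1 + mu) * X).
  by rewrite ler_wpM2l//; [lra|move: d2 c2 k1 tZ; lra].
have : 0 <= mu ^+ 2 * Z by rewrite mulr_ge0 ?sqr_ge0// ltW.
by move: XZ; lra.
Qed.

(** Points with equal normals are compared first. Their horizontal displacement is of order
    [mu * rho], the vertical one only of order [mu ^+ 2 * rho], because slopes are at most [mu];
    passing to equal abscissas costs another slope times displacement. The second power of [mu] is
    what lets the dent survive at small scales. *)
Lemma window_stable : exists (c : R * R) (g : R -> R), forall z, `|z| <= rho ->
  low_at D (c.1 + z, c.2 + g z) /\ `|g z - h z| <= 8 * mu ^+ 2 * rho.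
Proof.
have [N S B] := W; have mu0' := mu0; have mu1' := mu1; have rho0' := rho0; have rhor' := rhor.
have [[Dc /cvxP cD [a0 /interior_subset Do]] _ _ _ _] := HD.
have [P HP] := choice (fun z => @normal_exists R D (s z, -1) Dc (ex_intro _ a0 Do)).
have shift z w : `|z| < r -> `|w| < r -> z <= w ->
    `|(P w).1 - (P z).1 - (w - z)| <= 2 * mu * (w - z).
  by move=> zr wr zw; exact: normal_shift.
have vert z w : `|z| < r -> `|w| < r -> z <= w ->
    `|((P w).2 - h w) - ((P z).2 - h z)| <= 2 * mu ^+ 2 * (w - z).
  apply: (@quadratic_lipschitz (fun z => (P z).2 - h z) r (2 * mu ^+ 2) (2 * k)) => {}z {}w zr wr zw.
  have := shift _ _ zr wr zw; rewrite ler_norml => /andP[e1 e2].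
  have p1 := outer_normal_low (HP z) (HP w).1; have p2 := outer_normal_low (HP w) (HP z).1.
  have p3 := outer_normal_low (N _ zr) (N _ wr).1; have p4 := outer_normal_low (N _ wr) (N _ zr).1.
  rewrite /= in p3 p4; have /andP[s1 s2] := S _ _ zr wr zw.
  set Z := w - z in e1 e2 s1 s2 *; set X := (P w).1 - (P z).1 in e1 e2.
  have Z0 : 0 <= Z by rewrite subr_ge0.
  have X0 : 0 <= X by have : 0 <= (1 - 2 * mu) * Z by [rewrite mulr_ge0//; lra|]; move: e1; lra.
  have X2 : X <= 2 * Z by have : 0 <= (1 - 2 * mu) * Z by [rewrite mulr_ge0//; lra|]; move: e2; lra.
  have sXZ : `|s z * (X - Z)| <= mu * (2 * mu * Z).
    by rewrite normrM ler_pM// ?B// ler_norml e1 e2.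
  move: sXZ; rewrite ler_norml => /andP[f1 f2].
  have q1 : (s w - s z) * X <= k * Z * (2 * Z).
    apply: ler_pM => //; rewrite subr_ge0 -subr_ge0; apply: le_trans s1.
    by rewrite mulr_ge0// ltW.
  have q2 : (s w - s z) * Z <= k * Z * Z by rewrite ler_wpM2r.
  have kZ : 0 <= k * Z * Z by rewrite !mulr_ge0// ltW.
  rewrite /X in X0 X2 f1 f2 q1; rewrite /Z in Z0 f1 f2 q1 q2 kZ *.
  by rewrite ler_norml; apply/andP; split; move: p1 p2 p3 p4 f1 f2 q1 q2 kZ; lra.
have z0r : `|0 : R| < r by rewrite normr0; lra.
pose c : R * R := ((P 0).1, (P 0).2 - h 0).
have lo (z : R) : `|z| <= 2 * rho -> `|z| < r by move=> zr; apply: le_lt_trans zr _.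
have hor z : `|z| <= 2 * rho -> `|(P z).1 - c.1 - z| <= 4 * mu * rho.
  move=> zr; apply: (@le_trans _ _ (2 * mu * `|z|)); last first.
    by have : 2 * mu * `|z| <= 2 * mu * (2 * rho) by [rewrite ler_wpM2l//; lra|]; lra.
  have [z0|/ltW z0] := leP 0 z.
    by have := shift _ _ z0r (lo _ zr) z0; rewrite subr0 (ger0_norm z0).
  have := shift _ _ (lo _ zr) z0r z0; rewrite sub0r opprK (ler0_norm z0) mulrN.
  rewrite /c/= -normrN.
  by have -> : - ((P 0).1 - (P z).1 + z) = (P z).1 - (P 0).1 - z by ring.
have ver z : `|z| <= 2 * rho -> `|(P z).2 - c.2 - h z| <= 4 * mu ^+ 2 * rho.
  move=> zr; apply: (@le_trans _ _ (2 * mu ^+ 2 * `|z|)); last first.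
    have : 2 * mu ^+ 2 * `|z| <= 2 * mu ^+ 2 * (2 * rho) by rewrite ler_wpM2l// mulr_ge0// sqr_ge0.
    by lra.
  have -> : (P z).2 - c.2 - h z = ((P z).2 - h z) - ((P 0).2 - h 0) by rewrite /c/=; ring.
  have [z0|/ltW z0] := leP 0 z.
    by have := vert _ _ z0r (lo _ zr) z0; rewrite subr0 (ger0_norm z0).
  have := vert _ _ (lo _ zr) z0r z0; rewrite sub0r (ler0_norm z0).
  by rewrite distrC.
pose kp := 4 * mu * rho.
have kp0 : 0 <= kp by rewrite /kp !mulr_ge0// ltW.
have kprho : kp <= rho by rewrite /kp -[leRHS]mul1r ler_wpM2r//; lra.
have main z : `|z| <= rho -> exists g, low_at D (c.1 + z, c.2 + g) /\
    `|g - h z| <= 8 * mu ^+ 2 * rho.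
  move=> zr; have := zr; rewrite ler_norml => /andP[z1 z2].
  have r1 : `|z - kp| <= 2 * rho by rewrite ler_norml; apply/andP; split; lra.
  have r2 : `|z + kp| <= 2 * rho by rewrite ler_norml; apply/andP; split; lra.
  have r3 : `|z| <= 2 * rho by rewrite ler_norml; apply/andP; split; lra.
  have [v Dv vmax] : exists2 v, D (c.1 + z, v) & v <= Num.max (P (z - kp)).2 (P (z + kp)).2.
    apply: low_between cD (HP _).1 (HP _).1 _.
    have := hor _ r1; have := hor _ r2; rewrite -/kp !ler_norml => /andP[a1 a2] /andP[a3 a4].
    by apply/andP; split; lra.
  have [w [Dw wlow]] := low_exists Dc Dv.
  exists (w - c.2); rewrite subrKC; split; first by [].
  have wv : w <= v by exact: wlow Dv.
  have up : w <= c.2 + h z + mu * kp + 4 * mu ^+ 2 * rho.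
    apply: (le_trans wv); apply: (le_trans vmax).
    have := window_lipschitz W (lo _ r3) (lo _ r1); have := window_lipschitz W (lo _ r3) (lo _ r2).
    have -> : z - kp - z = - kp by ring.
    have -> : z + kp - z = kp by ring.
    rewrite normrN (ger0_norm kp0) !ler_norml => /andP[a1 a2] /andP[a3 a4].
    have := ver _ r1; have := ver _ r2; rewrite !ler_norml => /andP[e1 e2] /andP[e3 e4].
    by rewrite ge_max; apply/andP; split; lra.
  have low : c.2 + h z - mu * kp - 4 * mu ^+ 2 * rho <= w.
    have p1 := outer_normal_low (HP z) Dw; rewrite /= in p1.
    have := ver _ r3; have := hor _ r3; rewrite -/kp => f1; rewrite ler_norml => /andP[e1 e2].
    have : `|s z * ((P z).1 - c.1 - z)| <= mu * kp by rewrite normrM ler_pM// B// lo.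
    by rewrite ler_norml => /andP[e3 e4]; move: p1 e1 e3 e4; lra.
  rewrite ler_norml; have mk : mu * kp = 4 * mu ^+ 2 * rho by rewrite /kp; ring.
  by move: up low; rewrite mk => up low; apply/andP; split; lra.
have main' z : exists g, `|z| <= rho -> low_at D (c.1 + z, c.2 + g) /\
    `|g - h z| <= 8 * mu ^+ 2 * rho.
  by have [/main[g Hg]|_] := boolP (`|z| <= rho); [exists g|exists 0].
by have [g Hg] := choice main'; exists c, g.
Qed.

End stability.

(** * Dented disks at small perimeter distance *)

Section perturbation.
Context {R : realType}.

(** The factor [d ^+ 2] makes the bound on the second derivative independent of the width, so the
    dent can be shrunk at a fixed relative effect on the curvature. *)
Lemma scaled_bump (a d : R) (phi := fun z => - (a * d ^+ 2) * cubic_bump (z / d))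
    (phi1 := fun z => - (a * d) * bump1 (z / d)) (phi2 := fun z => - a * bump2 (z / d)) :
  0 <= a -> 0 < d ->
  [/\ forall z, is_derive z (1 : R) phi (phi1 z), forall z, is_derive z (1 : R) phi1 (phi2 z),
    continuous phi2, forall z, phi z <= 0
  & [/\ forall z, d <= `|z| -> [/\ phi z = 0, phi1 z = 0 & phi2 z = 0],
      forall z, `|phi2 z| <= 6 * a & phi1 0 = 0]].
Proof.
move=> a0 d0; have dn := lt0r_neq0 d0.
have sc (z : R) : is_derive z (1 : R) (fun u : R => u / d) d^-1.
  by apply: is_derive_eq; rewrite -![_ *: _]/(_ * _); ring.
have comp (f f1 : R -> R) z : (forall z, is_derive z (1 : R) f (f1 z)) ->
    is_derive z (1 : R) (fun u => f (u / d)) (f1 (z / d) / d).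
  by move=> df; exact: (@is_derive1_comp _ f (fun u => u / d) z _ _ (df _) (sc z)).
split.
- move=> z; have e := comp _ _ z (@is_derive_bump R).
  by apply: is_derive_eq; rewrite -![_ *: _]/(_ * _) /phi1; field.
- move=> z; have e := comp _ _ z (@is_derive_bump1 R).
  by apply: is_derive_eq; rewrite -![_ *: _]/(_ * _) /phi2; field.
- move=> z; apply: cvgM; first exact: cvg_cst.
  apply: (@continuous_comp _ _ _ (fun u : R => u / d)); last exact: bump2_continuous.
  by apply: cvgM; [exact: cvg_id|exact: cvg_cst].
- move=> z; have /andP[b0 _] := cubic_bump_itv (z / d).
  by rewrite /phi mulNr oppr_le0 mulr_ge0// mulr_ge0// sqr_ge0.
split.
- move=> z dz; have [|e1 e2 e3] := @bump_out R (z / d).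
    by rewrite normrM normfV (gtr0_norm d0) ler_pdivlMr// mul1r.
  by rewrite /phi /phi1 /phi2 e1 e2 e3 !mulr0.
- move=> z; rewrite /phi2 normrM normrN (ger0_norm a0) mulrC.
  by rewrite ler_wpM2r// bump2_bound.
by rewrite /phi1 mul0r bump1_0 mulr0.
Qed.

Variables (C : set (R * R)) (L : R) (x y x1 y1 x2 y2 : R -> R).
Hypothesis HC : curve_of C L x y x1 y1 x2 y2.
Hypothesis sC : origin_symmetric C.
Variables (b : R * R) (c nu eps r d M : R) (h s : R -> R).
Hypotheses (c0 : 0 < c) (eps0 : 0 < eps) (eps1 : eps <= 1 / 28) (nu0 : 0 < nu) (nu1 : nu <= eps).
Hypotheses (d0 : 0 < d) (dr : 2 * d < r).
Hypothesis G1 : forall z, `|z| <= r -> outer_normal C (s z, -1) (b.1 + z, b.2 + h z).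
Hypotheses (h00 : h 0 = 0) (s00 : s 0 = 0).
Hypothesis G : forall z w, `|z| <= r -> `|w| <= r ->
  (z <= w -> c * (1 - nu) * (w - z) <= s w - s z <= c * (1 + nu) * (w - z)) /\
  c * (1 - nu) / 2 * (w - z) ^+ 2 <= h w - h z - s z * (w - z) <= c * (1 + nu) / 2 * (w - z) ^+ 2.
Hypothesis M0 : 0 < M.
Hypothesis lipM : forall u v p q, dot u u = 1 -> dot v v = 1 ->
  outer_normal C u p -> outer_normal C v q -> dist p q <= M * dist u v.

Let k := c * (1 + 7 * eps).
Let l := c * (1 - 7 * eps).

Lemma slope_window (K : set (R * R)) (g m : R -> R) : 0 < r -> m 0 = 0 ->
  (forall z, `|z| < r -> outer_normal K (m z, -1) (b.1 + z, b.2 + g z)) ->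
  (forall z w, `|z| < r -> `|w| < r -> z <= w -> l * (w - z) <= m w - m z <= k * (w - z)) ->
  window K b r l k (k * r) g m.
Proof.
have c0' := c0; have e0 := eps0; have e1 := eps1.
move=> r0 m0 N S; split=> // z zr.
have z0r : `|0 : R| < r by rewrite normr0.
have l0 : 0 < l by rewrite mulr_gt0//; lra.
have k0 : 0 < k by rewrite mulr_gt0//; lra.
have [z0|/ltW z0] := leP 0 z.
  have := S _ _ z0r zr z0; rewrite m0 !subr0 => /andP[h1 h2].
  have h3 : 0 <= l * z by rewrite mulr_ge0// ltW.
  rewrite ger0_norm; last exact: le_trans h1.
  by apply: (le_trans h2); rewrite ler_pM2l// (le_trans (ler_norm z))// ltW.
have := S _ _ zr z0r z0; rewrite m0 !sub0r => /andP[h1 h2].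
have h3 : 0 <= l * - z by rewrite mulr_ge0 ?oppr_ge0// ltW.
rewrite ler0_norm; last by move: h1 h3; lra.
by apply: (le_trans h2); rewrite ler_pM2l// -(ler0_norm z0) ltW.
Qed.

Lemma perturbed_disk : exists (C' : set (R * R)) (g m : R -> R) (y' y1' y2' : R -> R),
  [/\ curve_of C' L x y' x1 y1' x2 y2', origin_symmetric C',
      window C' b r l k (k * r) g m,
      forall z, g z = h z - eps * c * d ^+ 2 * cubic_bump (z / d)
    & let a := (1 + k * r) * (k / l) in pm_close ((a - 1) * a * M) C C'].
Proof.
have c0' := c0; have e0' := eps0; have e1' := eps1; have n0' := nu0; have n1' := nu1.
have d0' := d0; have dr' := dr.
have a0 : 0 <= eps * c by rewrite mulr_ge0// ltW.
have [dphi dphi1 cphi2 phi_le0 [phi_out phi2b phi10]] := scaled_bump a0 d0.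
pose phi z := - (eps * c * d ^+ 2) * cubic_bump (z / d).
pose phi1 z := - (eps * c * d) * bump1 (z / d).
pose phi2 z := - (eps * c) * bump2 (z / d).
pose kap := 6 * (eps * c).
have r0 : 0 < r by lra.
have dr1 : d < r by lra.
pose l' := c * (1 - nu).
have cn : c * nu <= c * eps by rewrite ler_pM2l.
have ce : c * eps <= c * (1 / 28) by rewrite ler_pM2l.
have kl : kap < l' by rewrite /kap /l'; move: cn ce c0'; lra.
have Gs z w : `|z| <= r -> `|w| <= r -> z <= w -> l' * (w - z) <= s w - s z.
  by move=> zr wr zw; have [/(_ zw)/andP[]] := G zr wr.
have Gh z w : `|z| <= r -> `|w| <= r -> l' / 2 * (w - z) ^+ 2 <= h w - h z - s z * (w - z).
  by move=> zr wr; have [_ /andP[]] := G zr wr.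
have phi2_ge z : - kap <= phi2 z by have := phi2b z; rewrite ler_norml => /andP[].
pose C' := modified C b r h s phi phi1.
have HC' := modified_curve HC sC r0 G1 Gs Gh d0 dr1 kl dphi dphi1 cphi2 phi_le0 phi_out phi2_ge s00 phi10.
rewrite -/phi -/phi1 -/phi2 -/C' in HC'.
have sC' : origin_symmetric C' by exact: modified_sym.
have CC' : C `<=` C' := sub_modified sC G1 Gs Gh d0 dr1 kl dphi dphi1 phi_le0 phi_out phi2_ge.
have l0 : 0 < l by rewrite /l mulr_gt0//; lra.
have lk : l <= k by rewrite /l /k ler_pM2l//; lra.
have k0 : 0 < k by apply: lt_le_trans lk.
have W : window C b r l k (k * r) h s.
  apply: slope_window => //; first by move=> z /ltW/G1.
  move=> z w /ltW zr /ltW wr zw; have [/(_ zw)/andP[h1 h2] _] := G zr wr.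
  have zw0 : 0 <= w - z by rewrite subr_ge0.
  apply/andP; split.
    by apply: le_trans h1; apply: ler_wpM2r => //; rewrite /l; move: cn; lra.
  by apply: (le_trans h2); apply: ler_wpM2r => //; rewrite /k; move: cn; lra.
pose g := mod_height h phi; pose m := mod_slope s phi1.
have W' : window C' b r l k (k * r) g m.
  apply: slope_window => //.
  - by rewrite /m /mod_slope s00 add0r; exact: phi10.
  - by move=> z zr; apply: (modified_normal sC G1 Gs Gh d0 dr1 kl dphi dphi1 phi_le0 phi_out phi2_ge).
  move=> z w /ltW zr /ltW wr zw; have zw0 : 0 <= w - z by rewrite subr_ge0.
  have [/(_ zw)/andP[h1 h2] _] := G zr wr; apply/andP; split.
    apply: le_trans (mod_slope_mono Gs dphi1 phi2_ge zr wr zw).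
    by apply: ler_wpM2r => //; rewrite /l /l' /kap; move: cn; lra.
  have := C1_lipschitz dphi1 phi2b w z; rewrite (ger0_norm zw0) ler_norml => /andP[_ h3].
  have h4 : c * (1 + nu) * (w - z) + 6 * (eps * c) * (w - z) <= k * (w - z).
    by rewrite -mulrDl; apply: ler_wpM2r => //; rewrite /k; move: cn; lra.
  by rewrite /m /mod_slope; move: h2 h3 h4; rewrite -/(phi1 w) -/(phi1 z); lra.
exists C', g, m, (ymod x y x1 b phi), (ymod1 x x1 y1 b phi1), (ymod2 x x1 x2 y2 b phi1 phi2).
split => //; first by move=> z; rewrite /g /mod_height /phi mulNr.
have agree z : d <= `|z| -> h z = g z /\ s z = m z.
  by move=> /(mod_out h s phi_out)[e1 e2]; split; symmetry; [exact: e1|exact: e2].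
have [[Kc _ [q0 /interior_subset Cq0]] _ _ _ _] := HC.
have [[Kc' _ _] _ _ _ _] := HC'.
have sm := curve_smooth HC; have sm' := curve_smooth HC'.
have d2r : `|2 * d| < r by rewrite gtr0_norm//; lra.
have d2r' : `|- (2 * d)| < r by rewrite normrN.
have z0r : `|0 : R| <= r by rewrite normr0 ltW.
have cd : 0 < c * d ^+ 2 by rewrite mulr_gt0// exprn_gt0.
(* The height is about [2 * c * d ^+ 2] at [2 * d] and at most about [c * d ^+ 2 / 2] over the dent,
   so [c * d ^+ 2 / 2] fits in between with room for [nu]. *)
pose e := Num.min (c * d ^+ 2) d / 2.
have e0 : 0 < e by rewrite divr_gt0// lt_min cd d0.
have ecd : e <= c * d ^+ 2 / 2 by rewrite ler_pM2r// ge_min lexx.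
have ed2 : e <= d / 2 by rewrite ler_pM2r// ge_min lexx orbT.
have low2 z : `|z| = 2 * d -> c * (1 - nu) * 2 * d ^+ 2 <= h z.
  move=> zE; have zr : `|z| <= r by rewrite zE ltW.
  have [_ /andP[+ _]] := G z0r zr; rewrite h00 s00 mul0r !subr0.
  by rewrite -(real_normK (num_real z)) zE; lra.
have up1 z : `|z| <= d -> h z <= c * (1 + nu) / 2 * d ^+ 2.
  move=> zd; have zr : `|z| <= r by rewrite (le_trans zd)// ltW.
  have [_ /andP[_]] := G z0r zr; rewrite h00 s00 mul0r !subr0 => /le_trans; apply.
  apply: ler_wpM2l; first by rewrite divr_ge0// mulr_ge0 ?ltW//; lra.
  by rewrite -(real_normK (num_real z)) ler_sqr ?nnegrE// ltW.
have cdn : c * d ^+ 2 * nu <= c * d ^+ 2 * (1 / 28) by rewrite ler_pM2l//; lra.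
have gap z : `|z| <= d -> h z + e < h (2 * d) /\ h z + e < h (- (2 * d)).
  move=> /up1 hz; have n2 : `|2 * d| = 2 * d by rewrite gtr0_norm// mulr_gt0.
  have n3 : `|- (2 * d)| = 2 * d by rewrite normrN.
  have l1 := low2 _ n2; have l2 := low2 _ n3.
  by split; move: hz l1 l2 ecd cd cdn; lra.
have gap' z : `|z| <= d -> g z + e < g (2 * d) /\ g z + e < g (- (2 * d)).
  move=> zd; have [g1 g2] := gap z zd.
  have dd : d <= `|2 * d| by rewrite (le_trans _ (ler_norm _))//; lra.
  have dd' : d <= `|- (2 * d)| by rewrite normrN.
  have [<- _] := agree _ dd; have [<- _] := agree _ dd'.
  have gz : g z <= h z by rewrite /g /mod_height gerDl; exact: phi_le0.
  by split; [apply: le_lt_trans g1|apply: le_lt_trans g2]; rewrite lerD2r.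
have inj u w : `|u| < r -> `|w| < r -> m u = m w -> u = w.
  have lt (a a' : R) : `|a| < r -> `|a'| < r -> a < a' -> m a < m a'.
    move=> ar ar' aa; have [_ S _] := W'; have /andP[+ _] := S _ _ ar ar' (ltW aa).
    have : 0 < l * (a' - a) by rewrite mulr_gt0// subr_gt0.
    by lra.
  move=> ur wr E; have [uw|wu|//] := ltgtP u w.
    by have := lt _ _ ur wr uw; rewrite E ltxx.
  by have := lt _ _ wr ur wu; rewrite E ltxx.
have bottom u z p' : `|z| < r -> u != 0 -> outer_normal C u (b.1 + z, b.2 + h z) ->
    outer_normal C' u p' -> (b.1 + z, b.2 + h z) = p' \/ cap b d h g (b.1 + z, b.2 + h z) p'.
  move=> zr u0 up up'.
  have [z' [z'r p'E sE]] := window_transfer sm sm' W W' l0 d0 dr agree zr u0 up up'.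
  have [dz|zd] := leP d `|z|.
    have [hg sm0] := agree _ dz; left; rewrite p'E hg.
    by rewrite (inj _ _ z'r zr) // -sE sm0.
  right; exists z, z'; split => //; first exact: ltW.
  rewrite leNgt; apply/negP => dz'; have [_ smz'] := agree _ (ltW dz').
  have s_inj : z = z'.
    have lt (a a' : R) : `|a| < r -> `|a'| < r -> a < a' -> s a < s a'.
      move=> ar ar' aa; have [_ S _] := W; have /andP[+ _] := S _ _ ar ar' (ltW aa).
      have : 0 < l * (a' - a) by rewrite mulr_gt0// subr_gt0.
      by lra.
    rewrite -smz' in sE; have [uw|wu|//] := ltgtP z z'.
      by have := lt _ _ zr z'r uw; rewrite sE ltxx.
    by have := lt _ _ z'r zr wu; rewrite sE ltxx.
  by rewrite s_inj ltNge (ltW dz') in zd.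
have dicho u p p' : u != 0 -> outer_normal C u p -> outer_normal C' u p' ->
    [\/ p = p', cap b d h g p p' | cap b d h g (- p) (- p')].
  move=> u0 up up'; have [t pE] := curve_boundary HC (normal_boundary Kc u0 up).
  have [B|T|[P _ _]] := case_of HC sC r0 G1 dr1 phi_out t.
  - have pl := lower_on HC G1 B; rewrite -pE in pl.
    rewrite pl in up; have := bottom _ _ _ B.2 u0 up up'; rewrite -pl.
    by case=> [E|cp]; [apply: Or31|apply: Or32].
  - have pl := upper_on HC sC G1 T; rewrite -pE in pl.
    have opp K (a a' : R * R) : origin_symmetric K -> outer_normal K a a' -> outer_normal K (- a) (- a').
      move=> sK [Ka H]; split; first exact: sK.
      by move=> w /sK/H; rewrite /dot/= !mulrNN; lra.
    have nu0' : - u != 0 by rewrite oppr_eq0.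
    have up2 := opp _ _ _ sC up; rewrite pl in up2.
    have := bottom _ _ _ T.2 nu0' up2 (opp _ _ _ sC' up'); rewrite -pl.
    by case=> [/oppr_inj E|cp]; [apply: Or31|apply: Or33].
  (* The half-plane of an unmodified point is kept, so this point still has the normal [u] in
     [C']. *)
  apply: Or31; apply: (sm'.1 u) => //; split; first by apply: CC'; exact: up.1.
  by move=> q [Hq _]; apply: Hq => //; rewrite pE.
apply: (@window_pm_close _ C C' b r l k (k * r) d e M h s g m) => //.
- by rewrite mulr_ge0// ltW.
- by move: ed2; lra.
- by exists q0.
- by exists q0; exact: CC'.
- exact: curve_finite HC.
- exact: curve_finite HC'.
Qed.

End perturbation.

(** * Density *)

Section density.
Context {R : realType}.

(** The tolerance [eps / 100] is shared equally: [nu * (40 * Z) ^+ 2 = eps] leaves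
    [nu * z ^+ 2 / 2 <= eps / 200] for the deviation from the parabola, and [tol] takes the other
    half. *)
Lemma model_close (eps c nu d z hz gz Z tol : R) : 0 < eps -> 0 < c -> 0 < d -> 0 <= nu ->
  nu * (40 * Z) ^+ 2 = eps -> `|z| <= 4 * Z ->
  c * (1 - nu) / 2 * (d * z) ^+ 2 <= hz <= c * (1 + nu) / 2 * (d * z) ^+ 2 ->
  `|gz - (hz - eps * c * d ^+ 2 * cubic_bump z)| <= tol ->
  tol <= eps / 200 * (c * d ^+ 2) ->
  `|gz / (c * d ^+ 2) - model eps z| <= eps / 100.
Proof.
move=> e0 c0 d0 nu0 nuE zZ /andP[h1 h2] hg ht.
have cd : 0 < c * d ^+ 2 by rewrite mulr_gt0// exprn_gt0.
have z2 : z ^+ 2 <= 16 * Z ^+ 2.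
  have -> : 16 * Z ^+ 2 = (4 * Z) ^+ 2 by ring.
  have Z0 : 0 <= 4 * Z by exact: le_trans (normr_ge0 z) zZ.
  by rewrite -(real_normK (num_real z)) ler_sqr ?nnegrE.
have nz : nu * z ^+ 2 <= eps / 100.
  have : nu * z ^+ 2 <= nu * (16 * Z ^+ 2) by rewrite ler_wpM2l.
  by move: nuE; lra.
have nz' : c * d ^+ 2 * (nu * z ^+ 2) <= c * d ^+ 2 * (eps / 100) by rewrite ler_pM2l.
have -> : gz / (c * d ^+ 2) - model eps z = (gz - c * d ^+ 2 * model eps z) / (c * d ^+ 2).
  by rewrite /model; field; rewrite !lt0r_neq0.
rewrite normrM normfV (gtr0_norm cd) ler_pdivrMr//.
move: hg; rewrite /model !ler_norml => /andP[g1 g2].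
move: (cubic_bump z) g1 g2 => B g1 g2.
by apply/andP; split; move: h1 h2 g1 g2 ht nz'; lra.
Qed.

(** From [k / l <= 1 + 20 * eps] and [mu <= eps] follow [a <= 1 + 22 * eps <= 2] and
    [(a - 1) * a <= 44 * eps]; the constant [88] leaves a factor [2] for strictness. *)
Lemma distortion_bound (eps mu c M tau : R) (k := c * (1 + 7 * eps)) (l := c * (1 - 7 * eps))
    (a := (1 + mu) * (k / l)) : 0 < eps -> eps <= 1 / 28 -> 0 < mu -> mu <= eps -> 0 < c ->
  0 < M -> 0 < tau -> 88 * M * eps <= tau -> 0 <= (a - 1) * a * M < tau.
Proof.
move=> eps0 eps1 mu0 mueps c0 M0 tau0 eps2; rewrite /a.
have l0 : 0 < l by rewrite /l mulr_gt0//; lra.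
have k0 : 0 < k by rewrite /k mulr_gt0//; lra.
have kl1 : 1 <= k / l by rewrite ler_pdivlMr// mul1r /k /l ler_pM2l//; lra.
have kl : k / l <= 1 + 20 * eps.
  rewrite ler_pdivrMr// /k /l mulrCA ler_pM2l//.
  have : eps * eps <= eps * (1 / 28) by rewrite ler_pM2l.
  by lra.
have a1 : 1 <= (1 + mu) * (k / l) by move: (k / l) kl1 => q qq; nra.
have a2 : (1 + mu) * (k / l) <= 1 + 22 * eps.
  have : (1 + mu) * (k / l) <= (1 + eps) * (1 + 20 * eps).
    by apply: ler_pM; move: kl1 kl; lra.
  have : eps * eps <= eps * (1 / 28) by rewrite ler_pM2l.
  by lra.
move: ((1 + mu) * (k / l)) a1 a2 => e a1 a2.
have a0 : 0 <= e by exact: le_trans ler01 a1.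
have a10 : 0 <= e - 1 by rewrite subr_ge0.
apply/andP; split; first by apply: mulr_ge0; [exact: mulr_ge0|exact: ltW].
have aa : (e - 1) * e <= 22 * eps * 2 by rewrite ler_pM//; lra.
have : (e - 1) * e * M <= 22 * eps * 2 * M by rewrite ler_pM2r.
by move: eps2 tau0; lra.
Qed.

Lemma perturbation (C : set (R * R)) (tau : R) : convex_disk C -> origin_symmetric C ->
  C2_positive_curvature C -> 0 < tau ->
  exists (C' : set (R * R)) (e : R), [/\ convex_disk C', origin_symmetric C',
    C2_positive_curvature C', 0 < e
  & [/\ exists2 t, 0 <= t < tau & pm_close t C C', (hausdorff1 (boundary C') < +oo)%E
      & forall D t, convex_disk D -> origin_symmetric D -> C2_positive_curvature D ->
          0 <= t < e -> pm_close t C' D -> ~ quadrangle_property D]].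
Proof.
move=> cC sC c2C tau0; have [L [x [y [x1 [y1 [x2 [y2 HC]]]]]]] := C2_curve cC c2C.
have [M M0 lipM] := gauss_lipschitz HC.
have [b [c [c0 Hloc]]] := local_graph HC.
pose eps := Num.min (1 / 28) (tau / (88 * M)).
have M88 : 0 < 88 * M by rewrite mulr_gt0// ltr0n.
have eps0 : 0 < eps by rewrite lt_min !divr_gt0.
have eps1 : eps <= 1 / 28 by rewrite ge_min lexx.
have eps2 : 88 * M * eps <= tau.
  by rewrite mulrC -ler_pdivlMr// ge_min lexx orbT.
clearbody eps.
pose Z := (1 / 2 + 2 * eps) / eps.
have eZ : eps * Z = 1 / 2 + 2 * eps by rewrite /Z mulrC divfK// gt_eqF.
have Z7 : 7 <= Z by rewrite /Z ler_pdivlMr//; lra.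
clearbody Z.
have Z0 : 0 < Z by lra.
pose nu := eps / (40 * Z) ^+ 2.
have q0 : 0 < (40 * Z) ^+ 2 by rewrite exprn_gt0// mulr_gt0// ltr0n.
have nu0 : 0 < nu by rewrite divr_gt0.
have nuE : nu * (40 * Z) ^+ 2 = eps by rewrite /nu divfK// gt_eqF.
have Z2 : 49 <= Z ^+ 2 by have := ler_pM _ _ Z7 Z7; rewrite expr2; lra.
have nu1 : nu <= eps by rewrite /nu ler_pdivrMr// ler_peMr// ?ltW//; lra.
clearbody nu.
have [|r0 [h [s [r00 N [h00 s00] G]]]] := Hloc nu; first by rewrite nu0/=; lra.
(* The first bound fits the window of radius [12 * Z * d] into the local graph. The second makes
   [mu] at most [eps] and [8 * mu ^+ 2 * (4 * Z * d)], the error of [window_stable], at most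
   [eps / 200] times [c * d ^+ 2]. *)
pose d := Num.min (r0 / (12 * Z)) (eps / (c * (200 * Z) ^+ 3)).
have Z12 : 0 < 12 * Z by rewrite mulr_gt0.
have Z3 : 0 < Z ^+ 3 by rewrite exprn_gt0.
have cZ : 0 < c * (200 * Z) ^+ 3 
  by apply: mulr_gt0; [exact: c0|apply: exprn_gt0; apply: mulr_gt0; [rewrite ltr0n|exact: Z0]].
have d0 : 0 < d by rewrite lt_min !divr_gt0.
have dr0 : 12 * Z * d <= r0 by rewrite mulrC -ler_pdivlMr// ge_min lexx.
have de : c * (200 * Z) ^+ 3 * d <= eps by rewrite mulrC -ler_pdivlMr// ge_min lexx orbT.
clearbody d.
(* The model is compared on radius [4 * Z * d], [window_stable] needs more than twice that, and [12]
   leaves a margin. *)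
pose r := 12 * Z * d.
have rp : 0 < r by rewrite /r mulr_gt0.
have ler0 (z : R) : `|z| <= r -> `|z| <= r0 by move=> /le_trans; apply.
have Zd : 7 * d <= Z * d by rewrite ler_pM2r.
have dr : 2 * d < r by rewrite /r; move: Zd d0; lra.
have := @perturbed_disk R C L x y x1 y1 x2 y2 HC sC b c nu eps r d M h s c0 eps0 eps1 nu0 nu1 d0 dr
  (fun z zr => N z (ler0 _ zr)) h00 s00 (fun z w zr wr => G z w (ler0 _ zr) (ler0 _ wr)) M0 lipM.
set k := c * (1 + 7 * eps); set l := c * (1 - 7 * eps).
move=> [C' [g [m [y' [y1' [y2' [HC' sC' W gE close]]]]]]].
have l0 : 0 < l by rewrite /l mulr_gt0//; lra.
have k0 : 0 < k by rewrite /k mulr_gt0//; lra.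
have ce : c * eps <= c * (1 / 28) by rewrite ler_pM2l.
have k2c : k <= 2 * c by rewrite /k; move: ce; lra.
pose mu := k * r.
have mu0 : 0 < mu by rewrite /mu mulr_gt0.
have cZd : 0 < c * Z * d by exact: mulr_gt0 (mulr_gt0 c0 Z0) d0.
have mu24 : mu <= 24 * (c * Z * d).
  have : k * r <= 2 * c * r by rewrite ler_wpM2r// ltW.
  by rewrite /mu /r; lra.
have Zc : c * Z * d <= c * Z ^+ 3 * d.
  rewrite ler_pM2r// ler_pM2l// exprS ler_peMr ?(ltW Z0)//; lra.
have mueps : mu <= eps by move: mu24 de Zc cZd; lra.
have mu4 : mu <= 1 / 4 by lra.
(* The radius is chosen for the hypothesis [t * k <= mu] of [window_stable]. *)
exists C', (mu / k); split.
- by case: HC'.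
- exact: sC'.
- exact: curve_C2 HC'.
- exact: divr_gt0.
split.
- exists (((1 + mu) * (k / l) - 1) * ((1 + mu) * (k / l)) * M); last exact: close.
  exact: distortion_bound.
- exact: curve_finite HC'.
move=> D t cD sD c2D /andP[t0 tmu] CD.
have [L' [u [v [u1 [v1 [u2 [v2 HD]]]]]]] := C2_curve cD c2D.
have tk : t * k <= mu by rewrite -ler_pdivlMr// ltW.
have rho0 : 0 < 4 * Z * d by apply: mulr_gt0 => //; exact: mulr_gt0.
have rhor : 2 * (4 * Z * d) < r by rewrite /r; move: rho0; lra.
have [c' [f Hf]] := window_stable HC' HD W l0 k0 mu0 mu4 rho0 rhor t0 tk CD.
have cd : 0 < c * d ^+ 2 by rewrite mulr_gt0// exprn_gt0.
have dz z : `|z| <= 4 * Z -> `|d * z| <= 4 * Z * d.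
  by move=> zZ; rewrite normrM (gtr0_norm d0) mulrC ler_pM2r.
apply: (@window_not_quadrangle R eps Z D c' d (c * d ^+ 2) (fun z => f (d * z) / (c * d ^+ 2))) => //.
- by lra.
- move=> z /dz/Hf[low _].
  by have -> : c * d ^+ 2 * (f (d * z) / (c * d ^+ 2)) = f (d * z) by rewrite mulrC divfK// gt_eqF.
move=> z zZ; have [_ cl] := Hf _ (dz _ zZ).
have dzr0 : `|d * z| <= r0.
  apply: (le_trans (dz _ zZ)); apply: le_trans dr0; rewrite ler_pM2r//; move: Z0; lra.
have z0r : `|0 : R| <= r0 by rewrite normr0 ltW.
have [_ hb] := G _ _ z0r dzr0; rewrite h00 s00 mul0r !subr0 in hb.
apply: (@model_close eps c nu d z (h (d * z)) (f (d * z)) Z (8 * mu ^+ 2 * (4 * Z * d))) => //.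
- exact: ltW.
- by move: cl; rewrite gE [d * z]mulrC mulfK// gt_eqF.
have mm : mu ^+ 2 <= (24 * (c * Z * d)) ^+ 2 by rewrite ler_sqr// nnegrE// ltW// mulr_gt0.
apply: (@le_trans _ _ (8 * (24 * (c * Z * d)) ^+ 2 * (4 * Z * d))).
  by rewrite ler_pM2r// ler_pM2l.
have : c * d ^+ 2 * (c * (200 * Z) ^+ 3 * d) <= c * d ^+ 2 * eps by rewrite ler_pM2l.
have : 0 < c ^+ 2 * Z ^+ 3 * d ^+ 3 by apply: mulr_gt0; [apply: mulr_gt0|]; exact: exprn_gt0.
by lra.
Qed.

End density.

(** * Residuality *)

Section topology.
Context {R : realType}.

Lemma open_pm_ball (C : sym_disk R) (e : R) : 0 < e -> open (pm_ball C e).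
Proof.
move=> e0; exists [set pm_ball C e]; last by rewrite bigcup_set1.
move=> _ ->; apply: finI_from1.
by exists C, e.
Qed.

Lemma open_K_o2plus (U : set (sym_disk R)) : open U ->
  open ((set_val : K_o2plus R -> sym_disk R) @^-1` U).
Proof. by move=> oU; exists U. Qed.

Lemma K_o2plus_open (O : set (K_o2plus R)) : open O ->
  exists2 U : set (sym_disk R), open U & O = (set_val : K_o2plus R -> sym_disk R) @^-1` U.
Proof. by move=> [U oU <-]; exists U. Qed.

Lemma K_o2plus_mk (E : sym_disk R) : C2_positive_curvature E ->
  exists C : K_o2plus R, set_val C = E.
Proof. by move=> H; exists (SigSub (mem_set H : E \in K_o2plus R)). Qed.

Lemma K_o2plus_val (C : K_o2plus R) : C2_positive_curvature (set_val C : sym_disk R).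
Proof. exact: (set_valP C). Qed.
End topology.

Theorem theorem2 (R : realType) :
  residual [set C : K_o2plus R | ~ quadrangle_property (set_val C : sym_disk R)].
Proof.
set A := [set C : K_o2plus R | _].
(* The set itself has dense interior, so a constant sequence suffices. *)
exists (fun=> A); split; last by rewrite bigcap_const//; exists 0%N.
move=> _ O [C OC] /K_o2plus_open[U oU OE].
rewrite OE in OC; have [tau tau0 Htau] := open_sym_disk_pm oU OC.
have [cC sC] := sym_diskP (set_val C).
have [C' [e [cC' sC' c2C' e0 [[t tt CC'] finC' Hbad]]]] :=
  perturbation cC sC (K_o2plus_val C) tau0.
have [C2 C2E] := @K_o2plus_mk R (SymDisk (conj cC' sC')) c2C'.
exists C2; split.
  rewrite OE /preimage/= C2E; apply: Htau; apply/pm_distance_lt.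
  by exists t.
have oB := open_K_o2plus (open_pm_ball (SymDisk (conj cC' sC')) e0).
suff sBA : (set_val : K_o2plus R -> sym_disk R) @^-1` (pm_ball (SymDisk (conj cC' sC')) e) `<=` A.
  move: sBA; rewrite (open_subsetE _ oB); apply.
  (* That the centre lies in its own ball uses the finiteness of its perimeter. *)
  rewrite /preimage/= C2E; apply/pm_distance_lt; exists 0; first by rewrite lexx.
  apply: pm_close_refl => // sigma.
  rewrite ge0_fin_numE ?hausdorff1_ge0//; apply: le_lt_trans finC'.
  by apply: le_hausdorff1 => p [].
move=> D /= /pm_distance_lt[t' tt' CD].
have [cD sD] := sym_diskP (set_val D).
exact: Hbad cD sD (K_o2plus_val D) tt' CD.
Qed.
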